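(* Let $m,n$ be positive integers and let $p$ be a positive multiple of $n$. Let $f:\{-1,1\}^m\to M_n(\mathbb{C})$ satisfy $\|f(\sigma)\|\le1$ for all $\sigma\in\{-1,1\}^m$. Let $0<\rho<1$ and let $\tau:=\max_{i=1,\dots,m}\mathrm{Inf}_if$, with $\tau>0$. Let $\mathcal{G}$ be a distribution on $M_n(\mathbb{C})$ such that $G\sim\mathcal{G}$ satisfies $\mathbb{E}G=0$, $\mathbb{E}GG^*=I$, $\|\mathbb{E}(GG^* )^2\|\le c_2$ and $\|\mathbb{E}(GG^* )^3\|\le c_3$ for some $c_2,c_3\ge1$. Then $\frac1n\|Q_f\|_{L_2,\mathcal{G}}^2\le1$ and $$\frac1n\big\|T_\rho Q_f^{\iota}-\mathrm{Chop}\,T_\rho Q_f^{\iota}\big\|_{L_2,\mathcal{G}}^2\le10\,n^{1/2}\,\tau^{\frac{1-\rho}{30c_2c_3}}+O_{m,n}(\tau^{-1/3}p^{-1/2}).$$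
   Context: For $f:\{-1,1\}^m\to M_n(\mathbb{C})$ and $S\subseteq\{1,\dots,m\}$, $\widehat{f}(S)=2^{-m}\sum_{\sigma\in\{-1,1\}^m}f(\sigma)\prod_{i\in S}\sigma_i\in M_n(\mathbb{C})$. The influences are $\mathrm{Inf}_if=\sum_{S:\,i\in S}\mathrm{Tr}(\widehat{f}(S)\widehat{f}(S)^* )$. The noncommutative multilinear polynomial associated to $f$ is $Q_f(X_1,\dots,X_m)=\sum_{S\subseteq\{1,\dots,m\}}\widehat{f}(S)\prod_{i\in S}X_i$, with noncommuting matrix variables and products in increasing order of the index. For $A\in M_n(\mathbb{C})$, $\iota(A)=\begin{pmatrix}A&0\\0&0\end{pmatrix}\in M_p(\mathbb{C})$; $Q_f^{\iota}(X_1,\dots,X_m)=\sum_S\iota(\widehat{f}(S))\prod_{i\in S}X_i$ and $T_\rho Q_f^{\iota}(X_1,\dots,X_m)=\sum_S\rho^{|S|}\iota(\widehat{f}(S))\prod_{i\in S}X_i$ for $p\times p$ matrix variables $X_i$. $\mathrm{Chop}:\mathbb{R}\to\mathbb{R}$ is $\mathrm{Chop}(t)=t$ for $|t|\le1$, $\mathrm{Chop}(t)=1$ for $t\ge1$, $\mathrm{Chop}(t)=-1$ for $t\le-1$. It is applied to a (not necessarily Hermitian) matrix through its singular values: if $A=U\Sigma V^*$ is a singular value decomposition then $\mathrm{Chop}\,A=U\,\mathrm{Chop}(\Sigma)V^*$; it is applied to the matrix value of the polynomial. $G_i\sim\mathcal{G}\otimes I$: $G_i=G_i'\otimes I_{p/n}\in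 M_p(\mathbb{C})$ with $G_1',\dots,G_m'$ i.i.d. of distribution $\mathcal{G}$. $H_i\sim\mathcal{H}_p$: independent $p\times p$ Haar-distributed random unitary matrices, independent of the $G_i$. With $|A|=(AA^* )^{1/2}$ and unnormalized trace, $\|Q_f\|_{L_2,\mathcal{G}}=\big(\mathbb{E}_{G_i\sim\mathcal{G}\otimes I,H_i\sim\mathcal{H}_p}\mathrm{Tr}\,|Q_f^{\iota}(G_1H_1,\dots,G_mH_m)|^2\big)^{1/2}$, and for a function $F$ of $p\times p$ matrix variables with values in $M_p(\mathbb{C})$, $\|F\|_{L_2,\mathcal{G}}=\big(\mathbb{E}\,\mathrm{Tr}\,|F(G_1H_1,\dots,G_mH_m)|^2\big)^{1/2}$ with the same expectation. $\|A\|$ without subscript is the operator norm. $a\le O_c(b)$ means that $a\le C(c)b$ for a constant $C(c)>0$ depending on $c$. *)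

(* Defs.v *)
From HB Require Import structures.
From mathcomp Require Import all_boot all_order all_algebra.
From mathcomp Require Import sesquilinear spectral complex.
From mathcomp Require mxtens.
From mathcomp Require Import all_classical all_reals all_analysis.
From mathcomp Require Import ring.

Set Implicit Arguments.
Unset Strict Implicit.
Unset Printing Implicit Defensive.

Import Order.TTheory GRing.Theory Num.Theory.
Local Open Scope classical_set_scope.
Local Open Scope ring_scope.
Local Open Scope complex_scope.
Local Open Scope sesquilinear_scope.

Lemma mx_sandwich {K : pzRingType} {n : nat}
    (U1 D1 V1 V1' U2 U2' D2 V2' : 'M[K]_n) :
  U2' *m U2 = 1%:M -> V1' *m V1 = 1%:M ->
  U1 *m D1 *m V1' = U2 *m D2 *m V2' ->
  U2' *m U1 *m D1 = D2 *m (V2' *m V1).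
Proof.
move=> eU eV /(congr1 (fun M => U2' *m M *m V1)).
by rewrite !mulmxA eU mul1mx -!mulmxA eV mulmx1.
Qed.

Lemma mx_unsandwich {K : pzRingType} {n : nat}
    (U1 D1 V1 V1' U2 U2' D2 V2' : 'M[K]_n) :
  U2 *m U2' = 1%:M -> V1 *m V1' = 1%:M ->
  U2' *m U1 *m D1 = D2 *m (V2' *m V1) ->
  U1 *m D1 *m V1' = U2 *m D2 *m V2'.
Proof.
move=> eU eV /(congr1 (fun M => U2 *m M *m V1')).
by rewrite !mulmxA eU mul1mx => ->; rewrite -!mulmxA eV mulmx1.
Qed.

Section MatrixAnalysis.
Context {R : realType}.

Definition vnorm {n : nat} (v : 'cV[R[i]]_n) : R :=
  Num.sqrt (\sum_(i < n) (complex.Re (v i 0) ^+ 2 + complex.Im (v i 0) ^+ 2)).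

Definition opnorm {n : nat} (A : 'M[R[i]]_n) : R :=
  sup [set vnorm (A *m v) | v in [set v : 'cV[R[i]]_n | vnorm v <= 1]].

(* |A| = (A A^* )^(1/2) by the functional calculus of A A^*: sqrtC is the
   nonnegative square root on its (nonnegative) eigenvalues. *)
Definition absmx {n : nat} (A : 'M[R[i]]_n) : 'M[R[i]]_n :=
  let B := A *m A ^t* in
  invmx (spectralmx B) *m diag_mx (map_mx sqrtC (spectral_diag B))
    *m spectralmx B.

Lemma absmx_sqr {n : nat} (A : 'M[R[i]]_n) : absmx A ^+ 2 = A *m A ^t*.
Proof.
rewrite /absmx; set B := A *m A ^t*.
have nB : B \is normalmx.
  apply/normalmxP; suff -> : B ^t* = B by [].
  by rewrite /B trmx_mul map_mxM trmxCK.
have /orthomx_spectralP eB := nB; rewrite [RHS]eB.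
have uB := spectral_unit B.
rewrite expr2 -!mulmxE !mulmxA (mulmxK uB)
  -(mulmxA (invmx (spectralmx B)) (diag_mx _) (diag_mx _))
  mulmx_diag.
have -> : \row_j (map_mx sqrtC (spectral_diag B) 0 j *
    map_mx sqrtC (spectral_diag B) 0 j) = spectral_diag B; last by [].
by apply/rowP => j; rewrite !mxE -expr2 sqrtCK.
Qed.

Definition trabs2 {n : nat} (A : 'M[R[i]]_n) : R := complex.Re (\tr (absmx A ^+ 2)).

Definition chop (t : R) : R :=
  if 1 <= t then 1 else if t <= -1 then -1 else t.

Definition is_svd {n : nat} (A U : 'M[R[i]]_n) (s : 'rV[R]_n)
    (V : 'M[R[i]]_n) : Prop :=
  [/\ U \is unitarymx, V \is unitarymx, (forall j, 0 <= s 0 j) &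
      A = U *m diag_mx (map_mx (real_complex R) s) *m V ^t*].

(* The value does not depend on the singular value decomposition of A
   (chop_svd_unique, chopmx_svd); as one always exists, the default 0 of xget is
   never used. *)
Definition chopmx {n : nat} (A : 'M[R[i]]_n) : 'M[R[i]]_n :=
  xget 0 [set B | exists U s V, is_svd A U s V /\
    B = U *m diag_mx (map_mx (real_complex R \o chop) s) *m V ^t*].

Lemma chop_svd_unique {n : nat} (A U1 : 'M[R[i]]_n) s1 V1 U2 s2 V2 :
  is_svd A U1 s1 V1 -> is_svd A U2 s2 V2 ->
  U1 *m diag_mx (map_mx (real_complex R \o chop) s1) *m V1 ^t* =
  U2 *m diag_mx (map_mx (real_complex R \o chop) s2) *m V2 ^t*.
Proof.
move=> [uU1 uV1 s1_ge0 ->] [uU2 uV2 s2_ge0 eqA].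
have uK (U : 'M[R[i]]_n) : U \is unitarymx -> U ^t* *m U = 1%:M.
  by move=> uU; rewrite -(invmx_unitary uU) mulVmx ?unitarymx_unit.
have uK' (U : 'M[R[i]]_n) : U \is unitarymx -> U *m U ^t* = 1%:M.
  by move/unitarymxP.
pose D (s : 'rV[R]_n) := diag_mx (map_mx (real_complex R) s).
pose W := U2 ^t* *m U1; pose Z := V2 ^t* *m V1.
have adj (A1 A2 : 'M[R[i]]_n) : (A1 *m A2) ^t* = A2 ^t* *m A1 ^t*.
  by rewrite trmx_mul map_mxM.
have adjD s : (D s) ^t* = D s.
  apply/matrixP => i j; rewrite !mxE [j == i]eq_sym.
  case: eqP => [->|_]; rewrite ?mulr0n ?conjC0 // !mulr1n.
  by apply: CrealP; apply/complex_realP; exists (s 0 j).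
have eWZ : W *m D s1 = D s2 *m Z.
  exact: mx_sandwich (uK _ uU2) (uK _ uV1) eqA.
have eZW : Z *m D s1 = D s2 *m W.
  apply: (mx_sandwich (uK _ uV2) (uK _ uU1)).
  have := congr1 (fun M : 'M[R[i]]_n => M ^t*) eqA.
  by rewrite !adj !trmxCK -!/(D _) !adjD !mulmxA.
have eC : W *m diag_mx (map_mx (real_complex R \o chop) s1) =
          diag_mx (map_mx (real_complex R \o chop) s2) *m Z.
  move: eWZ eZW; move: W Z => W Z /matrixP eWZ /matrixP eZW.
  apply/matrixP => i j; move: (eZW i j) (eWZ i j).
  rewrite !mul_mx_diag !mul_diag_mx !mxE /=; set w := W i j; set z := Z i j.
  move=> e1 e2.
  have dw : (w - z) * (s1 0 j + s2 0 i)%:C = 0.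
    by rewrite rmorphD /= mulrDr !mulrBl e1 e2 ![_%:C * _]mulrC; ring.
  have sw : (w + z) * (s1 0 j - s2 0 i)%:C = 0.
    by rewrite rmorphB /= mulrBr !mulrDl e1 e2 ![_%:C * _]mulrC; ring.
  have inj (x : R) : x%:C = 0 -> x = 0 by move=> [].
  move/eqP: dw; rewrite mulf_eq0 => /orP[|/eqP/inj s0].
    rewrite subr_eq0 => /eqP wz; rewrite -wz mulrC.
    move/eqP: sw; rewrite -wz mulf_eq0 => /orP[|/eqP/inj/eqP].
      by rewrite -mulr2n mulrn_eq0 /= => /eqP ->; rewrite !mulr0.
    by rewrite subr_eq0 => /eqP ->.
  have [/eqP a0 /eqP b0] : (s1 0 j == 0) /\ (s2 0 i == 0).
    by apply/andP; rewrite -paddr_eq0 ?s0.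
  by rewrite a0 b0 /chop ler10 lerNr oppr0 ler10 mulr0 mul0r.
exact: mx_unsandwich (uK' _ uU2) (uK' _ uV1) eC.
Qed.

Lemma chopmx_svd {n : nat} (A U : 'M[R[i]]_n) s V : is_svd A U s V ->
  chopmx A = U *m diag_mx (map_mx (real_complex R \o chop) s) *m V ^t*.
Proof.
move=> svd; rewrite /chopmx; case: xgetP => [B _ /= [U' [s' [V' [svd' ->]]]]|].
  exact: chop_svd_unique svd' svd.
by move=> /(_ (U *m diag_mx (map_mx (real_complex R \o chop) s) *m V ^t*))[];
  exists U, s, V.
Qed.

(* [pid_mx n : 'M_(p, n)] is the inclusion of C^n as the first n coordinates
   of C^p, so that this is the matrix with upper left block A and zeros
   elsewhere. *)
Definition iotamx {n : nat} (p : nat) (A : 'M[R[i]]_n) : 'M[R[i]]_p :=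
  (pid_mx n : 'M[R[i]]_(p, n)) *m A *m (pid_mx n : 'M[R[i]]_(n, p)).

Lemma iotamx_block {n q : nat} (A : 'M[R[i]]_n) :
  iotamx (n + q) A = block_mx A 0 0 0.
Proof.
by rewrite /iotamx pid_mx_col pid_mx_row mul_col_mx mul1mx mul0mx
  mul_mx_row mulmx1 mulmx0 block_mxEh col_mx0.
Qed.

End MatrixAnalysis.

Section Fourier.
Context {R : realType} {m n : nat}.

(* The point sigma of {-1,1}^m is encoded by the booleans b_i with
   sigma_i = (-1)^(b_i). *)
Definition fhat (f : {ffun 'I_m -> bool} -> 'M[R[i]]_n) (S : {set 'I_m}) :
    'M[R[i]]_n :=
  (2 ^+ m)^-1 *: \sum_(b : {ffun 'I_m -> bool})
    (\prod_(i in S) (-1) ^+ b i) *: f b.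

Definition influence (f : {ffun 'I_m -> bool} -> 'M[R[i]]_n) (i : 'I_m) : R :=
  \sum_(S : {set 'I_m} | i \in S) complex.Re (\tr (fhat f S *m (fhat f S) ^t*)).

(* Influences are nonnegative, so starting the maximum at 0 is harmless when
   m > 0. *)
Definition maxInf (f : {ffun 'I_m -> bool} -> 'M[R[i]]_n) : R :=
  \big[Num.max/0]_(i < m) influence f i.

(* The product follows the enumeration of 'I_m, hence increasing indices. *)
Definition TQiota (p : nat) (rho : R) (f : {ffun 'I_m -> bool} -> 'M[R[i]]_n)
    (X : 'I_m -> 'M[R[i]]_p) : 'M[R[i]]_p :=
  \sum_(S : {set 'I_m})
    (rho ^+ #|S|)%:C *: (iotamx p (fhat f S) *m \prod_(i < m | i \in S) X i).

Definition Qiota (p : nat) (f : {ffun 'I_m -> bool} -> 'M[R[i]]_n)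
    (X : 'I_m -> 'M[R[i]]_p) : 'M[R[i]]_p :=
  \sum_(S : {set 'I_m}) iotamx p (fhat f S) *m \prod_(i < m | i \in S) X i.

End Fourier.

(* Complex matrices with the Borel sigma-algebra of C^(n x n) = R^(2 n^2),
   generated by the real and imaginary parts of the entries. *)
Definition cmx (R : realType) (n : nat) : Type := 'M[R[i]]_n.

HB.instance Definition _ (R : realType) (n : nat) :=
  Choice.copy (cmx R n) 'M[R[i]]_n.
HB.instance Definition _ (R : realType) (n : nat) :=
  isPointed.Build (cmx R n) (0 : 'M[R[i]]_n).

Definition mx_cylinder (R : realType) (n : nat) : set (set (cmx R n)) :=
  [set A | exists i j (B : set R), measurable B /\
    (A = [set M : 'M[R[i]]_n | B (complex.Re (M i j))] \/
     A = [set M : 'M[R[i]]_n | B (complex.Im (M i j))])].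

HB.instance Definition _ (R : realType) (n : nat) :=
  @isMeasurable.Build (sigma_display (@mx_cylinder R n)) (cmx R n)
    <<s @mx_cylinder R n >> (@sigma_algebra0 _ setT _)
    (@sigma_algebraC _ _) (@sigma_algebra_bigcup _ setT _).

Section RandomMatrices.
Context {R : realType}.

Definition mx_integrable d (T : measurableType d) (mu : probability T R)
    {n : nat} (F : T -> 'M[R[i]]_n) : Prop :=
  forall i j, mu.-integrable setT (EFin \o (fun x => complex.Re (F x i j))) /\
              mu.-integrable setT (EFin \o (fun x => complex.Im (F x i j))).

Definition mx_expectation d (T : measurableType d) (mu : probability T R)
    {n : nat} (F : T -> 'M[R[i]]_n) : 'M[R[i]]_n :=
  \matrix_(i, j) (Rintegral mu setT (fun x => complex.Re (F x i j)) +i*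
                  Rintegral mu setT (fun x => complex.Im (F x i j))).

(* Rintegral is total: each moment is therefore assumed to exist before its
   value is constrained. *)
Definition moment_conditions {n : nat} (c2 c3 : R)
    (mu : probability (cmx R n) R) : Prop :=
  let GGs (A : cmx R n) : 'M[R[i]]_n := (A : 'M[R[i]]_n) *m A ^t* in
  [/\ mx_integrable mu (fun A : cmx R n => A : 'M[R[i]]_n) /\
        mx_expectation mu (fun A : cmx R n => A : 'M[R[i]]_n) = 0,
      mx_integrable mu GGs /\ mx_expectation mu GGs = 1%:M,
      mx_integrable mu (fun A => GGs A ^+ 2) /\
        opnorm (mx_expectation mu (fun A => GGs A ^+ 2)) <= c2 &
      mx_integrable mu (fun A => GGs A ^+ 3) /\
        opnorm (mx_expectation mu (fun A => GGs A ^+ 3)) <= c3].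

Definition is_haar {p : nat} (mu : probability (cmx R p) R) : Prop :=
  mu [set U : cmx R p | (U : 'M[R[i]]_p) \is unitarymx] = 1%E /\
  forall (V : 'M[R[i]]_p) (A : set (cmx R p)), V \is unitarymx ->
    measurable A ->
    mu [set U : cmx R p | A (V *m U)] = mu A /\
    mu [set U : cmx R p | A ((U : 'M[R[i]]_p) *m V)] = mu A.

Definition mutually_independent d (T : measurableType d)
    (P : probability T R) (I : finType) (F : I -> set (set T)) : Prop :=
  forall (E : I -> set T), (forall i, F i (E i)) ->
  forall J : {set I},
    P (\bigcap_(i in [set` J]) E i) =
    (\prod_(i in J) fine (P (E i)))%:E.

Definition sigma_of d (T : measurableType d) d' (T' : measurableType d')
    (X : T -> T') : set (set T) := [set X @^-1` A | A in measurable].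

Definition GH_model d (T : measurableType d) (P : probability T R)
    {m n k : nat} (calG : probability (cmx R n) R)
    (G : 'I_m -> {RV P >-> cmx R n}) (H : 'I_m -> {RV P >-> cmx R (n * k)%N}) :
    Prop :=
  [/\ forall i (A : set (cmx R n)), measurable A ->
        distribution P (G i) A = calG A,
      forall i, is_haar (distribution P (H i)) &
      mutually_independent P (fun i : 'I_m + 'I_m =>
        match i with inl a => sigma_of (G a) | inr b => sigma_of (H b) end)].

Definition GH d (T : measurableType d) (P : probability T R) {m n k : nat}
    (G : 'I_m -> {RV P >-> cmx R n}) (H : 'I_m -> {RV P >-> cmx R (n * k)%N})
    (i : 'I_m) (w : T) : 'M[R[i]]_(n * k) :=
  mxtens.tensmx (G i w : 'M[R[i]]_n) (1%:M : 'M[R[i]]_k) *m H i w.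

Definition L2norm d (T : measurableType d) (P : probability T R) {m p : nat}
    (X : 'I_m -> T -> 'M[R[i]]_p) (F : ('I_m -> 'M[R[i]]_p) -> 'M[R[i]]_p) :
    \bar R :=
  ('E_P[fun w => trabs2 (F (X ^~ w))] `^ 2^-1)%E.

End RandomMatrices.

(* Main.v *)
Require Import Defs.
From HB Require Import structures.
From mathcomp Require Import all_boot all_order all_algebra.
From mathcomp Require Import perm sesquilinear spectral complex.
From mathcomp Require mxtens.
From mathcomp Require Import all_classical all_reals all_analysis.
From mathcomp Require Import measurable_realfun.
From mathcomp Require Import ring lra.

Set Implicit Arguments.
Unset Strict Implicit.
Unset Printing Implicit Defensive.

Import Order.TTheory GRing.Theory Num.Theory.
Local Open Scope classical_set_scope.
Local Open Scope ring_scope.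
Local Open Scope complex_scope.
Local Open Scope sesquilinear_scope.

(* Let M_S be the product of the X_i = G_i H_i over S, in increasing order, and Q the
   part of T_rho Q_f of degree at most d. In Q Q^* the off-diagonal terms
   f^(S) M_S M_S'^* f^(S')^*, S <> S', contain a Haar unitary that occurs in only one
   of the two factors, so that their second moments are O(1/p). The diagonal part has
   mean sum_S rho^(2|S|) f^(S) f^(S)^* <= I by Parseval, and it is a martingale in the
   G_i whose i-th increment has second moment at most (3 c2)^d times the square of the
   i-th influence. Hence Q Q^* is close to a matrix below I in Frobenius norm, and so
   only few and small singular values of Q exceed 1. The part of degree larger than d
   is damped by rho, and d is a small multiple of ln (1 / tau). As
   tau^((1 - rho) / (30 c2 c3)) is not small unless c2 = O(ln (1 / tau)), the powers of
   c2 in the O(1/p) term are absorbed by tau^(-1/3). *)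

(** The obstacle is that every bound has to be free of the dimension [p]. Two facts provide this.
    The projection onto the corner of size [n] fixes [Q], so at most [n] singular values are
    positive and the excess over 1 is paid [n] times, not [p] times. And where submultiplicativity
    of the Frobenius norm would lose a power of [p] on [V W W^*], integrating out the Haar factors
    of [W] one by one spreads [W W^*] evenly, at the price [3 c2] per variable. Haar integrals are
    only bounded from above, by averaging over signs and transpositions, so that no exact moment
    formula enters.

    An error [e] of [Q Q^*] costs [e^2 / t + t] in the excess of a singular value. The parameter [t]
    is the sum of the target [tau^th], where [th] is [(1 - rho) / (30 c2 c3)], and of the square
    root of the [1/p] error. Hence the power [p^(-1/2)], and hence the need for a diagonal error
    below the square of the target. If [th ln (1 / tau)] is at most 1/2, the target is at least 1/2
    and a trivial bound suffices. *)

Section ComplexParts.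
Context {R : realType}.
Implicit Types z w : R[i].

Lemma ReD z w : complex.Re (z + w) = complex.Re z + complex.Re w.
Proof. by case: z w => [a b] [c d]. Qed.

Lemma ImD z w : complex.Im (z + w) = complex.Im z + complex.Im w.
Proof. by case: z w => [a b] [c d]. Qed.

Lemma ReN z : complex.Re (- z) = - complex.Re z.
Proof. by case: z. Qed.

Lemma ImN z : complex.Im (- z) = - complex.Im z.
Proof. by case: z. Qed.

Lemma ReM z w :
  complex.Re (z * w) = complex.Re z * complex.Re w - complex.Im z * complex.Im w.
Proof. by case: z w => [a b] [c d]. Qed.

Lemma ImM z w :
  complex.Im (z * w) = complex.Re z * complex.Im w + complex.Im z * complex.Re w.
Proof. by case: z w => [a b] [c d]. Qed.

Lemma ReJ z : complex.Re (Num.conj z) = complex.Re z.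
Proof. by case: z. Qed.

Lemma ImJ z : complex.Im (Num.conj z) = - complex.Im z.
Proof. by case: z. Qed.

Lemma Re_sum (I : Type) (r : seq I) (P : pred I) (F : I -> R[i]) :
  complex.Re (\sum_(i <- r | P i) F i) = \sum_(i <- r | P i) complex.Re (F i).
Proof. by apply: (big_morph (@complex.Re R)) => //; apply: ReD. Qed.

Lemma Im_sum (I : Type) (r : seq I) (P : pred I) (F : I -> R[i]) :
  complex.Im (\sum_(i <- r | P i) F i) = \sum_(i <- r | P i) complex.Im (F i).
Proof. by apply: (big_morph (@complex.Im R)) => //; apply: ImD. Qed.

Lemma complex_eq z w :
  complex.Re z = complex.Re w -> complex.Im z = complex.Im w -> z = w.
Proof. by case: z w => [a b] [c d] /= -> ->. Qed.

End ComplexParts.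

(** * Frobenius norm and real inner product of complex matrices *)

Section Frobenius.
Context {R : realType}.
Notation C := R[i].

Definition sqn (z : C) : R := complex.Re z ^+ 2 + complex.Im z ^+ 2.

Definition cip (z w : C) : R :=
  complex.Re z * complex.Re w + complex.Im z * complex.Im w.

Definition nsq {a b} (A : 'M[C]_(a, b)) : R := \sum_i \sum_j sqn (A i j).

(** The real part of the Hilbert-Schmidt inner product [Tr A B^*], see [ip_tr]. Dropping the
    imaginary part makes it a symmetric real bilinear form, so that squares expand as in a Euclidean
    space. *)
Definition ip {a b} (A B : 'M[C]_(a, b)) : R := \sum_i \sum_j cip (A i j) (B i j).

Lemma sqn_ge0 z : 0 <= sqn z.
Proof. by rewrite addr_ge0 ?sqr_ge0. Qed.

Lemma sqnM z w : sqn (z * w) = sqn z * sqn w.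
Proof. by rewrite /sqn ReM ImM; ring. Qed.

Lemma sqnJ z : sqn (Num.conj z) = sqn z.
Proof. by rewrite /sqn ReJ ImJ sqrrN. Qed.

Lemma sqn_real (x : R) : sqn x%:C = x ^+ 2.
Proof. by rewrite /sqn /= expr0n addr0. Qed.

Lemma sqn0 : sqn 0 = 0.
Proof. by rewrite (sqn_real 0) expr0n. Qed.

Lemma sqn_eq0 z : sqn z = 0 -> z = 0.
Proof.
move/eqP; rewrite paddr_eq0 ?sqr_ge0// !sqrf_eq0 => /andP[/eqP ? /eqP ?].
exact: complex_eq.
Qed.

Lemma ipC {a b} (A B : 'M[C]_(a, b)) : ip A B = ip B A.
Proof.
by apply: eq_bigr => i _; apply: eq_bigr => j _; rewrite /cip; ring.
Qed.

Lemma ipDl {a b} (A A' B : 'M[C]_(a, b)) : ip (A + A') B = ip A B + ip A' B.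
Proof.
rewrite /ip -big_split /=; apply: eq_bigr => i _.
rewrite -big_split /=; apply: eq_bigr => j _.
by rewrite mxE /cip ReD ImD; ring.
Qed.

Lemma ipNl {a b} (A B : 'M[C]_(a, b)) : ip (- A) B = - ip A B.
Proof.
rewrite /ip -sumrN; apply: eq_bigr => i _.
rewrite -sumrN; apply: eq_bigr => j _.
by rewrite mxE /cip ReN ImN; ring.
Qed.

Lemma ipZl {a b} (t : R) (A B : 'M[C]_(a, b)) : ip (t%:C *: A) B = t * ip A B.
Proof.
rewrite /ip mulr_sumr; apply: eq_bigr => i _.
rewrite mulr_sumr; apply: eq_bigr => j _.
by rewrite mxE /cip ReM ImM /=; ring.
Qed.

Lemma ipDr {a b} (A B B' : 'M[C]_(a, b)) : ip A (B + B') = ip A B + ip A B'.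
Proof. by rewrite ipC ipDl !(ipC _ A). Qed.

Lemma ipNr {a b} (A B : 'M[C]_(a, b)) : ip A (- B) = - ip A B.
Proof. by rewrite ipC ipNl ipC. Qed.

Lemma ipZr {a b} (t : R) (A B : 'M[C]_(a, b)) : ip A (t%:C *: B) = t * ip A B.
Proof. by rewrite ipC ipZl ipC. Qed.

Lemma ip0l {a b} (B : 'M[C]_(a, b)) : ip 0 B = 0.
Proof. by have /eqP := ipDl 0 0 B; rewrite addr0 -subr_eq subrr => /eqP. Qed.

Lemma ip_suml {a b} (I : Type) (r : seq I) (P : pred I)
    (F : I -> 'M[C]_(a, b)) B :
  ip (\sum_(i <- r | P i) F i) B = \sum_(i <- r | P i) ip (F i) B.
Proof. exact: (big_morph (ip^~ B) (fun x y => ipDl x y B) (ip0l B)). Qed.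

Lemma ip_sumr {a b} (I : Type) (r : seq I) (P : pred I)
    (F : I -> 'M[C]_(a, b)) B :
  ip B (\sum_(i <- r | P i) F i) = \sum_(i <- r | P i) ip B (F i).
Proof. by rewrite ipC ip_suml; apply: eq_bigr => i _; rewrite ipC. Qed.

Lemma ipxx {a b} (A : 'M[C]_(a, b)) : ip A A = nsq A.
Proof. by apply: eq_bigr => i _; apply: eq_bigr => j _; rewrite /cip -!expr2. Qed.

Lemma nsq_ge0 {a b} (A : 'M[C]_(a, b)) : 0 <= nsq A.
Proof. by apply: sumr_ge0 => i _; apply: sumr_ge0 => j _; apply: sqn_ge0. Qed.

Lemma nsq0 {a b} : nsq (0 : 'M[C]_(a, b)) = 0.
Proof. by rewrite -ipxx ip0l. Qed.

Lemma nsq_eq0 {a b} (A : 'M[C]_(a, b)) : nsq A = 0 -> A = 0.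
Proof.
move=> A0; apply/matrixP => i j; rewrite mxE; apply: sqn_eq0.
have r0 (k : 'I_a) : 0 <= \sum_l sqn (A k l).
  by apply: sumr_ge0 => l _; apply: sqn_ge0.
have /(_ i isT) := psumr_eq0P (fun k _ => r0 k) A0.
by move/(psumr_eq0P (fun l _ => sqn_ge0 (A i l))) => ->.
Qed.

Lemma nsqD {a b} (A B : 'M[C]_(a, b)) : nsq (A + B) = nsq A + 2 * ip A B + nsq B.
Proof. by rewrite -!ipxx ipDl !ipDr (ipC B A); ring. Qed.

Lemma nsqN {a b} (A : 'M[C]_(a, b)) : nsq (- A) = nsq A.
Proof. by rewrite -!ipxx ipNl ipNr opprK. Qed.

Lemma nsqZ {a b} (z : C) (A : 'M[C]_(a, b)) : nsq (z *: A) = sqn z * nsq A.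
Proof.
rewrite /nsq mulr_sumr; apply: eq_bigr => i _.
by rewrite mulr_sumr; apply: eq_bigr => j _; rewrite mxE sqnM.
Qed.

Lemma nsqZr {a b} (t : R) (A : 'M[C]_(a, b)) : nsq (t%:C *: A) = t ^+ 2 * nsq A.
Proof. by rewrite nsqZ sqn_real. Qed.

Lemma ip_CS {a b} (A B : 'M[C]_(a, b)) : ip A B ^+ 2 <= nsq A * nsq B.
Proof.
have [B0|B0] := eqVneq (nsq B) 0.
  by rewrite (nsq_eq0 B0) ipC ip0l expr0n nsq0 mulr0.
have Bp : 0 < nsq B by rewrite lt_def B0 nsq_ge0.
have := nsq_ge0 ((nsq B)%:C *: A + (- ip A B)%:C *: B).
rewrite nsqD !nsqZr ipZl ipZr => h.
have : 0 <= nsq B * (nsq A * nsq B - ip A B ^+ 2).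
  by apply: le_trans h _; rewrite le_eqVlt; apply/orP; left; apply/eqP; ring.
by rewrite pmulr_rge0// subr_ge0.
Qed.

Lemma ip_le {a b} (A B : 'M[C]_(a, b)) :
  ip A B <= Num.sqrt (nsq A) * Num.sqrt (nsq B).
Proof.
rewrite -sqrtrM ?nsq_ge0//; apply: le_trans (ler_norm _) _.
by rewrite -sqrtr_sqr ler_sqrt ?ip_CS// mulr_ge0 ?nsq_ge0.
Qed.

Lemma nsqD_le2 {a b} (A B : 'M[C]_(a, b)) : nsq (A + B) <= 2 * (nsq A + nsq B).
Proof.
have := nsq_ge0 (A - B); rewrite !nsqD ipNr nsqN; lra.
Qed.

Lemma cip_mulJ (z w : C) : cip z w = complex.Re (z * Num.conj w).
Proof. by rewrite /cip ReM ReJ ImJ; ring. Qed.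

Lemma ip_tr {a b} (A B : 'M[C]_(a, b)) : ip A B = complex.Re (\tr (A *m B ^t*)).
Proof.
rewrite /ip /mxtrace Re_sum; apply: eq_bigr => i _.
by rewrite mxE Re_sum; apply: eq_bigr => j _; rewrite cip_mulJ !mxE.
Qed.

Lemma nsq_tr {a b} (A : 'M[C]_(a, b)) : nsq A = complex.Re (\tr (A *m A ^t*)).
Proof. by rewrite -ipxx ip_tr. Qed.

Lemma adjM {a b c} (A : 'M[C]_(a, b)) (B : 'M[C]_(b, c)) :
  (A *m B) ^t* = B ^t* *m A ^t*.
Proof. by rewrite trmx_mul map_mxM. Qed.

Lemma adjD {a b} (A B : 'M[C]_(a, b)) : (A + B) ^t* = A ^t* + B ^t*.
Proof. by rewrite linearD /= map_mxD. Qed.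

Lemma adj0 {a b} : (0 : 'M[C]_(a, b)) ^t* = 0.
Proof. by apply/matrixP => i j; rewrite !mxE conjC0. Qed.

Lemma adj1 {a} : (1%:M : 'M[C]_a) ^t* = 1%:M.
Proof. by rewrite trmx1 map_mx1. Qed.

Lemma adjZ {a b} (z : C) (A : 'M[C]_(a, b)) : (z *: A) ^t* = Num.conj z *: A ^t*.
Proof. by apply/matrixP => i j; rewrite !mxE rmorphM. Qed.

Lemma adj_sum {a b} (I : Type) (r : seq I) (P : pred I) (F : I -> 'M[C]_(a, b)) :
  (\sum_(i <- r | P i) F i) ^t* = \sum_(i <- r | P i) (F i) ^t*.
Proof. exact: (big_morph (fun M : 'M[C]_(a, b) => M ^t*) adjD adj0). Qed.

Lemma ip_mulr {a b c} (A : 'M[C]_(a, b)) (B : 'M[C]_(b, c)) D :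
  ip (A *m B) D = ip A (D *m B ^t*).
Proof. by rewrite !ip_tr adjM trmxCK !mulmxA. Qed.

Lemma ip_adj {a b} (A B : 'M[C]_(a, b)) : ip (A ^t*) (B ^t*) = ip A B.
Proof.
rewrite /ip exchange_big; apply: eq_bigr => i _; apply: eq_bigr => j _.
by rewrite !mxE /cip !ReJ !ImJ mulrNN.
Qed.

Lemma nsq_adj {a b} (A : 'M[C]_(a, b)) : nsq (A ^t*) = nsq A.
Proof. by rewrite -!ipxx ip_adj. Qed.

Lemma ip_mull {a b c} (A : 'M[C]_(a, b)) (B : 'M[C]_(b, c)) D :
  ip (A *m B) D = ip B (A ^t* *m D).
Proof.
by rewrite -ip_adj adjM ip_mulr trmxCK -[B in RHS]trmxCK -[in RHS]ip_adj adjM !trmxCK.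
Qed.

Lemma unitary_adjl {a} (U : 'M[C]_a) : U \is unitarymx -> U *m U ^t* = 1%:M.
Proof. by move/unitarymxP. Qed.

Lemma unitary_adjr {a} (U : 'M[C]_a) : U \is unitarymx -> U ^t* *m U = 1%:M.
Proof.
by move=> uU; rewrite -(invmx_unitary uU) mulVmx ?unitarymx_unit.
Qed.

Lemma nsq_mulr_unitary {a b} (A : 'M[C]_(a, b)) (U : 'M[C]_b) :
  U \is unitarymx -> nsq (A *m U) = nsq A.
Proof.
by move=> uU; rewrite -!ipxx ip_mulr -mulmxA unitary_adjl// mulmx1.
Qed.

Lemma nsq_mull_unitary {a b} (A : 'M[C]_(a, b)) (U : 'M[C]_a) :
  U \is unitarymx -> nsq (U *m A) = nsq A.
Proof.
by move=> uU; rewrite -!ipxx ip_mull mulmxA unitary_adjr// mul1mx.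
Qed.

Lemma nsq_row {a b} (A : 'M[C]_(a, b)) : nsq A = \sum_i nsq (row i A).
Proof.
apply: eq_bigr => i _; rewrite /nsq big_ord1.
by apply: eq_bigr => j _; rewrite mxE.
Qed.

(** Multiplying [u] by the conjugate of [z] makes its pairing with [v] real, so that the real
    inequality [ip_CS] yields the complex one without loss. *)
Lemma mulmx_entry_CS {b} (u : 'rV[C]_b) (v : 'cV[C]_b) :
  sqn ((u *m v) 0 0) <= nsq u * nsq v.
Proof.
pose z : C := (u *m v) 0 0; rewrite -/z.
have [->|z0] := eqVneq (sqn z) 0; first by rewrite mulr_ge0 ?nsq_ge0.
have zp : 0 < sqn z by rewrite lt_def z0 sqn_ge0.
have := ip_CS (Num.conj z *: u) (v ^t*).
have -> : ip (Num.conj z *: u) (v ^t*) = sqn z.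
  rewrite ip_tr trmxCK -scalemxAl mxtraceZ /mxtrace big_ord1 -/z.
  by rewrite ReM ReJ ImJ /sqn; ring.
rewrite nsqZ sqnJ nsq_adj expr2 -mulrA.
by rewrite ler_pM2l.
Qed.

Lemma nsqM {a b c} (A : 'M[C]_(a, b)) (B : 'M[C]_(b, c)) :
  nsq (A *m B) <= nsq A * nsq B.
Proof.
rewrite [nsq A]nsq_row mulr_suml {1}/nsq; apply: ler_sum => i _.
rewrite -[nsq B]nsq_adj [nsq (B ^t*)]nsq_row mulr_sumr; apply: ler_sum => j _.
have -> : (A *m B) i j = (row i A *m col j B) 0 0.
  by rewrite !mxE; apply: eq_bigr => k _; rewrite !mxE.
apply: le_trans (mulmx_entry_CS _ _) _; apply: ler_wpM2l; rewrite ?nsq_ge0//.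
rewrite -(nsq_adj (col j B)) le_eqVlt; apply/orP; left; apply/eqP; congr nsq.
by apply/rowP => k; rewrite !mxE.
Qed.

Lemma trabs2E {a} (A : 'M[C]_a) : trabs2 A = nsq A.
Proof. by rewrite /trabs2 absmx_sqr nsq_tr. Qed.

(* The weights [al] may vanish, but only where the summand does. *)
Lemma nsq_sum_CS {a b} (I : finType) (Q : pred I) (al : I -> R)
    (F : I -> 'M[C]_(a, b)) :
  (forall i, 0 <= al i) -> (forall i, al i = 0 -> F i = 0) ->
  nsq (\sum_(i | Q i) F i) <=
    (\sum_(i | Q i) al i) * \sum_(i | Q i) (al i)^-1 * nsq (F i).
Proof.
move=> al0 F0; set X := \sum_(i | Q i) F i.
set s := \sum_(i | Q i) al i; set q := (X in s * X).
have s0 : 0 <= s by apply: sumr_ge0 => i _.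
have [s00|sN0] := eqVneq s 0.
  suff -> : X = 0 by rewrite nsq0 s00 mul0r.
  apply: big1 => i Qi; apply: F0.
  by have /(_ i Qi) := psumr_eq0P (fun k _ => al0 k) s00.
have sp : 0 < s by rewrite lt_def sN0.
have h (i : I) : (2 / s) * ip (F i) X - (al i / s ^+ 2) * nsq X <= (al i)^-1 * nsq (F i).
  have [ai0|aiN0] := eqVneq (al i) 0.
    by rewrite (F0 _ ai0) ip0l ai0 mulr0 mul0r mul0r subrr invr0 mul0r.
  have ap : 0 < al i by rewrite lt_def aiN0 al0.
  have := nsq_ge0 (F i - (al i / s)%:C *: X).
  rewrite nsqD nsqN nsqZr ipNr ipZr => h.
  rewrite -subr_ge0 -(pmulr_rge0 _ ap).
  apply: le_trans h _; rewrite le_eqVlt; apply/orP; left; apply/eqP; field.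
  by rewrite aiN0 sN0.
have : (2 / s) * nsq X - (s / s ^+ 2) * nsq X <= q.
  have -> : s / s ^+ 2 * nsq X = \sum_(i | Q i) (al i / s ^+ 2) * nsq X.
    by rewrite -!mulr_suml.
  rewrite -[in X in X - _]ipxx {1}/X ip_suml mulr_sumr -sumrB.
  by apply: ler_sum => i _; apply: h.
suff -> : 2 / s * nsq X - s / s ^+ 2 * nsq X = nsq X / s.
  by rewrite ler_pdivrMr// mulrC.
by field.
Qed.

End Frobenius.

(** * Singular value decomposition and the part removed by [chop] *)

Section SingularValues.
Context {R : realType}.
Notation C := R[i].

Lemma nsq_rowE {a b} (K : 'M[C]_(a, b)) i : (K *m K ^t*) i i = (nsq (row i K))%:C.
Proof.
rewrite mxE /nsq big_ord1 rmorph_sum /=; apply: eq_bigr => j _.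
rewrite !mxE; apply: complex_eq; rewrite ?ReM ?ImM !ReJ !ImJ /= /sqn; ring.
Qed.

Lemma mul_adj_row {a a' b} (K : 'M[C]_(a, b)) (L : 'M[C]_(a', b)) i j :
  (K *m L ^t*) i j = (row i K *m (row j L) ^t*) 0 0.
Proof. by rewrite !mxE; apply: eq_bigr => k _; rewrite !mxE. Qed.

(* A zero row is replaced by a unit vector orthogonal to all the rows, which
   exists because the matrix is singular. *)
Lemma orthonormal_rows_completion {p} (K : 'M[C]_p) :
  (forall i j, i != j -> (K *m K ^t*) i j = 0) ->
  (forall i, row i K != 0 -> nsq (row i K) = 1) ->
  exists2 W : 'M[C]_p, W \is unitarymx &
    forall i, row i K != 0 -> row i W = row i K.
Proof.
have [c] := ubnP #|[pred i | row i K == 0]|.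
elim: c K => // c IH K cK ortK norK.
have [i0 Ki0|/= noz] := pickP [pred i | row i K == 0]; last first.
  exists K => //; apply/unitarymxP/matrixP => i j; rewrite [RHS]mxE.
  have [->|ij] := eqVneq i j; last by rewrite ortK.
  by rewrite nsq_rowE norK//; apply/negbT/noz.
have [v v0 vK] : exists2 v : 'rV[C]_p, v != 0 & v *m K ^t* = 0.
  have : kermx (K ^t*) != 0.
    rewrite kermx_eq0 row_free_unit; apply/negP => uK.
    have /matrixP/(_ i0 i0) : K *m (invmx (K ^t*)) ^t* = 1%:M.
      by rewrite -{1}[K]trmxCK -adjM mulVmx// adj1.
    rewrite !mxE eqxx big1 => [/esym/eqP|j _]; first by rewrite oner_eq0.
    by have /eqP/rowP/(_ j) := Ki0; rewrite !mxE => ->; rewrite mul0r.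
  move=> /matrix0Pn[i [j ij0]]; exists (row i (kermx (K ^t*))).
    by apply/rV0Pn; exists j; rewrite mxE.
  by apply/sub_kermxP; rewrite row_sub.
have nv : 0 < nsq v.
  by rewrite lt_def nsq_ge0 andbT; apply: contra v0 => /eqP/nsq_eq0/eqP.
pose e : 'rV[C]_p := (Num.sqrt (nsq v))^-1%:C *: v.
have ne : nsq e = 1.
  by rewrite nsqZr exprVn sqr_sqrtr ?ltW// mulVf// gt_eqF.
have eK : e *m K ^t* = 0 by rewrite -scalemxAl vK scaler0.
have e0 : e != 0.
  by apply/eqP => e0; have := oner_neq0 R; rewrite -ne e0 nsq0 eqxx.
pose K' := \matrix_(i < p) (if i == i0 then e else row i K).
have rK' i : row i K' = if i == i0 then e else row i K by rewrite rowK.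
have [|||W uW WK] := IH K'.
- apply: (@leq_trans #|[pred i | row i K == 0]|); last by rewrite -ltnS.
  apply: proper_card; apply/properP; split.
    apply/fintype.subsetP => i; rewrite !inE rK'; case: ifP => // _.
    by rewrite (negbTE e0).
  by exists i0; rewrite !inE ?rK' ?eqxx.
- move=> i j ij; rewrite mul_adj_row !rK'.
  have rowe k : (e *m (row k K) ^t*) 0 0 = 0.
    transitivity ((e *m K ^t*) 0 k); last by rewrite eK mxE.
    by rewrite !mxE; apply: eq_bigr => l _; rewrite !mxE.
  have [ii0|_] := eqVneq i i0.
    by rewrite ifN ?rowe// -ii0 eq_sym.
  case: ifP => [_|_]; last by rewrite -mul_adj_row ortK.
  have -> : row i K *m e ^t* = (e *m (row i K) ^t*) ^t* by rewrite adjM trmxCK.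
  by rewrite mxE mxE rowe conjC0.
- by move=> i; rewrite rK'; case: ifP => // _ /norK.
exists W => // i Ki; have ii0 : i != i0 by apply: contra Ki => /eqP->.
by rewrite WK rK' (negbTE ii0).
Qed.

(** In an eigenbasis [P] of [A A^*] the rows of [P A] are pairwise orthogonal. Their lengths are the
    singular values, and the normalised rows, completed to a unitary matrix, give [V^*]. *)
Lemma svd_exists {p} (A : 'M[C]_p) : exists U s V, is_svd A U s V.
Proof.
pose B := A *m A ^t*.
have hB : B ^t* = B by rewrite adjM trmxCK.
have nB : B \is normalmx by apply/normalmxP; rewrite hB.
have /orthomx_spectralP eB := nB.
pose P := spectralmx B; have uP : P \is unitarymx := spectral_unitarymx B.
pose K := P *m A.
have PB : P *m B = diag_mx (spectral_diag B) *m P.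
  by rewrite [X in P *m X]eB -/P !mulmxA mulmxV ?mul1mx ?unitarymx_unit.
have KK : K *m K ^t* = diag_mx (spectral_diag B).
  by rewrite adjM mulmxA -(mulmxA P A) -/B PB -mulmxA unitary_adjl// mulmx1.
pose s : 'rV[R]_p := \row_j Num.sqrt (nsq (row j K)).
(* The inverse of a zero singular value is 0, so that its row stays zero and is left to the
   completion. *)
pose K1 := \matrix_(i < p) ((s 0 i)^-1%:C *: row i K).
have rK1 i : row i K1 = (s 0 i)^-1%:C *: row i K by rewrite rowK.
have s0 i : s 0 i = 0 -> row i K = 0.
  move=> /eqP; rewrite mxE sqrtr_eq0 => h; apply: nsq_eq0.
  by apply/eqP; rewrite eq_le h nsq_ge0.
have [||W uW WK] := @orthonormal_rows_completion _ K1.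
- move=> i j ij; have h : (row i K *m (row j K) ^t*) 0 0 = 0.
    by rewrite -mul_adj_row KK mxE (negbTE ij) mulr0n.
  by rewrite mul_adj_row !rK1 adjZ -scalemxAl -scalemxAr scalerA mxE h mulr0.
- move=> i; rewrite rK1 nsqZr.
  have [si|si] := eqVneq (s 0 i) 0; first by rewrite (s0 _ si) scaler0 eqxx.
  move=> _; have -> : nsq (row i K) = s 0 i ^+ 2.
    by rewrite mxE sqr_sqrtr ?nsq_ge0.
  by rewrite exprVn mulVf// sqrf_eq0.
exists (P ^t*), s, (W ^t*); split => [|||].
- by rewrite trmxC_unitary.
- by rewrite trmxC_unitary.
- by move=> j; rewrite mxE sqrtr_ge0.
rewrite trmxCK -mulmxA.
have -> : diag_mx (map_mx (real_complex R) s) *m W = K.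
  apply/row_matrixP => i.
  have -> : row i (diag_mx (map_mx (real_complex R) s) *m W) = (s 0 i)%:C *: row i W.
    by apply/rowP => j; rewrite mxE mul_diag_mx !mxE.
  have [si|si] := eqVneq (s 0 i) 0; first by rewrite si scale0r s0.
  have rKi : row i K = (s 0 i)%:C *: row i K1.
    by rewrite rK1 scalerA -rmorphM /= mulfV// scale1r.
  have [K10|K1n0] := eqVneq (row i K1) 0; last by rewrite WK// -rKi.
  exfalso; have : row i K = 0 by rewrite rKi K10 scaler0.
  by move=> h; move/negP: si; apply; rewrite mxE h nsq0 sqrtr0.
by rewrite mulmxA unitary_adjr// mul1mx.
Qed.

Lemma chop_ge0E (x : R) : 0 <= x -> chop x = Num.min x 1.
Proof.
move=> x0; rewrite /chop minEle; case: (leP 1 x) => h.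
  by case: (leP x 1) => // h'; apply/le_anti; rewrite h h'.
by rewrite leNgt (lt_le_trans _ x0) ?oppr_lt0// ltW.
Qed.

Lemma nsq_diag {p} (s : 'rV[R]_p) :
  nsq (diag_mx (map_mx (real_complex R) s)) = \sum_j s 0 j ^+ 2.
Proof.
apply: eq_bigr => i _; rewrite (bigD1 i)//= big1 ?addr0 => [|j ji].
  by rewrite !mxE eqxx mulr1n sqn_real.
by rewrite !mxE eq_sym (negbTE ji) mulr0n sqn0.
Qed.

Lemma nsq1 {q} : nsq (1%:M : 'M[C]_q) = q%:R.
Proof.
have -> : (1%:M : 'M[C]_q) = diag_mx (map_mx (real_complex R) (const_mx 1)).
  by rewrite -diag_const_mx; congr diag_mx; apply/rowP => i; rewrite !mxE.
by rewrite nsq_diag (eq_bigr (fun=> 1)) ?sumr_const ?card_ord// => i _; rewrite mxE expr1n.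
Qed.

(** The difference is diagonal in the singular bases of [A], so only the diagonal entries [l], [y],
    [e] of [U^* L V], [U^* T V] and [U^* (L L^* - B) U] matter. An index counts only if its singular
    value exceeds 1, which happens at most [nsq Pi] times. There [|l|^2 <= 1 + e], because [B] is
    below [I], and [2 e <= e^2 / t + t] trades the linear error for a Frobenius norm. *)
Lemma chop_excess_le {p} (Pi A L T B : 'M[C]_p) (t : R) : 0 < t ->
  Pi *m A = A -> A = L + T ->
  (forall v : 'rV[C]_p, ip (v *m B) v <= nsq v) ->
  nsq (A - chopmx A) <= nsq (L *m L ^t* - B) / t + nsq Pi * t + 2 * nsq T.
Proof.
move=> t0 PiA AE B1.
have [U [s [V svdA]]] := svd_exists A.
rewrite (chopmx_svd svdA); case: svdA => uU uV s0 svdA.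
pose D (x : 'rV[R]_p) := diag_mx (map_mx (real_complex R) x).
pose x := \row_j (s 0 j - chop (s 0 j)) : 'rV[R]_p.
have -> : nsq (A - U *m diag_mx (map_mx (real_complex R \o chop) s) *m V ^t*) =
    \sum_j x 0 j ^+ 2.
  rewrite {1}svdA -mulmxBl -mulmxBr nsq_mulr_unitary ?trmxC_unitary//.
  rewrite nsq_mull_unitary// -nsq_diag; congr nsq.
  by rewrite -linearB; congr diag_mx; apply/rowP => j; rewrite !mxE rmorphB.
set E := L *m L ^t* - B.
pose U' := U ^t*.
have UE : U = U' ^t* by rewrite trmxCK.
have uU' : U' \is unitarymx by rewrite trmxC_unitary.
have DE : U' *m A *m V = D s.
  by rewrite svdA !mulmxA unitary_adjr// mul1mx -mulmxA unitary_adjr// mulmx1.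
pose e j := complex.Re ((U' *m E *m U) j j).
pose y j := (U' *m T *m V) j j.
pose J := [pred j | 1 < s 0 j].
have stepJ j : J j -> x 0 j ^+ 2 <= e j ^+ 2 / t + t + 2 * sqn (y j).
  move=> /= sj; have -> : x 0 j = s 0 j - 1.
    by rewrite mxE chop_ge0E// min_r// ltW.
  pose l := (U' *m L *m V) j j.
  have sE : s 0 j = complex.Re l + complex.Re (y j).
    have /matrixP/(_ j j) := DE; rewrite AE mulmxDr mulmxDl mxE !mxE eqxx mulr1n.
    move=> /(congr1 (@complex.Re R)); rewrite ReD /= => <-.
    by rewrite /l /y ![in RHS]mxE.
  have yle : complex.Re (y j) ^+ 2 <= sqn (y j) by rewrite lerDl sqr_ge0.
  (* The entry [l] is at most the length of row [j] of [U^* L], whose square is a diagonal entry of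
     [U^* L L^* U]; there [B] contributes at most 1. *)
  have lle : complex.Re l ^+ 2 <= 1 + e j.
    apply: (@le_trans _ _ (sqn l)); first by rewrite lerDl sqr_ge0.
    have rU : nsq (row j U') = 1.
      have /matrixP/(_ j j) := unitary_adjl uU'; rewrite nsq_rowE mxE eqxx.
      by move=> /(congr1 (@complex.Re R)).
    have -> : 1 = nsq (row j U') by [].
    have := B1 (row j U') => Bj.
    apply: (@le_trans _ _ (ip (row j U' *m B) (row j U') + e j)); last by rewrite lerD2r.
    have -> : e j = ip (row j U' *m E) (row j U').
      rewrite ip_tr /mxtrace big_ord1 /e; congr complex.Re.
      by rewrite [in LHS]UE mul_adj_row row_mul.
    rewrite -ipDl -mulmxDr addrC /E subrK mulmxA -row_mul ip_mulr trmxCK -row_mul ipxx.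
    have -> : l = (row j (U' *m L) *m col j V) 0 0.
      by rewrite /l mxE [RHS]mxE; apply: eq_bigr => k _; rewrite [in RHS]mxE [in X in _ = _ * X]mxE.
    apply: le_trans (mulmx_entry_CS _ _) _.
    suff -> : nsq (col j V) = 1 by rewrite mulr1.
    have uV' : V ^t* \is unitarymx by rewrite trmxC_unitary.
    have /matrixP/(_ j j) := unitary_adjl uV'; rewrite nsq_rowE mxE eqxx.
    move=> /(congr1 (@complex.Re R)) /= <-; rewrite -nsq_adj; congr nsq.
    by apply/rowP => k; rewrite !mxE.
  rewrite {}sE in sj *.
  have eet : 2 * e j <= e j ^+ 2 / t + t.
    rewrite -subr_ge0.
    suff -> : e j ^+ 2 / t + t - 2 * e j = (e j - t) ^+ 2 / t.
      by rewrite divr_ge0 ?sqr_ge0// ltW.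
    by field; rewrite gt_eqF.
  have et0 : 0 <= e j ^+ 2 / t + t.
    by rewrite addr_ge0 ?divr_ge0 ?sqr_ge0 ?ltW.
  move: (complex.Re l) (complex.Re (y j)) (e j ^+ 2 / t + t) sj yle lle eet et0.
  move=> a b q sj yle lle eet et0.
  (* The singular value is [a + b]. If [a <= 1], its excess is at most [b]. Otherwise the squared
     excess is at most [2 (a - 1)^2 + 2 b^2], and [(a - 1)^2 <= a^2 - 1 <= e]. *)
  have [a1|a1] := leP a 1.
    have : 0 <= (1 - a) * (a + b - 1 + b) by apply: mulr_ge0; lra.
    by nra.
  have : 0 <= (a - 1 - b) ^+ 2 by apply: sqr_ge0.
  by nra.
have stepN j : ~~ J j -> x 0 j ^+ 2 = 0.
  by rewrite /= -leNgt => sj; rewrite mxE chop_ge0E// min_l// subrr expr0n.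
(* [Pi] fixes each left singular vector of nonzero singular value, so each of these contributes a
   unit row to the adjoint of [Pi U]. *)
have cardJ : (\sum_(j | J j) 1) <= nsq Pi.
  rewrite -(nsq_mulr_unitary Pi uU) -nsq_adj nsq_row [leRHS](bigID J)/= -[leLHS]addr0.
  apply: lerD; last by apply: sumr_ge0 => j _; apply: nsq_ge0.
  apply: ler_sum => j /= sj; rewrite adjM.
  have sj0 : s 0 j != 0 by rewrite gt_eqF// (lt_trans ltr01).
  have AV : A *m V = U *m D s.
    by rewrite svdA -mulmxA unitary_adjr// mulmx1.
  have PiU : Pi *m (U *m D s) = U *m D s by rewrite -AV mulmxA PiA.
  have cj : row j (U ^t* *m Pi ^t*) = row j U'.
    apply/rowP => k; rewrite /U'.
    have /matrixP/(_ k j) := PiU; rewrite mulmxA !mul_mx_diag !mxE => h.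
    have /mulIf : (s 0 j)%:C != 0 by rewrite fmorph_eq0.
    by move=> /(_ _ _ h) h2; rewrite -h2 rmorph_sum; apply: eq_bigr => i _;
      rewrite !mxE rmorphM mulrC.
  rewrite cj.
  have /matrixP/(_ j j) := unitary_adjl uU'; rewrite nsq_rowE mxE eqxx.
  by move=> /(congr1 (@complex.Re R)) /= ->.
rewrite (bigID J)/= [X in _ + X]big1 ?addr0; last by move=> j /stepN.
apply: (@le_trans _ _ (\sum_(j | J j) (e j ^+ 2 / t + t + 2 * sqn (y j)))).
  by apply: ler_sum => j /stepJ.
rewrite big_split /= big_split /=; apply: lerD; last first.
  rewrite -mulr_sumr ler_pM2l//.
  rewrite -(nsq_mull_unitary T uU') -(nsq_mulr_unitary _ uV).
  rewrite [leRHS](_ : _ = \sum_(j | J j) \sum_k sqn ((U' *m T *m V) j k) +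
     \sum_(j | ~~ J j) \sum_k sqn ((U' *m T *m V) j k)); last by rewrite /nsq (bigID J).
  rewrite -[leLHS]addr0; apply: lerD; last first.
    by apply: sumr_ge0 => j _; apply: sumr_ge0 => k _; apply: sqn_ge0.
  apply: ler_sum => j _; rewrite (bigD1 j)//= lerDl.
  by apply: sumr_ge0 => k _; apply: sqn_ge0.
apply: lerD; last first.
  have -> : \sum_(j | J j) t = (\sum_(j | J j) 1) * t.
    by rewrite mulr_suml; apply: eq_bigr => j _; rewrite mul1r.
  by rewrite ler_pM2r.
rewrite -mulr_suml ler_pM2r ?invr_gt0//.
rewrite -(nsq_mull_unitary E uU') -(nsq_mulr_unitary _ uU).
rewrite [leRHS](_ : _ = \sum_(j | J j) \sum_k sqn ((U' *m E *m U) j k) +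
   \sum_(j | ~~ J j) \sum_k sqn ((U' *m E *m U) j k)); last by rewrite /nsq (bigID J).
rewrite -[leLHS]addr0; apply: lerD; last first.
  by apply: sumr_ge0 => j _; apply: sumr_ge0 => k _; apply: sqn_ge0.
apply: ler_sum => j _; rewrite (bigD1 j)//=.
apply: (@le_trans _ _ (sqn ((U' *m E *m U) j j))); first by rewrite lerDl sqr_ge0.
by rewrite lerDl; apply: sumr_ge0 => k _; apply: sqn_ge0.
Qed.

End SingularValues.

(** * Comparison of integrals of nonnegative functions *)

Section IntegralGe0.
Context d (T : measurableType d) (R : realType).
Variable mu : {measure set T -> \bar R}.
Local Open Scope ereal_scope.

(* The integral of a nonnegative function is a supremum over the simple functions
   below it, so that neither function needs to be measurable. *)
Lemma le_integral_ge0 (f g : T -> \bar R) : (forall x, 0 <= f x) ->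
  (forall x, f x <= g x) -> \int[mu]_x f x <= \int[mu]_x g x.
Proof.
move=> f0 fg; have g0 x : 0 <= g x by exact: le_trans (f0 x) (fg x).
rewrite !ge0_integralTE//; apply: ereal_sup_le => _ [h hf <-].
by exists h => // x; exact: le_trans (hf x) (fg x).
Qed.

Lemma integral_cst_prob (P : probability T R) (c : R) :
  \int[P]_x c%:E = c%:E.
Proof. by rewrite integral_cst// [X in _ * X]probability_setT mule1. Qed.

End IntegralGe0.

(** * Tonelli's theorem for two independent random elements *)

Section IndependentFubini.
Context {R : realType} d (T : measurableType d) (P : probability T R).
Context d1 (T1 : measurableType d1) d2 (T2 : measurableType d2).
Variables (X : {mfun T >-> T1}) (Y : {mfun T >-> T2}).
Hypothesis indepXY : forall A B, measurable A -> measurable B ->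
  P ((X @^-1` A) `&` (Y @^-1` B)) = (P (X @^-1` A) * P (Y @^-1` B))%E.

Let joint (w : T) : T1 * T2 := (X w, Y w).

Let mjoint : measurable_fun setT joint.
Proof. exact: measurable_fun_pair. Qed.

HB.instance Definition _ := @isMeasurableFun.Build _ _ T _ joint mjoint.

(** The law of the pair is the product of the two laws, since both agree on rectangles. *)
Lemma integral_indep (f : T1 * T2 -> \bar R) : measurable_fun setT f ->
  (forall z, 0 <= f z)%E ->
  (\int[P]_w f (X w, Y w) =
   \int[distribution P Y]_y \int[distribution P X]_x f (x, y))%E.
Proof.
move=> mf f0.
have -> : (\int[P]_w f (X w, Y w) =
    \int[distribution P (joint : {mfun T >-> (T1 * T2)%type})]_z f z)%E.
  by rewrite ge0_integral_distribution.
rewrite -(fubini_tonelli2 (m1 := distribution P X) (m2 := distribution P Y))//.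
apply: eq_measure_integral => A mA _; symmetry.
by apply: product_measure_unique => // B C mB mC; exact: indepXY.
Qed.

(** Integrates [X] out with [Y] frozen. The inner integral is measurable in [Y] by Tonelli, and is
    then compared with [g] pointwise. *)
Lemma integral_indep_le (f : T1 -> T2 -> R) (g : T2 -> R) :
  measurable_fun setT (fun z : T1 * T2 => f z.1 z.2) ->
  (forall x y, 0 <= f x y) ->
  (forall y, \int[distribution P X]_x (f x y)%:E <= (g y)%:E)%E ->
  (\int[P]_w (f (X w) (Y w))%:E <= \int[P]_w (g (Y w))%:E)%E.
Proof.
move=> mf f0 fg.
have mf' : measurable_fun setT (fun z : T1 * T2 => (f z.1 z.2)%:E).
  exact/measurable_EFinP.
have h := integral_indep mf' (fun z => f0 z.1 z.2).
rewrite /= in h; rewrite {}h.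
rewrite ge0_integral_distribution; last 2 first.
- apply: (measurable_fun_fubini_tonelli_G (m1 := distribution P X) _ mf').
  by move=> z; rewrite lee_fin; exact: f0.
- by move=> w; apply: integral_ge0 => x _; rewrite lee_fin; exact: f0.
apply: le_integral_ge0 => [w|w] /=.
  by apply: integral_ge0 => x _; rewrite lee_fin; exact: f0.
exact: fg.
Qed.

End IndependentFubini.

(** * Freezing all the variables but one *)

Section Decoupling.
Context {R : realType} d (T : measurableType d) (P : probability T R).
Context (I : finType) (F : I -> set (set T)).

Definition gen (D : pred I) : set (set T) := [set A | exists2 i, D i & F i A].

(** Measurability for the sigma-algebra generated by the families in [D]: this expresses that [f] is
    a function of the variables with index in [D] alone. *)
Definition depon (D : pred I) d' (T' : measurableType d') (f : T -> T') : Prop :=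
  @measurable_fun _ _ (g_sigma_algebraType (gen D)) T' setT f.

Lemma depon_sub (D D' : pred I) d' (T' : measurableType d') (f : T -> T') :
  (forall i, D i -> D' i) -> depon D f -> depon D' f.
Proof.
move=> DD' mf mT B mB; have := mf measurableT B mB.
by apply: sub_sigma_algebra2 => A [i Di FA]; exists i => //; exact: DD'.
Qed.

Hypothesis FT : forall i, F i setT.
Hypothesis FI : forall i A B, F i A -> F i B -> F i (A `&` B).
Hypothesis Fm : forall i, F i `<=` measurable.
Hypothesis indepF : mutually_independent P F.

(** The pi-system behind [gen D]: intersections of one event per index of [D], where an index may
    contribute the whole space. *)
Let Pi (D : pred I) : set (set T) := [set A | exists E : I -> set T,
  (forall i, F i (E i)) /\ A = \bigcap_(i in [set i | D i]) E i].

Let Pi_measurable D : Pi D `<=` measurable.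
Proof.
move=> A [E [FE ->]]; apply: fin_bigcap_measurable => [|i _].
  exact: finite_finset.
exact: Fm (FE i).
Qed.

(** Mutual independence is applied to [D] with [i0] added and to [D] itself; the two products differ
    by the factor of [i0]. *)
Let indep_Pi i0 (D : pred I) A B : ~~ D i0 -> F i0 A -> Pi D B ->
  P (A `&` B) = (P A * P B)%E.
Proof.
move=> Di0 FA [E [FE ->]].
pose E' i := if i == i0 then A else E i.
have FE' i : F i (E' i) by rewrite /E'; case: eqP => [->|].
pose J := finset D; have i0J : i0 \notin J by rewrite inE.
have setJ : [set` J] = [set i | D i] by apply/seteqP; split => i /=; rewrite inE.
have capE : \bigcap_(i in [set` i0 |: J]%SET) E' i =
    A `&` \bigcap_(i in [set i | D i]) E i.
  apply/seteqP; split => [x h|x [Ax Ex] i /=].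
    split; first by have := h i0; rewrite /E' eqxx /= !inE eqxx => /(_ isT).
    move=> i /= Di; have := h i; rewrite /E' /= !inE Di orbT => /(_ isT).
    by case: eqP Di0 => // <-; rewrite Di.
  rewrite /E' !inE => /orP[->//|Di]; case: eqP => // _; exact: Ex.
have capJ : \bigcap_(i in [set` J]) E' i = \bigcap_(i in [set i | D i]) E i.
  rewrite setJ; apply: eq_bigcapr => i /= Di; rewrite /E'.
  by case: eqP Di0 => // <-; rewrite Di.
have := indepF FE' (i0 |: J)%SET; rewrite capE => ->.
have := indepF FE' J; rewrite capJ => ->.
rewrite big_setU1//= /E' eqxx EFinM fineK ?fin_num_measure//.
exact: Fm FA.
Qed.

(** For fixed [A] both sides are finite measures in [B] that agree on the pi-system, hence on the
    sigma-algebra that it generates. *)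
Lemma indep_gen i0 (D : pred I) A B : ~~ D i0 -> F i0 A -> <<s gen D >> B ->
  P (A `&` B) = (P A * P B)%E.
Proof.
move=> Di0 FA sB.
have mA : measurable A by exact: Fm FA.
have genPi : gen D `<=` Pi D.
  move=> C [i Di FC]; exists (fun j => if j == i then C else setT); split.
    by move=> j; case: eqP => [->|].
  apply/seteqP; split => [x Cx j _|x]; first by case: eqP.
  by move=> /(_ i Di); rewrite eqxx.
have PiT : Pi D setT.
  by exists (fun=> setT); split => //; rewrite bigcapT.
have PA0 : 0 <= fine (P A) by rewrite fine_ge0.
pose m1 := mrestr P mA; pose m2 := mscale (NngNum PA0) P.
suff : m1 B = m2 B.
  by rewrite /m1 /m2 /mrestr /mscale /= setIC fineK// fin_num_measure.
apply: (g_sigma_algebra_measure_unique (Pi D) (@Pi_measurable D) (fun=> setT)) => //.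
- by rewrite bigcup_const.
- move=> X Y [E1 [FE1 ->]] [E2 [FE2 ->]].
  exists (fun i => E1 i `&` E2 i); split; first by move=> i; exact: FI.
  by rewrite bigcapI.
- move=> C PiC; rewrite /= /mrestr /mscale /= setIC fineK ?fin_num_measure//.
  exact: indep_Pi FA PiC.
- move=> _; rewrite /= /mrestr setTI.
  by apply: le_lt_trans (probability_le1 P mA) _; rewrite ltry.
- exact: sub_sigma_algebra2 genPi _ sB.
Qed.

Section Fubini.
Context d1 (T1 : measurableType d1) (X : {mfun T >-> T1}) (i0 : I).
Hypothesis FX : F i0 = sigma_of X.

Let D0 : pred I := [pred i | i != i0].
Let T' : measurableType _ := g_sigma_algebraType (gen D0).

(** All the variables but [i0] are bundled into one random element: the identity, with values in the
    space that carries the sigma-algebra they generate. *)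
Let idT (w : T) : T' := w.

Let midT : measurable_fun setT idT.
Proof.
move=> _ B mB; rewrite setTI.
suff : <<s gen D0 >> `<=` @measurable d T by exact.
apply: smallest_sub; first exact: sigma_algebra_measurable.
by move=> A [i _]; exact: Fm.
Qed.

HB.instance Definition _ := @isMeasurableFun.Build _ _ T T' idT midT.

(** Stands in for conditioning on all the variables but [X]. The two arguments of [f] separate the
    occurrences of [X] from the rest of the outcome, so that a bound on the integral over the first,
    at each frozen outcome, passes to the expectation. *)
Lemma decouple_le (f : T1 -> T -> R) (g : T -> R) :
  @measurable_fun _ _ (T1 * T')%type R setT (fun z => f z.1 z.2) ->
  (forall x w, 0 <= f x w) ->
  (forall w, \int[distribution P X]_x (f x w)%:E <= (g w)%:E)%E ->
  (\int[P]_w (f (X w) w)%:E <= \int[P]_w (g w)%:E)%E.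
Proof.
move=> mf f0 fg.
apply: (@integral_indep_le _ _ T P _ T1 _ T' X (idT : {mfun T >-> T'})) => //.
move=> A B mA mB.
apply: (@indep_gen i0 D0) => //; by rewrite ?FX /D0 /= ?eqxx//; exists A.
Qed.

End Fubini.

End Decoupling.

(** * Measurability of matrix-valued functions *)

Section MatrixMeasurability.
Context {R : realType}.
Notation C := R[i].

(** Stated by entries so as to cover rectangular matrices; for square ones it is measurability into
    [cmx], by [mxmeasP]. *)
Definition mxmeas d (T : measurableType d) {a b} (F : T -> 'M[C]_(a, b)) : Prop :=
  forall i j, measurable_fun setT (fun x => complex.Re (F x i j)) /\
              measurable_fun setT (fun x => complex.Im (F x i j)).

Section Closure.
Context d (T : measurableType d).

Lemma mxmeas_cst {a b} (A : 'M[C]_(a, b)) : mxmeas (fun _ : T => A).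
Proof. by move=> i j; split; exact: measurable_cst. Qed.

Lemma mxmeas_ext {a b} (F G : T -> 'M[C]_(a, b)) :
  (forall x, F x = G x) -> mxmeas F -> mxmeas G.
Proof. by move=> /funext ->. Qed.

Lemma mxmeas_add {a b} (F G : T -> 'M[C]_(a, b)) :
  mxmeas F -> mxmeas G -> mxmeas (fun x => F x + G x).
Proof.
move=> mF mG i j; have [F1 F2] := mF i j; have [G1 G2] := mG i j; split.
- by under eq_fun do rewrite mxE ReD; exact: measurable_funD.
- by under eq_fun do rewrite mxE ImD; exact: measurable_funD.
Qed.

Lemma mxmeas_adj {a b} (F : T -> 'M[C]_(a, b)) :
  mxmeas F -> mxmeas (fun x => (F x) ^t*).
Proof.
move=> mF i j; have [F1 F2] := mF j i; split.
- by under eq_fun do rewrite !mxE ReJ.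
- by under eq_fun do rewrite !mxE ImJ; exact: measurableT_comp.
Qed.

Lemma mxmeas_mul {a b c} (F : T -> 'M[C]_(a, b)) (G : T -> 'M[C]_(b, c)) :
  mxmeas F -> mxmeas G -> mxmeas (fun x => F x *m G x).
Proof.
move=> mF mG i j; split.
- under eq_fun do rewrite mxE Re_sum; apply: measurable_sum => k.
  have [F1 F2] := mF i k; have [G1 G2] := mG k j.
  under eq_fun do rewrite ReM; apply: measurable_funB; exact: measurable_funM.
- under eq_fun do rewrite mxE Im_sum; apply: measurable_sum => k.
  have [F1 F2] := mF i k; have [G1 G2] := mG k j.
  under eq_fun do rewrite ImM; apply: measurable_funD; exact: measurable_funM.
Qed.

Lemma mxmeas_scale {a b} (z : C) (F : T -> 'M[C]_(a, b)) :
  mxmeas F -> mxmeas (fun x => z *: F x).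
Proof.
move=> mF; have := mxmeas_mul (mxmeas_cst (z%:M : 'M[C]_a)) mF.
by under eq_fun do rewrite mul_scalar_mx.
Qed.

Lemma mxmeas_sum {a b} (I : Type) (r : seq I) (Q : pred I)
    (F : I -> T -> 'M[C]_(a, b)) :
  (forall i, Q i -> mxmeas (F i)) -> mxmeas (fun x => \sum_(i <- r | Q i) F i x).
Proof.
move=> mF; elim: r => [|i r IH].
  by under eq_fun do rewrite big_nil; exact: mxmeas_cst.
have [Qi|Qi] := boolP (Q i); last first.
  by under eq_fun do rewrite big_cons (negbTE Qi).
by under eq_fun do rewrite big_cons Qi; apply: mxmeas_add => //; exact: mF.
Qed.

Lemma mxmeas_row {a b} i (F : T -> 'M[C]_(a, b)) :
  mxmeas F -> mxmeas (fun x => row i (F x)).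
Proof.
by move=> mF k j; split; under eq_fun do rewrite mxE; have [] := mF i j.
Qed.

Lemma mxmeas_tens {n} k (F : T -> 'M[C]_n) :
  mxmeas F -> mxmeas (fun x => mxtens.tensmx (F x) (1%:M : 'M[C]_k)).
Proof.
move=> mF i j; case: (mxtens.mxtens_indexP i) => i1 i2.
case: (mxtens.mxtens_indexP j) => j1 j2; have [F1 F2] := mF i1 j1.
split; under eq_fun do rewrite mxtens.tensmxE ?ReM ?ImM.
- by apply: measurable_funB; exact: measurable_funM.
- by apply: measurable_funD; exact: measurable_funM.
Qed.

Lemma measurable_sqn {a b} (F : T -> 'M[C]_(a, b)) i j :
  mxmeas F -> measurable_fun setT (fun x => sqn (F x i j)).
Proof.
move=> mF; have [F1 F2] := mF i j.
by apply: measurable_funD; exact: measurable_funX.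
Qed.

Lemma measurable_nsq {a b} (F : T -> 'M[C]_(a, b)) :
  mxmeas F -> measurable_fun setT (fun x => nsq (F x)).
Proof.
move=> mF; apply: measurable_sum => i; apply: measurable_sum => j.
exact: measurable_sqn.
Qed.

Lemma mxmeas_comp d' (T' : measurableType d') {a b} (F : T -> 'M[C]_(a, b))
    (g : T' -> T) :
  mxmeas F -> measurable_fun setT g -> mxmeas (F \o g).
Proof.
move=> mF mg i j; have [F1 F2] := mF i j; split.
- exact: (measurableT_comp F1 mg).
- exact: (measurableT_comp F2 mg).
Qed.

Lemma mxmeasP {n} (F : T -> cmx R n) :
  measurable_fun setT F <-> @mxmeas _ T n n F.
Proof.
have cyl (A : set (cmx R n)) : mx_cylinder A -> measurable A.
  exact: sub_sigma_algebra.
split=> [mF i j|mF].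
  split=> _ B mB; rewrite setTI.
    have := mF measurableT [set M : 'M[C]_n | B (complex.Re (M i j))].
    by rewrite setTI; apply; apply: cyl; exists i, j, B; split => //; left.
  have := mF measurableT [set M : 'M[C]_n | B (complex.Im (M i j))].
  by rewrite setTI; apply; apply: cyl; exists i, j, B; split => //; right.
apply: (measurability (@mx_cylinder R n)) => // _ [A [i [j [B [mB AE]]]] <-].
have [F1 F2] := mF i j.
have := F1 measurableT B mB; have := F2 measurableT B mB.
by case: AE => ->.
Qed.

End Closure.

Lemma mxmeas_cmx {n} : mxmeas (fun x : cmx R n => (x : 'M[C]_n)).
Proof. by apply/mxmeasP. Qed.

End MatrixMeasurability.

(** * Diagonal sign matrices and permutation matrices as unitaries *)

Section Signs.
Context {R : realType}.
Notation C := R[i].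

Lemma sum_signs {p} (a b : 'I_p) :
  \sum_(e : {ffun 'I_p -> bool}) ((-1) ^+ e a * (-1) ^+ e b : R) =
  if a == b then 2 ^+ p else 0.
Proof.
case: eqVneq => [->|ab].
  under eq_bigr do rewrite -expr2 sqrr_sign.
  by rewrite sumr_const card_ffun card_bool card_ord -[LHS]/(_%:R) natrX.
(* Flipping the sign at [a] is an involution that negates every term. *)
set s := LHS; suff : s = - s by move/eqP; rewrite -addr_eq0 -mulr2n mulrn_eq0 => /eqP.
pose h (e : {ffun 'I_p -> bool}) := [ffun j => e j (+) (j == a)].
have hK : involutive h by move=> e; apply/ffunP => j; rewrite !ffunE addbK.
rewrite {1}/s (reindex_inj (inv_inj hK)) /= -sumrN; apply: eq_bigr => e _.
by rewrite !ffunE eqxx (eq_sym b) (negbTE ab) addbT addbF signrN mulNr.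
Qed.

Lemma sqn_sum {I : finType} (z : I -> C) :
  sqn (\sum_i z i) = \sum_i \sum_j cip (z i) (z j).
Proof.
rewrite /sqn Re_sum Im_sum !expr2 !mulr_suml -big_split; apply: eq_bigr => i _.
by rewrite !mulr_sumr -big_split; apply: eq_bigr => j _.
Qed.

Lemma sum_sqn_signs {p} (z : 'I_p -> C) :
  \sum_(e : {ffun 'I_p -> bool}) sqn (\sum_a (-1) ^+ e a * z a) =
  2 ^+ p * \sum_a sqn (z a).
Proof.
have sgnE (b : bool) : ((-1) ^+ b : C) = ((-1) ^+ b : R)%:C.
  by case: b => //=; rewrite ?expr0 ?expr1 ?rmorphN.
under eq_bigr do rewrite sqn_sum.
rewrite exchange_big mulr_sumr; apply: eq_bigr => a _.
rewrite exchange_big (bigD1 a)//= [X in _ + X]big1 ?addr0.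
  rewrite (eq_bigr (fun e : {ffun 'I_p -> bool} => (-1) ^+ e a * (-1) ^+ e a * sqn (z a))).
    by rewrite -mulr_suml sum_signs eqxx.
  by move=> e _; rewrite sgnE /cip !ReM !ImM /= /sqn; ring.
move=> b ba.
rewrite (eq_bigr (fun e : {ffun 'I_p -> bool} => (-1) ^+ e a * (-1) ^+ e b * cip (z a) (z b))).
  by rewrite -mulr_suml sum_signs eq_sym (negbTE ba) mul0r.
by move=> e _; rewrite !sgnE /cip !ReM !ImM /=; ring.
Qed.

Definition sgmx {p} (e : {ffun 'I_p -> bool}) : 'M[C]_p :=
  diag_mx (\row_j (-1) ^+ e j).

Lemma sgmx_adj {p} (e : {ffun 'I_p -> bool}) : (sgmx e) ^t* = sgmx e.
Proof.
apply/matrixP => i j; rewrite !mxE eq_sym; case: eqP => [->|_]; last by rewrite conjC0.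
by rewrite mulr1n rmorphXn rmorphN rmorph1.
Qed.

Lemma sgmx_sqr {p} (e : {ffun 'I_p -> bool}) : sgmx e *m sgmx e = 1%:M.
Proof.
rewrite mulmx_diag -diag_const_mx; congr diag_mx; apply/rowP => j; rewrite !mxE.
by rewrite -expr2 sqrr_sign.
Qed.

Lemma sgmx_unitary {p} (e : {ffun 'I_p -> bool}) : sgmx e \is unitarymx.
Proof. by apply/unitarymxP; rewrite sgmx_adj sgmx_sqr. Qed.

(** Signs at different places are orthogonal, so averaging over them removes the interaction between
    different columns of [A]. *)
Lemma sum_nsq_signs {a p c} (A : 'M[C]_(a, p)) (Y : 'M[C]_(p, c)) :
  \sum_(e : {ffun 'I_p -> bool}) nsq (A *m sgmx e *m Y) =
  2 ^+ p * \sum_b nsq (col b A) * nsq (row b Y).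
Proof.
have entry (e : {ffun 'I_p -> bool}) r s :
    (A *m sgmx e *m Y) r s = \sum_b (-1) ^+ e b * (A r b * Y b s).
  rewrite mxE; apply: eq_bigr => b _; rewrite mul_mx_diag !mxE; ring.
rewrite /nsq exchange_big /=.
under eq_bigr => r _.
  rewrite exchange_big /=.
  under eq_bigr => s _.
    under eq_bigr do rewrite entry.
    rewrite sum_sqn_signs; over.
  over.
under eq_bigr do rewrite -mulr_sumr.
rewrite -mulr_sumr; congr (_ * _).
transitivity (\sum_i \sum_b \sum_j sqn (A i b * Y b j)).
  by apply: eq_bigr => i _; rewrite exchange_big.
rewrite exchange_big /=; apply: eq_bigr => b _.
rewrite [X in _ = X * _](_ : _ = \sum_r sqn (A r b)); last first.
  by apply: eq_bigr => r _; rewrite big_ord1 mxE.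
rewrite big_ord1 mulr_suml; apply: eq_bigr => r _.
by rewrite mulr_sumr; apply: eq_bigr => s _; rewrite mxE sqnM.
Qed.

Lemma perm_unitary {p} (s : {perm 'I_p}) : (perm_mx s : 'M[C]_p) \is unitarymx.
Proof.
apply/unitarymxP; rewrite tr_perm_mx map_perm_mx -perm_mxM.
by rewrite fingroup.mulgV perm_mx1.
Qed.

Lemma nsq_col {a p} (A : 'M[C]_(a, p)) :
  nsq A = \sum_b nsq (col b A).
Proof.
rewrite /nsq exchange_big; apply: eq_bigr => b _; apply: eq_bigr => i _.
by rewrite big_ord1 mxE.
Qed.

Lemma row_perm_mul {p c} (s : {perm 'I_p}) (Y : 'M[C]_(p, c)) i :
  row i (perm_mx s *m Y) = row (s i) Y.
Proof. by rewrite -row_permE; apply/rowP => j; rewrite !mxE. Qed.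

End Signs.

(** * Upper bounds for Haar integrals *)

Section Haar.
Context {R : realType} {p : nat} (mu : probability (cmx R p) R).
Hypothesis muH : is_haar mu.
Notation C := R[i].
Notation M := 'M[C]_p.

Lemma integral_haar_mull (phi : cmx R p -> R) (V : M) : V \is unitarymx ->
  measurable_fun setT phi -> (forall x, 0 <= phi x) ->
  (\int[mu]_x (phi ((V *m (x : M)) : M))%:E = \int[mu]_x (phi x)%:E)%E.
Proof.
move=> uV mphi phi0.
pose g (x : cmx R p) : cmx R p := V *m (x : M).
have mg : measurable_fun setT g.
  by apply/mxmeasP; apply: mxmeas_mul; [exact: mxmeas_cst|exact: mxmeas_cmx].
pose gm : {mfun cmx R p >-> cmx R p} := HB.pack g (isMeasurableFun.Build _ _ _ _ _ mg).
transitivity (\int[distribution mu gm]_x (phi x)%:E)%E.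
  rewrite ge0_integral_distribution//; first exact/measurable_EFinP.
apply: eq_measure_integral => A mA _.
by have [_ /(_ V A uV mA) []] := muH.
Qed.

(** The matrices that are not unitary form a null set, measurable because unitarity is the vanishing
    of a measurable function. This makes unitarity of [x] available under the integral. *)
Lemma le_integral_haar (phi psi : cmx R p -> R) :
  measurable_fun setT phi -> measurable_fun setT psi ->
  (forall x, 0 <= phi x) -> (forall x, 0 <= psi x) ->
  (forall x : M, x \is unitarymx -> phi x <= psi x) ->
  (\int[mu]_x (phi x)%:E <= \int[mu]_x (psi x)%:E)%E.
Proof.
move=> mphi mpsi phi0 psi0 le; apply: ae_ge0_le_integral => //.
- by move=> x _; rewrite lee_fin.
- exact/measurable_EFinP.
- by move=> x _; rewrite lee_fin.
- exact/measurable_EFinP.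
pose Un := [set U : cmx R p | (U : M) \is unitarymx].
have mUn : measurable Un.
  have m1 : measurable_fun setT (fun x : cmx R p => nsq ((x : M) *m (x : M) ^t* - 1%:M)).
    apply: measurable_nsq; apply: mxmeas_add; last exact: mxmeas_cst.
    by apply: mxmeas_mul; [exact: mxmeas_cmx|apply: mxmeas_adj; exact: mxmeas_cmx].
  have := m1 measurableT [set 0] (measurable_set1 _); rewrite setTI.
  congr measurable; apply/seteqP; split => x /=.
    by move/nsq_eq0/eqP; rewrite subr_eq0 => /eqP/unitarymxP.
  by move/unitarymxP => ->; rewrite subrr nsq0.
exists (~` Un); split.
- exact: measurableC.
- have := probability_setC mu mUn; have [-> _] := muH.
  by rewrite subee.
- by move=> x /= nle Ux; apply: nle => _; rewrite lee_fin; exact: le.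
Qed.

(** Left invariance replaces [phi] under the integral by its average over a finite family of unitary
    matrices. The estimates below take signs or transpositions for [V]. *)
Lemma haar_average (E : finType) (V : E -> M) (phi psi : cmx R p -> R) :
  (0 < #|E|)%N -> (forall e, V e \is unitarymx) ->
  measurable_fun setT phi -> measurable_fun setT psi ->
  (forall x, 0 <= phi x) -> (forall x, 0 <= psi x) ->
  (forall x : M, x \is unitarymx -> \sum_e phi (V e *m x) <= #|E|%:R * psi x) ->
  (\int[mu]_x (phi x)%:E <= \int[mu]_x (psi x)%:E)%E.
Proof.
move=> E0 uV mphi mpsi phi0 psi0 le.
have mphiV e : measurable_fun setT (fun x : cmx R p => phi (V e *m (x : M))).
  apply: (measurableT_comp mphi); apply/mxmeasP.
  by apply: mxmeas_mul; [exact: mxmeas_cst|exact: mxmeas_cmx].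
have cE : (0 : R) < #|E|%:R by rewrite ltr0n.
rewrite -(@lee_pmul2l _ #|E|%:R%:E)// -[leRHS]ge0_integralZl//; last 2 first.
- exact/measurable_EFinP.
- by move=> x _; rewrite lee_fin.
have -> : (#|E|%:R%:E * \int[mu]_x (phi x)%:E =
    \int[mu]_x (\sum_e phi (V e *m (x : M)))%:E)%E.
  under [RHS]eq_integral do rewrite -sumEFin.
  rewrite ge0_integral_sum//; last 2 first.
  - by move=> e; exact/measurable_EFinP.
  - by move=> e x _; rewrite lee_fin.
  under eq_bigr do rewrite integral_haar_mull//.
  rewrite -[in RHS](mul1e (\int[mu]_x (phi x)%:E)%E).
  rewrite -ge0_sume_distrl// sumEFin sumr_const//.
apply: le_integral_haar => //.
- exact: measurable_sum.
- exact: measurable_funM.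
- by move=> x; apply: sumr_ge0.
- by move=> x; rewrite mulr_ge0// ltW.
Qed.

(** [x] and [- x] have the same law and opposite cross terms with [A]. *)
Lemma haar_nsqDM {a} (A B : 'M[C]_(a, p)) :
  (\int[mu]_x (nsq (A + B *m (x : M)))%:E <= (nsq A + nsq B)%:E)%E.
Proof.
pose V (b : bool) : M := (-1) ^+ b *: 1%:M.
apply: (@le_trans _ _ (\int[mu]_x (nsq A + nsq B)%:E)%E); last first.
  by rewrite integral_cst_prob.
apply: (@haar_average _ V (fun x => nsq (A + B *m (x : M))) (fun=> nsq A + nsq B)) => //.
- by rewrite card_bool.
- case; apply/unitarymxP; rewrite /V adjZ adj1 -scalemxAl -scalemxAr mulmx1 scalerA.
    by rewrite rmorphXn rmorphN rmorph1 /= expr1 mulrNN mulr1 scale1r.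
  by rewrite expr0 rmorph1 mulr1 scale1r.
- apply: measurable_nsq; apply: mxmeas_add; first exact: mxmeas_cst.
  by apply: mxmeas_mul; [exact: mxmeas_cst|exact: mxmeas_cmx].
- by move=> x; exact: nsq_ge0.
- by move=> x; rewrite addr_ge0 ?nsq_ge0.
move=> x ux; rewrite big_bool /= /V card_bool expr1 expr0 scale1r mul1mx.
rewrite scaleN1r mulNmx mul1mx mulmxN !nsqD ipNr nsqN nsq_mulr_unitary//.
by rewrite le_eqVlt; apply/orP; left; apply/eqP; ring.
Qed.

(** Transpositions exchange row [i] with any other, so all the rows share one mean square, and the
    squares of the rows add up to [nsq B]. *)
Lemma haar_nsq_row {c} (B : 'M[C]_(p, c)) (i : 'I_p) :
  (\int[mu]_x (nsq (row i ((x : M) *m B)))%:E <= (nsq B / p%:R)%:E)%E.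
Proof.
have p0 : (0 < p)%N by exact: leq_ltn_trans (ltn_ord i).
apply: (@le_trans _ _ (\int[mu]_x (nsq B / p%:R)%:E)%E); last first.
  by rewrite integral_cst_prob.
apply: (@haar_average _ (fun j => perm_mx (tperm i j) : M)
  (fun x => nsq (row i ((x : M) *m B))) (fun=> nsq B / p%:R)) => //.
- by rewrite card_ord.
- by move=> j; exact: perm_unitary.
- apply: measurable_nsq; apply: mxmeas_row.
  by apply: mxmeas_mul; [exact: mxmeas_cmx|exact: mxmeas_cst].
- by move=> x; exact: nsq_ge0.
- by move=> x; rewrite divr_ge0 ?nsq_ge0.
move=> x ux; rewrite card_ord mulrC divfK ?pnatr_eq0 -?lt0n//.
rewrite -(nsq_mull_unitary B ux) [leRHS]nsq_row.
apply: ler_sum => j _.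
by rewrite -mulmxA row_perm_mul tpermL.
Qed.

(** Signs decouple the columns of [A], and each row of [x B] then carries the share [1/p] of
    [nsq B]. This gain is the source of the [1/p] in the off-diagonal terms. *)
Lemma haar_nsq_mul {a c} (A : 'M[C]_(a, p)) (B : 'M[C]_(p, c)) :
  (\int[mu]_x (nsq (A *m (x : M) *m B))%:E <= (nsq A * nsq B / p%:R)%:E)%E.
Proof.
have mxB : mxmeas (fun x : cmx R p => (x : M) *m B).
  by apply: mxmeas_mul; [exact: mxmeas_cmx|exact: mxmeas_cst].
apply: (@le_trans _ _ (\int[mu]_x (\sum_b nsq (col b A) *
    nsq (row b ((x : M) *m B)))%:E)%E).
  apply: (@haar_average _ (@sgmx R p) (fun x => nsq (A *m (x : M) *m B))) => //.
  - by rewrite card_ffun card_bool expn_gt0.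
  - by move=> e; exact: sgmx_unitary.
  - apply: measurable_nsq; under eq_fun do rewrite -mulmxA.
    by apply: mxmeas_mul => //; exact: mxmeas_cst.
  - apply: measurable_sum => b; apply: measurable_funM => //.
    by apply: measurable_nsq; exact: mxmeas_row.
  - by move=> x; exact: nsq_ge0.
  - by move=> x; apply: sumr_ge0 => b _; rewrite mulr_ge0 ?nsq_ge0.
  move=> x ux; rewrite card_ffun card_bool card_ord natrX -sum_nsq_signs.
  by apply: ler_sum => e _; rewrite !mulmxA.
under eq_integral do rewrite -sumEFin.
rewrite ge0_integral_sum//; last 2 first.
- move=> b; apply/measurable_EFinP; apply: measurable_funM => //.
  by apply: measurable_nsq; exact: mxmeas_row.
- by move=> b x _; rewrite lee_fin mulr_ge0 ?nsq_ge0.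
rewrite (nsq_col A) -mulrA mulr_suml -sumEFin; apply: lee_sum => b _.
under eq_integral do rewrite EFinM.
rewrite ge0_integralZl//; last 3 first.
- by apply/measurable_EFinP; apply: measurable_nsq; exact: mxmeas_row.
- by move=> x _; rewrite lee_fin nsq_ge0.
- by rewrite lee_fin nsq_ge0.
by rewrite EFinM lee_wpmul2l ?lee_fin ?nsq_ge0//; exact: haar_nsq_row.
Qed.

End Haar.

(** * Conjugation of a fixed matrix by a Haar unitary *)

Section HaarConjugation.
Context {R : realType} {p : nat} (mu : probability (cmx R p) R).
Hypothesis muH : is_haar mu.
Notation C := R[i].
Notation M := 'M[C]_p.

(** [B B^*] is diagonal, so that no two columns of [X] interact. *)
Lemma nsq_mul_orthorows {a c} (X : 'M[C]_(a, p)) (B : 'M[C]_(p, c)) :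
  (forall i j, i != j -> (B *m B ^t*) i j = 0) ->
  nsq (X *m B) = \sum_b nsq (col b X) * nsq (row b B).
Proof.
move=> ortB; have -> : nsq (X *m B) = ip X (X *m (B *m B ^t*)).
  by rewrite -ipxx ip_mulr mulmxA.
have -> : B *m B ^t* = diag_mx (\row_b (nsq (row b B))%:C).
  apply/matrixP => i j; rewrite [RHS]mxE; have [<-|ij] := eqVneq i j.
    by rewrite nsq_rowE mxE.
  by rewrite ortB.
rewrite /ip exchange_big; apply: eq_bigr => b _ /=.
rewrite [nsq (col b X)](_ : _ = \sum_i sqn (X i b)); last first.
  by apply: eq_bigr => i _; rewrite big_ord1 mxE.
rewrite mulr_suml; apply: eq_bigr => i _.
by rewrite mul_mx_diag !mxE /cip ReM ImM /= /sqn; ring.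
Qed.

Let N (M0 : M) (x : cmx R p) : M := (x : M) *m M0 *m (x : M) ^t*.

Let mxN M0 : mxmeas (N M0).
Proof.
apply: mxmeas_mul; last by apply: mxmeas_adj; exact: mxmeas_cmx.
by apply: mxmeas_mul; [exact: mxmeas_cmx|exact: mxmeas_cst].
Qed.

Let N_mull M0 (V x : M) : N M0 (V *m x) = V *m N M0 x *m V ^t*.
Proof. by rewrite /N adjM !mulmxA. Qed.

Let nsqN_unitary M0 (x : M) : x \is unitarymx -> nsq (N M0 x) = nsq M0.
Proof.
by move=> ux; rewrite nsq_mulr_unitary ?trmxC_unitary// nsq_mull_unitary.
Qed.

Lemma haar_conj_row (M0 : M) i :
  (\int[mu]_x (nsq (row i (N M0 x)))%:E <= (nsq M0 / p%:R)%:E)%E.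
Proof.
have p0 : (0 < p)%N by exact: leq_ltn_trans (ltn_ord i).
apply: (@le_trans _ _ (\int[mu]_x (nsq M0 / p%:R)%:E)%E); last first.
  by rewrite integral_cst_prob.
apply: (haar_average muH (V := fun j => perm_mx (tperm i j) : M)
  (phi := fun x => nsq (row i (N M0 x))) (psi := fun=> nsq M0 / p%:R)) => //.
- by rewrite card_ord.
- by move=> j; exact: perm_unitary.
- by apply: measurable_nsq; apply: mxmeas_row.
- by move=> x; exact: nsq_ge0.
- by move=> x; rewrite divr_ge0 ?nsq_ge0.
move=> x ux; rewrite card_ord mulrC divfK ?pnatr_eq0 -?lt0n//.
rewrite -(nsqN_unitary M0 ux) [leRHS]nsq_row.
apply: ler_sum => j _; rewrite N_mull row_mul nsq_mulr_unitary; last first.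
  by rewrite trmxC_unitary perm_unitary.
by rewrite row_perm_mul tpermL.
Qed.

Let sqn_le_row {a b} (A : 'M[C]_(a, b)) i j : sqn (A i j) <= nsq (row i A).
Proof.
rewrite /nsq big_ord1 (bigD1 j)//= mxE lerDl.
by apply: sumr_ge0 => k _; exact: sqn_ge0.
Qed.

(** Permutations that fix [i] permute the other entries of row [i], so each of these takes at most
    the share [1/(p - 1) <= 2/p] of the row. The diagonal entry is bounded by the whole row, and for
    [M0 = 1] it carries all of it. *)
Lemma haar_conj_entry (M0 : M) i j :
  (\int[mu]_x (sqn (N M0 x i j))%:E <=
   (nsq M0 / p%:R * (if i == j then 1 else 2 / p%:R))%:E)%E.
Proof.
have mrow : measurable_fun setT (fun x => nsq (row i (N M0 x))).
  by apply: measurable_nsq; exact: mxmeas_row.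
have msqn : measurable_fun setT (fun x => sqn (N M0 x i j)).
  exact: measurable_sqn.
have [_|ij] := eqVneq.
  rewrite mulr1; apply: le_trans (haar_conj_row M0 i).
  apply: le_integral_ge0 => x; rewrite lee_fin ?sqn_ge0//.
have p1 : (1 < p)%N.
  rewrite ltnNge; apply/negP => p1.
  by move/negP: ij; apply; apply/eqP/val_inj; case: i j {mrow msqn} => [[|?] ip] [[|?] jp] //=;
    have := leq_trans ip p1; have := leq_trans jp p1.
pose E := {k : 'I_p | k != i}.
have cE : #|{: E}| = p.-1.
  by rewrite card_sig cardC1 card_ord.
have cE0 : (0 < #|{: E}|)%N by rewrite cE -ltnS prednK// ltnW.
pose t := (2 / p%:R : R).
have t0 : 0 <= t by rewrite divr_ge0.
(* This is [p <= 2 (p - 1)]; here [p] is at least 2 because [i] and [j] differ. *)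
have tE : 1 <= #|{: E}|%:R * t.
  rewrite cE /t mulrA ler_pdivlMr ?ltr0n 1?ltnW// mul1r -natrM ler_nat.
  by case: (p) p1 => // -[]// q _; rewrite /= muln2 -addnn addnS addSn !ltnS leq_addr.
apply: (@le_trans _ _ (\int[mu]_x (t * nsq (row i (N M0 x)))%:E)%E).
  apply: (haar_average muH (V := fun k : E => perm_mx (tperm j (val k)) : M)
    (phi := fun x => sqn (N M0 x i j))
    (psi := fun x => t * nsq (row i (N M0 x)))) => //.
  - by move=> k; exact: perm_unitary.
  - exact: measurable_funM.
  - by move=> x; exact: sqn_ge0.
  - by move=> x; rewrite mulr_ge0 ?nsq_ge0.
  move=> x ux; rewrite mulrA.
  apply: (@le_trans _ _ (1 * nsq (row i (N M0 x)))); last by rewrite ler_wpM2r ?nsq_ge0.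
  rewrite mul1r.
  have -> : \sum_(k : E) sqn (N M0 (perm_mx (tperm j (val k)) *m x) i j) =
      \sum_(k : E) sqn (N M0 x i (val k)).
    apply: eq_bigr => -[k ki] _ /=; congr sqn.
    rewrite N_mull tr_perm_mx map_perm_mx -col_permE mxE -row_permE mxE tpermL.
    by rewrite tpermD// eq_sym.
  have -> : \sum_(k : E) sqn (N M0 x i (val k)) = \sum_(k | k != i) sqn (N M0 x i k).
    by rewrite [RHS]big_sub /=; apply: eq_bigl.
  rewrite /nsq big_ord1 [leRHS](bigD1 i)//=.
  rewrite -[leLHS]add0r; apply: lerD; first exact: sqn_ge0.
  by apply: ler_sum => k _; rewrite [X in _ <= sqn X]mxE.
under eq_integral do rewrite EFinM.
rewrite ge0_integralZl//; last 2 first.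
- exact/measurable_EFinP.
- by move=> x _; rewrite lee_fin nsq_ge0.
rewrite [X in (_ <= X%:E)%E]mulrC [leRHS]EFinM lee_wpmul2l ?lee_fin//.
exact: haar_conj_row.
Qed.

Lemma haar_conj_row_mul {c} (M0 : M) (B : 'M[C]_(p, c)) i :
  (forall i j, i != j -> (B *m B ^t*) i j = 0) ->
  (\int[mu]_x (nsq (row i (N M0 x *m B)))%:E <=
   (nsq M0 / p%:R * (nsq (row i B) + 2 * nsq B / p%:R))%:E)%E.
Proof.
move=> ortB.
have -> : (\int[mu]_x (nsq (row i (N M0 x *m B)))%:E =
    \int[mu]_x (\sum_b (sqn (N M0 x i b) * nsq (row b B))%:E))%E.
  apply: eq_integral => x _; rewrite row_mul nsq_mul_orthorows// sumEFin.
  congr (_%:E); apply: eq_bigr => b _; congr (_ * _).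
  by rewrite /nsq !big_ord1 [X in sqn X]mxE [X in sqn X]mxE.
have msqn b : measurable_fun setT (fun x => sqn (N M0 x i b)).
  exact: measurable_sqn.
rewrite ge0_integral_sum//; last 2 first.
- by move=> b; apply/measurable_EFinP; exact: measurable_funM.
- by move=> b x _; rewrite lee_fin mulr_ge0 ?sqn_ge0 ?nsq_ge0.
apply: (@le_trans _ _ (\sum_b (nsq M0 / p%:R * (if i == b then 1 else 2 / p%:R) *
    nsq (row b B))%:E)%E).
  apply: lee_sum => b _; under eq_integral do rewrite mulrC EFinM.
  rewrite ge0_integralZl//; last 3 first.
  - exact/measurable_EFinP.
  - by move=> x _; rewrite lee_fin sqn_ge0.
  - by rewrite lee_fin nsq_ge0.
  rewrite [X in (_ <= X%:E)%E]mulrC EFinM lee_wpmul2l ?lee_fin ?nsq_ge0//.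
  exact: haar_conj_entry.
rewrite sumEFin lee_fin.
under eq_bigr do rewrite -mulrA; rewrite -mulr_sumr.
rewrite ler_wpM2l ?divr_ge0 ?nsq_ge0// (bigD1 i)//= eqxx mul1r lerD2l.
rewrite mulrAC [nsq B]nsq_row mulr_sumr [leRHS](bigD1 i)//=.
rewrite -[leLHS]add0r; apply: lerD; first by rewrite mulr_ge0 ?divr_ge0 ?nsq_ge0.
by apply: ler_sum => b bi; rewrite eq_sym (negbTE bi).
Qed.

Lemma haar_nsq_conj_ortho {a c} (V : 'M[C]_(a, p)) (M0 : M) (B : 'M[C]_(p, c)) :
  (forall i j, i != j -> (B *m B ^t*) i j = 0) ->
  (\int[mu]_x (nsq (V *m N M0 x *m B))%:E <=
   (nsq M0 / p%:R * (nsq (V *m B) + 2 * nsq V * nsq B / p%:R))%:E)%E.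
Proof.
move=> ortB.
have mrow b : measurable_fun setT (fun x => nsq (row b (N M0 x *m B))).
  apply: measurable_nsq; apply: mxmeas_row.
  by apply: mxmeas_mul; [exact: mxN|exact: mxmeas_cst].
apply: (@le_trans _ _ (\int[mu]_x (\sum_b nsq (col b V) *
    nsq (row b (N M0 x *m B)))%:E)%E).
  apply: (haar_average muH (V := @sgmx R p)
    (phi := fun x => nsq (V *m N M0 x *m B))) => //.
  - by rewrite card_ffun card_bool expn_gt0.
  - by move=> e; exact: sgmx_unitary.
  - apply: measurable_nsq; apply: mxmeas_mul; last exact: mxmeas_cst.
    by apply: mxmeas_mul; [exact: mxmeas_cst|exact: mxN].
  - by apply: measurable_sum => b; exact: measurable_funM.
  - by move=> x; exact: nsq_ge0.
  - by move=> x; apply: sumr_ge0 => b _; rewrite mulr_ge0 ?nsq_ge0.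
  move=> x ux; rewrite card_ffun card_bool card_ord natrX -sum_nsq_signs.
  apply: ler_sum => e _; rewrite N_mull sgmx_adj.
  move: (N M0 x) => X; rewrite !mulmxA -(mulmxA _ (sgmx e) B).
  have ortSB i j : i != j -> (sgmx e *m B *m (sgmx e *m B) ^t*) i j = 0.
    move=> ij; rewrite adjM sgmx_adj mulmxA mul_mx_diag -(mulmxA (sgmx e)).
    by rewrite mxE mul_diag_mx mxE ortB// mulr0 mul0r.
  rewrite !nsq_mul_orthorows// le_eqVlt; apply/orP; left; apply/eqP.
  apply: eq_bigr => b _; congr (_ * _).
  have -> : row b (sgmx e *m B) = (-1) ^+ e b *: row b B.
    by apply/rowP => k; rewrite mxE mul_diag_mx !mxE.
  by rewrite nsqZ /sqn; case: (e b); rewrite ?expr1 ?expr0 /=; ring.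
under eq_integral do rewrite -sumEFin.
rewrite ge0_integral_sum//; last 2 first.
- by move=> b; apply/measurable_EFinP; exact: measurable_funM.
- by move=> b x _; rewrite lee_fin mulr_ge0 ?nsq_ge0.
rewrite [nsq (V *m B)]nsq_mul_orthorows// [nsq V]nsq_col.
have -> : nsq M0 / p%:R * (\sum_b nsq (col b V) * nsq (row b B) +
    2 * (\sum_b nsq (col b V)) * nsq B / p%:R) =
  \sum_b nsq (col b V) * (nsq M0 / p%:R * (nsq (row b B) + 2 * nsq B / p%:R)).
  rewrite [RHS](eq_bigr (fun b => nsq M0 / p%:R * (nsq (col b V) * nsq (row b B)) +
    nsq M0 / p%:R * (2 * nsq B / p%:R) * nsq (col b V))); last by move=> b _; ring.
  by rewrite big_split /= -!mulr_sumr; ring.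
rewrite -sumEFin; apply: lee_sum => b _.
under eq_integral do rewrite EFinM.
rewrite ge0_integralZl//; last 3 first.
- exact/measurable_EFinP.
- by move=> x _; rewrite lee_fin nsq_ge0.
- by rewrite lee_fin nsq_ge0.
by rewrite EFinM lee_wpmul2l ?lee_fin ?nsq_ge0//; exact: haar_conj_row_mul.
Qed.

(** An eigenbasis of [B B^*] serves as [U]. *)
Lemma unitary_orthorows {c} (B : 'M[C]_(p, c)) :
  exists2 U : M, U \is unitarymx &
    forall i j, i != j -> ((U *m B) *m (U *m B) ^t*) i j = 0.
Proof.
have [D DE] : exists D, D = B *m B ^t* by exists (B *m B ^t*).
have /orthomx_spectralP eD : D \is normalmx.
  by apply/normalmxP; rewrite DE adjM trmxCK.
have uU := spectral_unitarymx D.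
exists (spectralmx D) => // i j ij.
have PD : spectralmx D *m D = diag_mx (spectral_diag D) *m spectralmx D.
  by rewrite [X in _ *m X]eD !mulmxA mulmxV ?mul1mx ?unitarymx_unit.
rewrite adjM mulmxA -(mulmxA _ B) -DE PD -mulmxA unitary_adjl// mulmx1 mxE.
by rewrite (negbTE ij).
Qed.

(** Left invariance absorbs the unitary that makes the rows of [B] orthogonal. The point of the
    bound is that [M0] enters as [nsq M0 / p], that is, as if it were spread evenly over all
    directions. *)
Lemma haar_nsq_conj {a c} (V : 'M[C]_(a, p)) (M0 : M) (B : 'M[C]_(p, c)) :
  (\int[mu]_x (nsq (V *m (x : M) *m M0 *m (x : M) ^t* *m B))%:E <=
   (nsq M0 / p%:R * (nsq (V *m B) + 2 * nsq V * nsq B / p%:R))%:E)%E.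
Proof.
have [U uU ortB] := unitary_orthorows B.
have uU' : U ^t* \is unitarymx by rewrite trmxC_unitary.
have VE (x : M) : V *m (U ^t* *m x) *m M0 *m (U ^t* *m x) ^t* *m B =
    (V *m U ^t*) *m N M0 x *m (U *m B).
  by rewrite /N adjM trmxCK !mulmxA.
have mphi : measurable_fun setT (fun x : cmx R p =>
    nsq (V *m (x : M) *m M0 *m (x : M) ^t* *m B)).
  apply: measurable_nsq; apply: mxmeas_mul; last exact: mxmeas_cst.
  apply: mxmeas_mul; last by apply: mxmeas_adj; exact: mxmeas_cmx.
  apply: mxmeas_mul; last exact: mxmeas_cst.
  by apply: mxmeas_mul; [exact: mxmeas_cst|exact: mxmeas_cmx].
rewrite -(integral_haar_mull muH uU' mphi) => [|x]; last exact: nsq_ge0.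
under eq_integral do rewrite VE.
apply: le_trans (haar_nsq_conj_ortho _ _ ortB) _.
by rewrite mulmxA -(mulmxA V) unitary_adjr// mulmx1 nsq_mull_unitary// nsq_mulr_unitary.
Qed.

End HaarConjugation.

(** * Consequences of an operator norm bound *)

Section OperatorNorm.
Context {R : realType} {n : nat}.
Notation C := R[i].

Lemma vnormE (v : 'cV[C]_n) : vnorm v = Num.sqrt (nsq v).
Proof. by rewrite /vnorm /nsq; congr Num.sqrt; apply: eq_bigr => i _; rewrite big_ord1. Qed.

Lemma nsq_mul_opnorm (A : 'M[C]_n) (c : R) (w : 'cV[C]_n) :
  opnorm A <= c -> nsq (A *m w) <= c ^+ 2 * nsq w.
Proof.
move=> Ac.
have ub v : vnorm v <= 1 -> vnorm (A *m v) <= c.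
  move=> v1; apply: le_trans Ac; apply: ub_le_sup; last by exists v.
  (* The Frobenius norm bounds the set, so that its [sup] is a true supremum and not a default
     value. *)
  exists (Num.sqrt (nsq A)) => _ [u u1 <-].
  rewrite vnormE ler_sqrt ?nsq_ge0//; apply: le_trans (nsqM _ _) _.
  rewrite -[leRHS]mulr1 ler_wpM2l ?nsq_ge0//.
  by move: u1; rewrite /= vnormE -[X in _ <= X -> _]sqrtr1 ler_sqrt.
have [w0|w0] := eqVneq (nsq w) 0.
  by rewrite (nsq_eq0 w0) mulmx0 !nsq0 mulr0.
have wp : 0 < nsq w by rewrite lt_def w0 nsq_ge0.
pose t := (Num.sqrt (nsq w))^-1.
have t2 : t ^+ 2 = (nsq w)^-1 by rewrite exprVn sqr_sqrtr ?nsq_ge0.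
have := ub (t%:C *: w); rewrite vnormE nsqZr t2 mulVf// sqrtr1 => /(_ (lexx _)).
rewrite -scalemxAr vnormE nsqZr t2 => h.
have c0 : 0 <= c by apply: le_trans h; exact: sqrtr_ge0.
move: h; rewrite -[X in _ <= X]ger0_norm// -sqrtr_sqr ler_sqrt ?sqr_ge0//.
by rewrite mulrC ler_pdivrMr.
Qed.

Lemma ip_mul_opnorm (A : 'M[C]_n) (c : R) (w : 'cV[C]_n) :
  0 <= c -> opnorm A <= c -> ip (A *m w) w <= c * nsq w.
Proof.
move=> c0 Ac; apply: le_trans (ip_le _ _) _.
apply: (@le_trans _ _ (Num.sqrt (c ^+ 2 * nsq w) * Num.sqrt (nsq w))).
  rewrite ler_wpM2r ?sqrtr_ge0// ler_sqrt ?mulr_ge0 ?sqr_ge0 ?nsq_ge0//.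
  exact: nsq_mul_opnorm.
by rewrite sqrtrM ?sqr_ge0// sqrtr_sqr ger0_norm// -mulrA -expr2 sqr_sqrtr ?nsq_ge0.
Qed.

End OperatorNorm.

(** * Tensoring with an identity matrix *)

Section Tensor.
Context {R : realType} {n k : nat}.
Notation C := R[i].
Notation p := (n * k)%N.

Definition amp (A : 'M[C]_n) : 'M[C]_p := mxtens.tensmx A (1%:M : 'M[C]_k).

Lemma ampM (A B : 'M[C]_n) : amp A *m amp B = amp (A *m B).
Proof. by rewrite /amp mxtens.tensmx_mul mulmx1. Qed.

Lemma amp_adj (A : 'M[C]_n) : (amp A) ^t* = amp (A ^t*).
Proof.
rewrite /amp mxtens.trmx_tens trmx1; apply/matrixP => i j.
case: (mxtens.mxtens_indexP i) => i1 i2; case: (mxtens.mxtens_indexP j) => j1 j2.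
by rewrite mxE !mxtens.tensmxE rmorphM !mxE; congr (_ * _); rewrite rmorph_nat.
Qed.

Lemma amp1 : amp 1%:M = 1%:M.
Proof.
apply/matrixP => i j.
case: (mxtens.mxtens_indexP i) => i1 i2; case: (mxtens.mxtens_indexP j) => j1 j2.
rewrite mxtens.tensmxE !mxE (can_eq (@mxtens.mxtens_indexK n k)) xpair_eqE -natrM.
by rewrite mulnb.
Qed.

(** Cutting each column of [V^*] along the second tensor index leaves vectors of length [n] on which
    the tensored matrix acts as [A], so the bound passes over without a factor [k]. *)
Lemma ip_amp_opnorm {q} (A : 'M[C]_n) (c : R) (V : 'M[C]_(q, p)) :
  0 <= c -> opnorm A <= c -> ip (amp A) (V ^t* *m V) <= c * nsq V.
Proof.
move=> c0 Ac.
have -> : ip (amp A) (V ^t* *m V) = ip (amp A *m V ^t*) (V ^t*).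
  by rewrite ip_mulr trmxCK.
rewrite -(nsq_adj V); move: (V ^t*) => W.
pose w r (j : 'I_k) : 'cV[C]_n := \col_i W (mxtens.mxtens_index (i, j)) r.
have sumI (F : 'I_p -> R) : \sum_i F i = \sum_j \sum_i F (mxtens.mxtens_index (i, j)).
  rewrite (reindex (@mxtens.mxtens_index n k)) /=; last first.
    apply: onW_bij; exists (@mxtens.mxtens_unindex n k).
      exact: mxtens.mxtens_indexK.
    exact: mxtens.mxtens_unindexK.
  rewrite exchange_big pair_big /=.
  by apply: eq_bigr => -[i j].
have nsqE : nsq W = \sum_r \sum_j nsq (w r j).
  rewrite /nsq exchange_big; apply: eq_bigr => r _; rewrite sumI.
  apply: eq_bigr => j _; apply: eq_bigr => i _; by rewrite big_ord1 mxE.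
have ipE : ip (amp A *m W) W = \sum_r \sum_j ip (A *m w r j) (w r j).
  rewrite /ip exchange_big; apply: eq_bigr => r _; rewrite sumI.
  apply: eq_bigr => j _; apply: eq_bigr => i _; rewrite big_ord1.
  congr cip; last by rewrite mxE.
  rewrite [LHS]mxE [RHS]mxE.
  rewrite (reindex (@mxtens.mxtens_index n k)) /=; last first.
    apply: onW_bij; exists (@mxtens.mxtens_unindex n k).
      exact: mxtens.mxtens_indexK.
    exact: mxtens.mxtens_unindexK.
  transitivity (\sum_(i0 : 'I_n) \sum_(j0 : 'I_k)
     amp A (mxtens.mxtens_index (i, j)) (mxtens.mxtens_index (i0, j0)) *
     W (mxtens.mxtens_index (i0, j0)) r).
    by rewrite pair_big /=; apply: eq_bigr => -[].
  apply: eq_bigr => i0 _; rewrite (bigD1 j)//= big1 ?addr0 => [|j0 j0j].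
    by rewrite mxtens.tensmxE !mxE eqxx mulr1.
  by rewrite mxtens.tensmxE !mxE eq_sym (negbTE j0j) mulr0 mul0r.
rewrite ipE nsqE mulr_sumr; apply: ler_sum => r _.
rewrite mulr_sumr; apply: ler_sum => j _; exact: ip_mul_opnorm.
Qed.

End Tensor.

(** * Integrable functions with a known mean *)

Section LinearFunctionals.
Context {R : realType} d (T : measurableType d) (mu : probability T R).
Notation C := R[i].

(** Integrability travels with the value, so that signed linear combinations can be integrated
    exactly before any inequality is used. *)
Definition has_mean (f : T -> R) (v : R) : Prop :=
  mu.-integrable setT (EFin \o f) /\ (\int[mu]_x (f x)%:E = v%:E)%E.

Lemma has_mean_ext f g v : (forall x, f x = g x) -> has_mean f v -> has_mean g v.
Proof. by move=> /funext ->. Qed.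

Lemma has_mean_cst c : has_mean (fun=> c) c.
Proof.
split; last exact: integral_cst_prob.
exact: finite_measure_integrable_cst.
Qed.

Lemma has_meanD f g v w : has_mean f v -> has_mean g w ->
  has_mean (fun x => f x + g x) (v + w).
Proof.
move=> [if_ vf] [ig wg]; split.
  by rewrite (_ : EFin \o _ = (EFin \o f) \+ (EFin \o g))//; exact: integrableD.
under eq_integral do rewrite EFinD.
by rewrite integralD// vf wg.
Qed.

Lemma has_meanZ c f v : has_mean f v -> has_mean (fun x => c * f x) (c * v).
Proof.
move=> [if_ vf]; split.
  by rewrite (_ : EFin \o _ = (fun x => c%:E * (EFin \o f) x)%E)//; exact: integrableZl.
under eq_integral do rewrite EFinM.
by rewrite integralZl// vf.
Qed.

Lemma has_mean_sum (I : Type) (r : seq I) (Q : pred I) (f : I -> T -> R) v :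
  (forall i, Q i -> has_mean (f i) (v i)) ->
  has_mean (fun x => \sum_(i <- r | Q i) f i x) (\sum_(i <- r | Q i) v i).
Proof.
move=> h; elim: r => [|i r IH].
  by under eq_fun do rewrite big_nil; rewrite big_nil; exact: has_mean_cst.
rewrite big_cons; have [Qi|Qi] := boolP (Q i); last first.
  by under eq_fun do rewrite big_cons (negbTE Qi).
by under eq_fun do rewrite big_cons Qi; apply: has_meanD => //; exact: h.
Qed.

Lemma has_mean_ip {a} (F : T -> 'M[C]_a) (B : 'M[C]_a) : mx_integrable mu F ->
  has_mean (fun x => ip (F x) B) (ip (mx_expectation mu F) B).
Proof.
move=> iF; apply: has_mean_sum => i _; apply: has_mean_sum => j _.
have [i1 i2] := iF i j.
have mean f : mu.-integrable setT (EFin \o f) -> has_mean f (Rintegral mu setT f).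
  by move=> hf; split => //; rewrite /Rintegral fineK//; exact: integrable_fin_num.
rewrite /cip mxE /=.
apply: (@has_mean_ext (fun x => complex.Re (B i j) * complex.Re (F x i j) +
   complex.Im (B i j) * complex.Im (F x i j))); first by move=> x; ring.
rewrite ![Rintegral _ _ _ * _]mulrC.
by apply: has_meanD; apply: has_meanZ; exact: mean.
Qed.

Lemma le_has_mean f g v : (forall x, 0 <= f x) -> (forall x, f x <= g x) ->
  has_mean g v -> (\int[mu]_x (f x)%:E <= v%:E)%E.
Proof.
by move=> f0 fg [_ <-]; apply: le_integral_ge0 => x; rewrite lee_fin.
Qed.

End LinearFunctionals.

(** * Moments of one random factor [G] tensored with the identity *)

Section Moments.
Context {R : realType} {n : nat} (k : nat) (c2 c3 : R) (mu : probability (cmx R n) R).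
Hypothesis c2_ge1 : 1 <= c2.
Hypothesis momG : moment_conditions c2 c3 mu.
Notation C := R[i].
Notation p := (n * k)%N.

Let ampG (x : cmx R n) : 'M[C]_p := amp (x : 'M[C]_n).
Let Gam (x : cmx R n) : 'M[C]_p := ampG x *m (ampG x) ^t*.

Let GamE x : Gam x = amp ((x : 'M[C]_n) *m (x : 'M[C]_n) ^t*).
Proof. by rewrite /Gam /ampG amp_adj ampM. Qed.

Let Gam_adj x : (Gam x) ^t* = Gam x.
Proof. by rewrite /Gam adjM trmxCK. Qed.

Lemma amp_integrable (F : cmx R n -> 'M[C]_n) : mx_integrable mu F ->
  mx_integrable mu (fun x => amp (F x) : 'M[C]_p) /\
  mx_expectation mu (fun x => amp (F x) : 'M[C]_p) = amp (mx_expectation mu F).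
Proof.
move=> iF.
have entry x i1 i2 j1 j2 :
    (amp (F x) : 'M[C]_p) (mxtens.mxtens_index (i1, i2)) (mxtens.mxtens_index (j1, j2)) =
    if i2 == j2 then F x i1 j1 else 0.
  by rewrite mxtens.tensmxE !mxE; case: eqP; rewrite ?mulr1 ?mulr0.
split.
  move=> i j; case: (mxtens.mxtens_indexP i) => i1 i2.
  case: (mxtens.mxtens_indexP j) => j1 j2.
  rewrite /comp; split; under eq_fun do rewrite entry.
    by case: eqP => _; [have [] := iF i1 j1|exact: finite_measure_integrable_cst].
  by case: eqP => _; [have [] := iF i1 j1|exact: finite_measure_integrable_cst].
apply/matrixP => i j; case: (mxtens.mxtens_indexP i) => i1 i2.
case: (mxtens.mxtens_indexP j) => j1 j2; rewrite mxE mxtens.tensmxE !mxE.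
under eq_Rintegral do rewrite entry.
under [X in _ +i* X]eq_Rintegral do rewrite entry.
case: eqP => _; rewrite ?mulr1 ?mulr0//.
by rewrite /Rintegral !integral_cst_prob.
Qed.

Let mean1 (B : 'M[C]_p) : has_mean mu (fun x => ip (Gam x) B) (ip 1%:M B).
Proof.
have [_ [i1 e1] _ _] := momG.
have [ia ea] := amp_integrable i1.
have := has_mean_ip B ia; rewrite ea e1 amp1.
by apply: has_mean_ext => x; rewrite GamE.
Qed.

Let nsq_mulG {a} (V : 'M[C]_(a, p)) x : nsq (V *m ampG x) = ip (Gam x) (V ^t* *m V).
Proof. by rewrite -ipxx ip_mulr -mulmxA ipC ip_mull. Qed.

Let nsq_mulGam {a} (V : 'M[C]_(a, p)) x :
  nsq (V *m Gam x) = ip (Gam x *m Gam x) (V ^t* *m V).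
Proof. by rewrite -ipxx ip_mulr Gam_adj -mulmxA ipC ip_mull. Qed.

Lemma moment_nsq {a} (V : 'M[C]_(a, p)) :
  (\int[mu]_x (nsq (V *m ampG x))%:E <= (nsq V)%:E)%E.
Proof.
have := mean1 (V ^t* *m V); rewrite ipC ip_mull mulmx1 trmxCK ipxx.
apply: le_has_mean => x; first exact: nsq_ge0.
by rewrite nsq_mulG.
Qed.

(** The exact mean is kept, next to its bound, because [moment_variance] adds this function to terms
    of either sign. *)
Lemma moment_nsq2 {a} (V : 'M[C]_(a, p)) :
  exists2 v, has_mean mu (fun x => nsq (V *m Gam x)) v & v <= c2 * nsq V.
Proof.
have [_ _ [i2 e2] _] := momG.
have [ia ea] := amp_integrable i2.
exists (ip (amp (mx_expectation mu (fun A : cmx R n =>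
    ((A : 'M[C]_n) *m (A : 'M[C]_n) ^t*) ^+ 2))) (V ^t* *m V)).
  have := has_mean_ip (V ^t* *m V) ia; rewrite ea.
  apply: has_mean_ext => x; rewrite nsq_mulGam GamE expr2 -mulmxE.
  by rewrite [in RHS]ampM.
by apply: ip_amp_opnorm => //; exact: le_trans c2_ge1.
Qed.

(** The origin of the constant [3 c2]; the integrand is what [haar_nsq_conj] produces for [V G] and
    [G^*]. With [Gam = G G^*], Cauchy-Schwarz gives [|V G|^4 <= |V Gam|^2 |V|^2] and
    [(|G|^2 / p)^2 <= |Gam|^2 / p], so by the inequality of means the second summand is at most
    [|V Gam|^2 + |V|^2 |Gam|^2 / p]. Each of the three terms then has mean at most [c2 |V|^2]. *)
Lemma moment_nsq3 {a} (V : 'M[C]_(a, p)) :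
  (\int[mu]_x (nsq (V *m ampG x *m (ampG x) ^t*) +
     2 * nsq (V *m ampG x) * nsq ((ampG x) ^t*) / p%:R)%:E <= (3 * c2 * nsq V)%:E)%E.
Proof.
have [v hv vle] := moment_nsq2 V.
have [u hu ule] := moment_nsq2 (1%:M : 'M[C]_p).
have p0 : (0 : R) <= p%:R^-1 by rewrite invr_ge0.
apply: (@le_trans _ _ (2 * v + nsq V / p%:R * u)%:E); last first.
  rewrite lee_fin; have V0 := nsq_ge0 V.
  (* If [p = 0], its inverse is 0 and the term with [u] vanishes. *)
  have [k0|k0] := eqVneq (p%:R : R) 0; last first.
    rewrite nsq1 in ule.
    have : nsq V / p%:R * u <= nsq V / p%:R * (c2 * p%:R).
      by rewrite ler_wpM2l// mulr_ge0.
    have -> : nsq V / p%:R * (c2 * p%:R) = c2 * nsq V by rewrite mulrCA divfK.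
    lra.
  rewrite k0 invr0 mulr0 mul0r addr0.
  have : 0 <= c2 * nsq V by rewrite mulr_ge0// (le_trans ler01).
  by lra.
apply: (le_has_mean (g := fun x => 2 * nsq (V *m Gam x) +
    nsq V / p%:R * nsq (1%:M *m Gam x))).
- by move=> x; rewrite addr_ge0 ?divr_ge0 ?mulr_ge0 ?nsq_ge0.
- move=> x; rewrite -mulmxA -/(Gam x) nsq_adj mul1mx.
  have GE : nsq (ampG x) = ip (Gam x) 1%:M.
    by have := nsq_mulG 1%:M x; rewrite mul1mx adj1 mul1mx.
  have GV : nsq (V *m ampG x) = ip (V *m Gam x) V.
    by rewrite nsq_mulG ip_mull.
  have GV2 : nsq (V *m ampG x) ^+ 2 <= nsq (V *m Gam x) * nsq V.
    by rewrite GV ip_CS.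
  have G2 : (nsq (ampG x) / p%:R) ^+ 2 <= nsq (Gam x) / p%:R.
    have [k0|k0] := eqVneq (p%:R : R) 0; first by rewrite k0 invr0 !mulr0 expr0n.
    rewrite exprMn [X in _ * X]expr2 mulrA ler_wpM2r//.
    have := ip_CS (Gam x) 1%:M; rewrite -GE nsq1 -ler_pdivrMr// lt_def k0/=.
    exact: ler0n.
  have s0 := nsq_ge0 (V *m ampG x); have a0 := nsq_ge0 (V *m Gam x).
  have v0 := nsq_ge0 V.
  have g0 : 0 <= nsq (ampG x) / p%:R by rewrite divr_ge0 ?nsq_ge0.
  have b0 : 0 <= nsq (Gam x) / p%:R by rewrite divr_ge0 ?nsq_ge0.
  have -> : 2 * nsq (V *m ampG x) * nsq (ampG x) / p%:R =
    2 * (nsq (V *m ampG x) * (nsq (ampG x) / p%:R)) by ring.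
  have -> : nsq V / p%:R * nsq (Gam x) = nsq V * (nsq (Gam x) / p%:R) by ring.
  move: (nsq (V *m ampG x)) (nsq (V *m Gam x)) (nsq V) (nsq (ampG x) / p%:R)
    (nsq (Gam x) / p%:R) GV2 G2 s0 a0 v0 g0 b0 => s A v' g b GV2 G2 s0 a0 v0 g0 b0.
  suff : 2 * (s * g) <= A + v' * b by lra.
  rewrite -(ler_pXn2r (n := 2)) ?nnegrE ?addr_ge0 ?mulr_ge0//.
  have h1 : (s * g) ^+ 2 <= (A * v') * b.
    by rewrite exprMn; apply: ler_pM => //; exact: sqr_ge0.
  have h2 := sqr_ge0 (A - v' * b).
  have -> : (2 * (s * g)) ^+ 2 = 4 * (s * g) ^+ 2 by ring.
  have -> : (A + v' * b) ^+ 2 = (A - v' * b) ^+ 2 + 4 * (A * v' * b) by ring.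
  lra.
by apply: has_meanD; apply: has_meanZ.
Qed.

(** The perturbation has mean 0, hence is orthogonal to [A], and centring [L Gam] can only lower its
    second moment. The weights [al] of the Cauchy-Schwarz inequality stay free until
    [E_diag_step]. *)
Lemma moment_variance (I : finType) (Q : pred I) (al kap : I -> R)
    (a : I -> 'M[C]_p) (A : 'M[C]_p) :
  (forall i, 0 <= al i) -> (forall i, al i = 0 -> (kap i)%:C *: a i = 0) ->
  (\int[mu]_x (nsq (A + \sum_(i | Q i)
      (kap i)%:C *: (a i *m (Gam x - 1%:M) *m (a i) ^t*)))%:E <=
   (nsq A + (\sum_(i | Q i) al i) *
      \sum_(i | Q i) (al i)^-1 * (kap i ^+ 2 * (c2 * nsq (a i) ^+ 2)))%:E)%E.
Proof.
move=> al0 ala.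
pose L (X : 'M[C]_p) := \sum_(i | Q i) (kap i)%:C *: (a i *m X *m (a i) ^t*).
pose D := A - L 1%:M.
have LE x : A + \sum_(i | Q i) (kap i)%:C *: (a i *m (Gam x - 1%:M) *m (a i) ^t*) =
    D + L (Gam x).
  rewrite /D addrAC -addrA /L -sumrB; congr (_ + _); apply: eq_bigr => i _.
  by rewrite mulmxBr mulmxBl scalerBr.
have ipL (X : 'M[C]_p) : ip (L X) D = ip X (\sum_(i | Q i)
    (kap i)%:C *: ((a i) ^t* *m D *m a i)).
  rewrite ip_suml ip_sumr; apply: eq_bigr => i _.
  by rewrite ipZl ipZr ip_mulr trmxCK ip_mull mulmxA.
have hL : has_mean mu (fun x => ip (L (Gam x)) D) (ip (L 1%:M) D).
  by rewrite ipL; apply: has_mean_ext (mean1 _) => x; rewrite ipL.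
pose v i := cid2 (moment_nsq2 (a i)).
set s := \sum_(i | Q i) al i.
have s0 : 0 <= s by apply: sumr_ge0.
have F0 x i : al i = 0 -> (kap i)%:C *: (a i *m Gam x *m (a i) ^t*) = 0.
  by move=> /ala ai0; rewrite !scalemxAl ai0 !mul0mx.
apply: (@le_trans _ _ (nsq D + 2 * ip (L 1%:M) D +
    s * \sum_(i | Q i) (al i)^-1 * (kap i ^+ 2 * (nsq (a i) * s2val (v i))))%:E).
  apply: (le_has_mean (g := fun x => nsq D + 2 * ip (L (Gam x)) D +
      s * \sum_(i | Q i) (al i)^-1 * (kap i ^+ 2 * (nsq (a i) * nsq (a i *m Gam x))))).
  - by move=> x; exact: nsq_ge0.
  - move=> x; rewrite LE nsqD ipC lerD2l.
    apply: le_trans (nsq_sum_CS _ al0 (F0 x)) _; rewrite ler_wpM2l//.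
    apply: ler_sum => i _; rewrite ler_wpM2l ?invr_ge0//.
    rewrite nsqZr ler_wpM2l ?sqr_ge0//; apply: le_trans (nsqM _ _) _.
    by rewrite nsq_adj mulrC.
  - apply: has_meanD.
      by apply: has_meanD; [exact: has_mean_cst|exact: has_meanZ].
    apply: has_meanZ; apply: has_mean_sum => i _; do 3 apply: has_meanZ.
    exact: (s2valP (v i)).
rewrite lee_fin; apply: lerD.
  (* Expanding this square leaves [nsq (L 1)] to spare. *)
  have -> : nsq A = nsq (D + L 1%:M) by rewrite /D subrK.
  by rewrite [leRHS]nsqD (ipC D) lerDl nsq_ge0.
rewrite ler_wpM2l//; apply: ler_sum => i _; rewrite ler_wpM2l ?invr_ge0//.
rewrite ler_wpM2l ?sqr_ge0//.
apply: (@le_trans _ _ (nsq (a i) * (c2 * nsq (a i)))).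
  by rewrite ler_wpM2l ?nsq_ge0//; exact: (s2valP' (v i)).
by rewrite mulrCA expr2.
Qed.

End Moments.

Section SigmaOf.
Context d (T : measurableType d) d' (T' : measurableType d') (X : {mfun T >-> T'}).

Lemma sigma_ofT : sigma_of X setT.
Proof. by exists setT => //; rewrite preimage_setT. Qed.

Lemma sigma_ofI A B : sigma_of X A -> sigma_of X B -> sigma_of X (A `&` B).
Proof.
by move=> [A' mA <-] [B' mB <-]; exists (A' `&` B'); [exact: measurableI|].
Qed.

Lemma sigma_of_measurable : sigma_of X `<=` measurable.
Proof. by move=> _ [A mA <-]; exact: measurable_funPTI. Qed.

End SigmaOf.

(** * The random model: moments of the products of the [G_i H_i] *)

Section Model.
Context {R : realType} {m n k : nat} (c2 c3 : R) (calG : probability (cmx R n) R).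
Context d (Omega : measurableType d) (P : probability Omega R).
Variables (G : 'I_m -> {RV P >-> cmx R n}) (H : 'I_m -> {RV P >-> cmx R (n * k)%N}).
Hypothesis c2_ge1 : 1 <= c2.
Hypothesis momG : moment_conditions c2 c3 calG.
Hypothesis modelGH : GH_model calG G H.
Hypothesis p_gt0 : (0 < n * k)%N.
Notation C := R[i].
Notation p := (n * k)%N.
Notation M := 'M[C]_p.
Notation I := ('I_m + 'I_m)%type.

Definition GHsigma (i : I) : set (set Omega) :=
  match i with inl a => sigma_of (G a) | inr b => sigma_of (H b) end.

Let FT i : GHsigma i setT.
Proof. by case: i => j; exact: sigma_ofT. Qed.

Let FI i A B : GHsigma i A -> GHsigma i B -> GHsigma i (A `&` B).
Proof. by case: i => j; exact: sigma_ofI. Qed.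

Let Fm i : GHsigma i `<=` measurable.
Proof. by case: i => j; exact: sigma_of_measurable. Qed.

Let indepF : mutually_independent P GHsigma.
Proof. by have [_ _ h] := modelGH. Qed.

Let Tdep (D : pred I) : measurableType _ := g_sigma_algebraType (gen GHsigma D).

(** [mxdep] and [rdep] are [depon] for matrices and for reals; [inl i] is the index of [G i] and
    [inr i] that of [H i]. *)
Definition mxdep (D : pred I) {a b} (F : Omega -> 'M[C]_(a, b)) : Prop :=
  @mxmeas R _ (g_sigma_algebraType (gen GHsigma D)) a b F.

Definition rdep (D : pred I) (f : Omega -> R) : Prop :=
  @measurable_fun _ _ (g_sigma_algebraType (gen GHsigma D)) R setT f.

Lemma mxdep_sub (D D' : pred I) {a b} (F : Omega -> 'M[C]_(a, b)) :
  (forall i, D i -> D' i) -> mxdep D F -> mxdep D' F.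
Proof.
move=> DD' mF i j; have [m1 m2] := mF i j.
by split; [exact: depon_sub m1|exact: depon_sub m2].
Qed.

Lemma rdep_sub (D D' : pred I) (f : Omega -> R) :
  (forall i, D i -> D' i) -> rdep D f -> rdep D' f.
Proof. exact: depon_sub. Qed.

Lemma rdep_measurable D (f : Omega -> R) : rdep D f -> measurable_fun setT f.
Proof.
move=> mf _ B mB; have := mf measurableT B mB.
suff : <<s gen GHsigma D >> `<=` @measurable d Omega by exact.
apply: smallest_sub; first exact: sigma_algebra_measurable.
by move=> A [i _]; exact: Fm.
Qed.

Lemma mxdepG (D : pred I) i : D (inl i) -> mxdep D (fun w => G i w : 'M[C]_n).
Proof.
move=> Di; apply/mxmeasP => _ B mB; rewrite setTI.
by apply: sub_sigma_algebra; exists (inl i) => //; exists B.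
Qed.

Lemma mxdepH (D : pred I) i : D (inr i) -> mxdep D (fun w => H i w : M).
Proof.
move=> Di; apply/mxmeasP => _ B mB; rewrite setTI.
by apply: sub_sigma_algebra; exists (inr i) => //; exists B.
Qed.

Lemma mxdep_amp (D : pred I) i : D (inl i) -> mxdep D (fun w => amp (G i w) : M).
Proof. by move=> Di; apply: mxmeas_tens; exact: mxdepG. Qed.

Let jointT d1 (T1 : measurableType d1) (i : I) : measurableType _ :=
  (T1 * Tdep [pred j | j != i])%type.

(** Joint measurability in a free value for variable [i] and in the outcome as seen through the
    other variables: the form in which [decouple_le] takes its integrand. *)
Definition jdep d1 (T1 : measurableType d1) (i : I) (f : T1 -> Omega -> R) : Prop :=
  @measurable_fun _ _ (jointT T1 i) R setT (fun z => f z.1 z.2).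

Definition mxjdep d1 (T1 : measurableType d1) (i : I) {a b}
    (F : T1 -> Omega -> 'M[C]_(a, b)) : Prop :=
  @mxmeas R _ (jointT T1 i) a b (fun z => F z.1 z.2).

Lemma decouple_G i (f : cmx R n -> Omega -> R) (g : Omega -> R) :
  jdep (inl i) f -> (forall x w, 0 <= f x w) ->
  (forall w, \int[calG]_x (f x w)%:E <= (g w)%:E)%E ->
  (\int[P]_w (f (G i w) w)%:E <= \int[P]_w (g w)%:E)%E.
Proof.
move=> mf f0 fg.
apply: (@decouple_le _ _ _ P I GHsigma FT FI Fm indepF _ _ (G i) (inl i)) => // w.
have [lawG _ _] := modelGH.
rewrite (eq_measure_integral calG); first exact: fg.
by move=> A mA _; exact: lawG.
Qed.

Lemma decouple_H i (f : cmx R p -> Omega -> R) (g : Omega -> R) :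
  jdep (inr i) f -> (forall x w, 0 <= f x w) ->
  (forall w, \int[distribution P (H i)]_x (f x w)%:E <= (g w)%:E)%E ->
  (\int[P]_w (f (H i w) w)%:E <= \int[P]_w (g w)%:E)%E.
Proof.
move=> mf f0 fg.
exact: (@decouple_le _ _ _ P I GHsigma FT FI Fm indepF _ _ (H i) (inr i)).
Qed.

Lemma haarH i : is_haar (distribution P (H i)).
Proof. by have [_ h _] := modelGH; exact: h. Qed.

Lemma mxjdep_snd d1 (T1 : measurableType d1) (i : I) (D : pred I) {a b}
    (F : Omega -> 'M[C]_(a, b)) : ~~ D i -> mxdep D F ->
  mxjdep i (fun (_ : T1) w => F w).
Proof.
move=> Di mF.
have mF' : mxdep [pred j | j != i] F.
  apply: mxdep_sub mF => j Dj /=; apply/eqP => ji.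
  by move: Di; rewrite -ji Dj.
exact: (mxmeas_comp mF' measurable_snd).
Qed.

Lemma jdep_snd d1 (T1 : measurableType d1) (i : I) (D : pred I)
    (f : Omega -> R) : ~~ D i -> rdep D f -> jdep i (fun (_ : T1) w => f w).
Proof.
move=> Di mf.
have mf' : rdep [pred j | j != i] f.
  apply: rdep_sub mf => j Dj /=; apply/eqP => ji.
  by move: Di; rewrite -ji Dj.
exact: (measurableT_comp mf' measurable_snd).
Qed.

Lemma mxjdep_fst q (i : I) : mxjdep i (fun (x : cmx R q) (_ : Omega) => (x : 'M[C]_q)).
Proof. exact: (mxmeas_comp (@mxmeas_cmx R q) measurable_fst). Qed.

Let X i w : M := amp (G i w) *m (H i w : M).

(** The factor at place [r], equal to 1 off [S] and beyond [m]. Natural numbers as places allow the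
    product [Wf] to be cut anywhere. *)
Definition Yf (S : {set 'I_m}) (r : nat) (w : Omega) : M :=
  if insub r is Some i then (if i \in S then X i w else 1%:M) else 1%:M.

Definition Wf (S : {set 'I_m}) (l u : nat) (w : Omega) : M :=
  \prod_(l <= r < u) Yf S r w.

Lemma Wf_geq S l u w : (u <= l)%N -> Wf S l u w = 1%:M.
Proof. by move=> ul; rewrite /Wf big_geq. Qed.

Lemma Wf_recr S l u w : (l <= u)%N -> Wf S l u.+1 w = Wf S l u w *m Yf S u w.
Proof. by move=> lu; rewrite /Wf big_nat_recr. Qed.

Lemma Wf_recl S l u w : (l < u)%N -> Wf S l u w = Yf S l w *m Wf S l.+1 u w.
Proof. by move=> lu; rewrite /Wf big_ltn. Qed.

Lemma Wf_cat S l v u w : (l <= v)%N -> (v <= u)%N ->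
  Wf S l u w = Wf S l v w *m Wf S v u w.
Proof. by move=> lv vu; rewrite /Wf (big_cat_nat lv vu). Qed.

Lemma Yf_ord (S : {set 'I_m}) (i : 'I_m) w : Yf S i w = if i \in S then X i w else 1%:M.
Proof. by rewrite /Yf valK. Qed.

Lemma prod_GH (S : {set 'I_m}) w : \prod_(i < m | i \in S) GH G H i w = Wf S 0 m w.
Proof.
rewrite /Wf big_mkord big_mkcond; apply: eq_bigr => i _.
by rewrite Yf_ord.
Qed.

Lemma mxdep_Yf (D : pred I) (S : {set 'I_m}) r :
  (forall i : 'I_m, i = r :> nat -> i \in S -> D (inl i) && D (inr i)) ->
  mxdep D (Yf S r).
Proof.
rewrite /Yf; case: insubP => [i _ ir|_] h; last exact: mxmeas_cst.
have := h i ir; case: (i \in S) => [/(_ isT)/andP[D1 D2]|_]; last exact: mxmeas_cst.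
by apply: mxmeas_mul; [exact: mxdep_amp|exact: mxdepH].
Qed.

Lemma mxdep_Wf (D : pred I) (S : {set 'I_m}) l u :
  (forall i : 'I_m, (l <= i < u)%N -> i \in S -> D (inl i) && D (inr i)) ->
  mxdep D (Wf S l u).
Proof.
elim: u => [|u IH] h.
  by apply: mxmeas_ext (mxmeas_cst _ 1%:M) => w; rewrite Wf_geq.
have [lu|ul] := leqP l u; last first.
  by apply: mxmeas_ext (mxmeas_cst _ 1%:M) => w; rewrite Wf_geq.
apply: (@mxmeas_ext R _ (Tdep D) _ _ (fun w => Wf S l u w *m Yf S u w)).
  by move=> w; rewrite Wf_recr.
apply: mxmeas_mul; first by apply: IH => i /andP[li iu]; apply: h; rewrite li ltnW.
by apply: mxdep_Yf => i iu; apply: h; rewrite iu lu leqnn.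
Qed.

Definition below (u : nat) (S : {set 'I_m}) : bool := [forall i in S, (i < u)%N].

Lemma belowP u (S : {set 'I_m}) : reflect (forall i, i \in S -> (i < u)%N) (below u S).
Proof. exact: 'forall_implyP. Qed.

Lemma sum_belowS (V : nmodType) (F : {set 'I_m} -> V) (i : 'I_m) :
  \sum_(S | below i.+1 S) F S =
  \sum_(S | below i S) F S + \sum_(S | below i S) F (i |: S)%SET.
Proof.
rewrite (bigID [pred S : {set 'I_m} | i \notin S]) /=; congr (_ + _).
  apply: eq_bigl => S; apply/andP/belowP => [[/belowP b iS] j jS|b].
    rewrite ltn_neqAle -ltnS b// andbT; apply: contra iS => /eqP ji.
    by rewrite -(val_inj ji).
  split; first by apply/belowP => j /b /ltnW.
  by apply/negP => /b; rewrite ltnn.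
rewrite (reindex_onto (fun S => i |: S)%SET (fun S => S :\ i)%SET) /=; last first.
  by move=> S /andP[_ /negPn iS]; rewrite finset.setD1K.
apply: eq_bigl => S; rewrite setU11 andbT; apply/andP/belowP => [[/belowP b /eqP iS] j jS|b].
  have jS' : j \in (i |: S)%SET by rewrite !inE jS orbT.
  rewrite ltn_neqAle -ltnS b// andbT; apply/eqP => /val_inj ji.
  by move: jS; rewrite -iS ji !inE eqxx.
split; first by apply/belowP => j; rewrite !inE => /orP[/eqP->//|/b /ltnW].
apply/eqP/finset.setP => j; rewrite !inE; case: eqP => //= ->.
by apply/esym/negP => /b; rewrite ltnn.
Qed.

Let dep_ltn u : pred I := fun i => match i with inl a => (a < u)%N | inr a => (a < u)%N end.

Let mxdep_W0 (S : {set 'I_m}) u : mxdep (dep_ltn u) (Wf S 0 u).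
Proof. by apply: mxdep_Wf => i /andP[_ iu] _; rewrite /= iu. Qed.

(** Induction on the number of variables: the Haar factor of the last one separates the sets that
    contain it from the others, and [E G G^* = I] then removes its [G]. *)
Lemma E_nsq_sum (c : {set 'I_m} -> M) u : (u <= m)%N ->
  (\int[P]_w (nsq (\sum_(S | below u S) c S *m Wf S 0 u w))%:E <=
   (\sum_(S | below u S) nsq (c S))%:E)%E.
Proof.
elim: u c => [|u IH] c um.
  have b0 (S : {set 'I_m}) : below 0 S = (S == finset.set0).
    apply/belowP/eqP => [b|-> i]; last by rewrite inE.
    by apply/finset.setP => i; rewrite inE; apply/negP => /b.
  rewrite (eq_bigl _ _ b0) big_pred1_eq.
  under eq_integral => w _.
    rewrite (eq_bigl _ _ b0) big_pred1_eq Wf_geq// mulmx1; over.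
  by rewrite integral_cst_prob.
pose i := Ordinal um.
pose A w := \sum_(S | below u S) c S *m Wf S 0 u w.
pose B w := \sum_(S | below u S) c (i |: S)%SET *m Wf S 0 u w.
have mA : mxdep (dep_ltn u) A.
  by apply: mxmeas_sum => S _; apply: mxmeas_mul; [exact: mxmeas_cst|exact: mxdep_W0].
have mB : mxdep (dep_ltn u) B.
  by apply: mxmeas_sum => S _; apply: mxmeas_mul; [exact: mxmeas_cst|exact: mxdep_W0].
have sumE w : \sum_(S | below u.+1 S) c S *m Wf S 0 u.+1 w =
    A w + (B w *m amp (G i w)) *m (H i w : M).
  rewrite (sum_belowS _ i); congr (_ + _).
    apply: eq_bigr => S /belowP b; rewrite Wf_recr//.
    rewrite (_ : Yf S u w = 1%:M) ?mulmx1// -[u]/(i : nat) Yf_ord ifN//.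
    by apply/negP => /b; rewrite ltnn.
  rewrite -mulmxA mulmx_suml; apply: eq_bigr => S /belowP b.
  rewrite Wf_recr// -[X in Yf _ X]/(i : nat) Yf_ord setU11 !mulmxA.
  have -> : Wf (i |: S)%SET 0 u w = Wf S 0 u w; last by [].
  rewrite /Wf; apply: eq_big_nat => r /andP[_ ru].
  have rm : (r < m)%N by exact: ltn_trans ru um.
  have rNi : Ordinal rm != i by rewrite -val_eqE /= ltn_eqF.
  by rewrite -[r]/(Ordinal rm : nat) !Yf_ord !inE (negbTE rNi).
rewrite (eq_integral (fun w => (nsq (A w + (B w *m amp (G i w)) *m (H i w : M)))%:E)); last first.
  by move=> w _; rewrite sumE.
pose D2 : pred I := [pred j | dep_ltn u j || (j == inl i)].
have D2i : ~~ D2 (inr i) by rewrite /D2 /= ltnn.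
have mA2 : mxdep D2 A by apply: mxdep_sub mA => j h; apply/orP; left.
have mB2 : mxdep D2 (fun w => B w *m amp (G i w)).
  apply: mxmeas_mul; first by apply: mxdep_sub mB => j h; apply/orP; left.
  by apply: mxdep_amp; apply/orP; right.
apply: (@le_trans _ _ (\int[P]_w (nsq (A w) + nsq (B w *m amp (G i w)))%:E)%E).
  apply: (@decouple_H i (fun x w => nsq (A w + (B w *m amp (G i w)) *m (x : M)))).
  - apply: measurable_nsq; apply: mxmeas_add; first exact: mxjdep_snd D2i mA2.
    by apply: mxmeas_mul; [exact: mxjdep_snd D2i mB2|exact: mxjdep_fst].
  - by move=> x w; exact: nsq_ge0.
  - by move=> w; apply: haar_nsqDM; exact: haarH.
have Di : ~~ dep_ltn u (inl i) by rewrite /= ltnn.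
apply: (@le_trans _ _ (\int[P]_w (nsq (A w) + nsq (B w))%:E)%E).
  apply: (@decouple_G i (fun x w => nsq (A w) + nsq (B w *m amp (x : 'M[C]_n)))).
  - apply: measurable_funD; apply: measurable_nsq; first exact: mxjdep_snd Di mA.
    apply: mxmeas_mul; first exact: mxjdep_snd Di mB.
    by apply: mxmeas_tens; exact: mxjdep_fst.
  - by move=> x w; rewrite addr_ge0 ?nsq_ge0.
  - move=> w; under eq_integral do rewrite EFinD.
    rewrite ge0_integralD//; last 3 first.
    + by move=> x _; rewrite lee_fin nsq_ge0.
    + by move=> x _; rewrite lee_fin nsq_ge0.
    + apply/measurable_EFinP; apply: measurable_nsq.
      apply: mxmeas_mul; first exact: mxmeas_cst.
      by apply: mxmeas_tens; exact: mxmeas_cmx.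
    rewrite integral_cst_prob EFinD leeD2l//.
    exact: (moment_nsq momG).
under eq_integral do rewrite EFinD.
have mnsq F : mxdep (dep_ltn u) F -> measurable_fun setT (fun w => nsq (F w : M)).
  by move=> mF; apply: (@rdep_measurable (dep_ltn u)); exact: measurable_nsq.
rewrite ge0_integralD//; last 4 first.
- by move=> w _; rewrite lee_fin nsq_ge0.
- by apply/measurable_EFinP; exact: mnsq.
- by move=> w _; rewrite lee_fin nsq_ge0.
- by apply/measurable_EFinP; exact: mnsq.
rewrite (sum_belowS _ i) EFinD; apply: leeD; first exact: IH (ltnW um).
by apply: (IH (fun S => c (i |: S)%SET)); exact: ltnW.
Qed.

(** Counts the elements of [S] from [l] to [u - 1], as a sum that splits in the same way as [Wf]. *)
Definition cnt (S : {set 'I_m}) (l u : nat) : nat :=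
  \sum_(l <= r < u) (if insub r is Some i then (i \in S : nat) else 0%N).

Lemma cnt_recl (S : {set 'I_m}) (i : 'I_m) u : (i < u)%N ->
  cnt S i u = ((i \in S) + cnt S i.+1 u)%N.
Proof. by move=> iu; rewrite /cnt big_ltn// valK. Qed.

Lemma cnt_card (S : {set 'I_m}) : cnt S 0 m = #|S|.
Proof.
rewrite /cnt big_mkord -sum1_card [RHS]big_mkcond; apply: eq_bigr => i _.
by rewrite valK; case: (i \in S).
Qed.

Lemma cnt_cat (S : {set 'I_m}) l v u : (l <= v)%N -> (v <= u)%N ->
  cnt S l u = (cnt S l v + cnt S v u)%N.
Proof. by move=> lv vu; rewrite /cnt (big_cat_nat lv vu). Qed.

Let K : R := 3 * c2.

Let K_ge1 : 1 <= K.
Proof. by rewrite /K; have := c2_ge1; lra. Qed.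

Let K_ge0 : 0 <= K.
Proof. exact: le_trans K_ge1. Qed.

Let integralZ (c : R) (f : Omega -> R) : 0 <= c -> (forall w, 0 <= f w) ->
  measurable_fun setT f ->
  (\int[P]_w (c * f w)%:E = c%:E * \int[P]_w (f w)%:E)%E.
Proof.
move=> c0 f0 mf; under eq_integral do rewrite EFinM.
rewrite ge0_integralZl//; first exact/measurable_EFinP.
by move=> w _; rewrite lee_fin.
Qed.

(** Peel off the leftmost factor [G_l H_l] and let [W'] be the remaining product. Averaging over
    [H_l] bounds the norm by [q / p] times [nsq (W' W'^* )], where [q] involves only [V] and [G_l].
    The induction hypothesis with [V = 1], for which [nsq 1 = p] cancels the [1/p], removes [W'],
    and [moment_nsq3] then removes [G_l] at the price [K]. The weight [h] is there to carry [q]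
    through the induction. *)
Lemma E_key (S : {set 'I_m}) u l (D : pred I) a (h : Omega -> R)
    (V : Omega -> 'M[C]_(a, p)) : (l <= u)%N -> (u <= m)%N ->
  (forall j : 'I_m, (l <= j < u)%N -> ~~ D (inl j) && ~~ D (inr j)) ->
  rdep D h -> (forall w, 0 <= h w) -> mxdep D V ->
  (\int[P]_w (h w * nsq (V w *m (Wf S l u w *m (Wf S l u w) ^t*)))%:E <=
   (K ^+ cnt S l u)%:E * \int[P]_w (h w * nsq (V w))%:E)%E.
Proof.
move=> lu um; have [len lenE] : exists len, len = (u - l)%N by exists (u - l)%N.
elim: len l D a h V lu lenE => [|len IH] l D a h V lu lenE disj mh h0 mV.
  have ul : (u <= l)%N by rewrite -subn_eq0 -lenE.
  rewrite /cnt big_geq// expr0 mul1e; apply: le_integral_ge0 => w.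
    by rewrite lee_fin mulr_ge0 ?nsq_ge0.
  by rewrite Wf_geq// adj1 !mulmx1.
have lltu : (l < u)%N by rewrite -subn_gt0 -lenE.
have lm : (l < m)%N by exact: leq_trans um.
pose j := Ordinal lm.
have lenE' : len = (u - l.+1)%N by rewrite subnS -lenE.
have disj' (D' : pred I) : (forall i, D' i -> D i || (i == inl j)) ->
    forall i : 'I_m, (l.+1 <= i < u)%N -> ~~ D' (inl i) && ~~ D' (inr i).
  move=> DD' i /andP[li iu].
  have /andP[d1 d2] := disj i (introT andP (conj (ltnW li) iu)).
  apply/andP; split; apply/negP => /DD' /orP[Di|].
  - by rewrite Di in d1.
  - by move=> /eqP[] ij; move: li; rewrite ij /= ltnn.
  - by rewrite Di in d2.
  - by [].
have cntE : cnt S l u = ((j \in S) + cnt S l.+1 u)%N by exact: (@cnt_recl S j).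
have WE w : Wf S l u w = (if j \in S then X j w else 1%:M) *m Wf S l.+1 u w.
  by rewrite Wf_recl// -(Yf_ord S j).
rewrite cntE.
have [jS|jS] := boolP (j \in S); last first.
  rewrite add0n.
  have DD i : D i -> D i || (i == inl j) by move=> ->.
  have h1 := IH l.+1 D a h V lltu lenE' (disj' D DD) mh h0 mV.
  apply: (le_trans _ h1); apply: le_integral_ge0 => w; first by rewrite lee_fin mulr_ge0 ?nsq_ge0.
  by rewrite WE (negbTE jS) mul1mx.
pose M' w : M := Wf S l.+1 u w *m (Wf S l.+1 u w) ^t*.
pose q w : R := nsq (V w *m amp (G j w) *m (amp (G j w)) ^t*) +
  2 * nsq (V w *m amp (G j w)) * nsq ((amp (G j w) : M) ^t*) / p%:R.
pose D2 : pred I := [pred i | D i || (i == inl j)].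
pose D3 : pred I := [pred i | (i != inr j)].
have /andP[Dl Dr] : ~~ D (inl j) && ~~ D (inr j) by apply: disj; rewrite /= leqnn.
have D23 i : D2 i -> D3 i.
  by move=> /orP[Di|/eqP->//]; apply/eqP => ij; rewrite ij (negbTE Dr) in Di.
have mh2 : rdep D2 h by apply: rdep_sub mh => i Di; apply/orP; left.
have mV2 : mxdep D2 V by apply: mxdep_sub mV => i Di; apply/orP; left.
have mG2 : mxdep D2 (fun w => amp (G j w) : M) by apply: mxdep_amp; apply/orP; right.
have mq : rdep D2 q.
  apply: measurable_funD.
    apply: measurable_nsq; apply: mxmeas_mul; first exact: mxmeas_mul.
    exact: mxmeas_adj.
  apply: measurable_funM => //; apply: measurable_funM.
    apply: measurable_funM => //.
    by apply: measurable_nsq; exact: mxmeas_mul.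
  by apply: measurable_nsq; exact: mxmeas_adj.
have q0 w : 0 <= q w by rewrite addr_ge0 ?divr_ge0 ?mulr_ge0 ?nsq_ge0.
have mM' : mxdep D3 M'.
  have mW : mxdep D3 (Wf S l.+1 u).
    apply: mxdep_Wf => i /andP[li iu] _; rewrite /D3 /=; apply/eqP => -[] ij.
    by move: li; rewrite ij /= ltnn.
  by apply: mxmeas_mul => //; exact: mxmeas_adj.
have D3j : ~~ D3 (inr j) by rewrite /D3 /= eqxx.
have p0 : (0 : R) < p%:R by rewrite ltr0n.
apply: (@le_trans _ _ (\int[P]_w ((h w * q w / p%:R) * nsq (1%:M *m M' w))%:E)%E).
  apply: (@le_trans _ _ (\int[P]_w (h w * nsq (V w *m amp (G j w) *m (H j w : M) *m
      M' w *m (H j w : M) ^t* *m (amp (G j w)) ^t*))%:E)%E).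
    apply: le_integral_ge0 => w; first by rewrite lee_fin mulr_ge0 ?nsq_ge0.
    by rewrite WE jS !adjM /M' !mulmxA.
  apply: (@decouple_H j (fun x w => h w * nsq (V w *m amp (G j w) *m (x : M) *m
      M' w *m (x : M) ^t* *m (amp (G j w)) ^t*))).
  - have jh : jdep (inr j) (fun (_ : cmx R p) w => h w).
      exact: jdep_snd D3j (rdep_sub D23 mh2).
    have jV : mxjdep (inr j) (fun (_ : cmx R p) w => V w).
      exact: mxjdep_snd D3j (mxdep_sub D23 mV2).
    have jG : mxjdep (inr j) (fun (_ : cmx R p) w => amp (G j w) : M).
      exact: mxjdep_snd D3j (mxdep_sub D23 mG2).
    have jM : mxjdep (inr j) (fun (_ : cmx R p) w => M' w).
      exact: mxjdep_snd D3j mM'.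
    have jx : mxjdep (inr j) (fun (x : cmx R p) (_ : Omega) => (x : M)).
      exact: mxjdep_fst.
    apply: measurable_funM; first exact: jh.
    apply: measurable_nsq; apply: mxmeas_mul; last exact: mxmeas_adj jG.
    apply: mxmeas_mul; last exact: mxmeas_adj jx.
    apply: mxmeas_mul; last exact: jM.
    apply: mxmeas_mul; last exact: jx.
    exact: mxmeas_mul jV jG.
  - by move=> x w; rewrite mulr_ge0 ?nsq_ge0.
  - move=> w; under eq_integral do rewrite EFinM.
    rewrite ge0_integralZl//; last 3 first.
    + apply/measurable_EFinP; apply: measurable_nsq.
      apply: mxmeas_mul; last exact: mxmeas_cst.
      apply: mxmeas_mul; last by apply: mxmeas_adj; exact: mxmeas_cmx.
      apply: mxmeas_mul; last exact: mxmeas_cst.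
      by apply: mxmeas_mul; [exact: mxmeas_cst|exact: mxmeas_cmx].
    + by move=> x _; rewrite lee_fin nsq_ge0.
    + by rewrite lee_fin.
    rewrite mul1mx -!mulrA [leRHS]EFinM lee_wpmul2l ?lee_fin//.
    apply: le_trans (haar_nsq_conj (haarH j) _ _ _) _.
    by rewrite lee_fin /q le_eqVlt; apply/orP; left; apply/eqP; ring.
have mh3 : rdep D2 (fun w => h w * q w / p%:R).
  by apply: measurable_funM => //; exact: measurable_funM.
have h30 w : 0 <= h w * q w / p%:R by rewrite divr_ge0 ?mulr_ge0.
have h1 := IH l.+1 D2 p _ (fun=> 1%:M) lltu lenE' (disj' D2 (fun i Di => Di))
  mh3 h30 (mxmeas_cst _ _).
apply: (le_trans h1) => {h1}.
rewrite exprS mulrC EFinM -muleA lee_wpmul2l ?lee_fin ?exprn_ge0//.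
have mhV : measurable_fun setT (fun w => h w * nsq (V w)).
  apply: (@rdep_measurable D); apply: measurable_funM => //.
  exact: measurable_nsq.
rewrite -integralZ//; last by move=> w; rewrite mulr_ge0 ?nsq_ge0.
apply: (@le_trans _ _ (\int[P]_w (h w * q w)%:E)%E).
  apply: le_integral_ge0 => w; first by rewrite lee_fin mulr_ge0 ?nsq_ge0.
  by rewrite nsq1 divfK// gt_eqF.
apply: (@decouple_G j (fun x w => h w * (nsq (V w *m amp (x : 'M[C]_n) *m (amp (x : 'M[C]_n)) ^t*) +
  2 * nsq (V w *m amp (x : 'M[C]_n)) * nsq ((amp (x : 'M[C]_n) : M) ^t*) / p%:R))).
- have jh : jdep (inl j) (fun (_ : cmx R n) w => h w) .
    exact: jdep_snd Dl mh.
  have jV : mxjdep (inl j) (fun (_ : cmx R n) w => V w) .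
    exact: mxjdep_snd Dl mV.
  have jG : mxjdep (inl j) (fun (x : cmx R n) (_ : Omega) => amp (x : 'M[C]_n) : M).
    by apply: mxmeas_tens; exact: mxjdep_fst.
  apply: measurable_funM; first exact: jh.
  apply: measurable_funD.
    apply: measurable_nsq; apply: mxmeas_mul; last exact: mxmeas_adj jG.
    exact: mxmeas_mul jV jG.
  apply: measurable_funM => //; apply: measurable_funM.
    apply: measurable_funM => //.
    by apply: measurable_nsq; exact: mxmeas_mul jV jG.
  by apply: measurable_nsq; exact: mxmeas_adj jG.
- by move=> x w; rewrite mulr_ge0// addr_ge0 ?divr_ge0 ?mulr_ge0 ?nsq_ge0.
- move=> w; under eq_integral do rewrite EFinM.
  have mG : mxmeas (fun x : cmx R n => amp (x : 'M[C]_n) : M).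
    by apply: mxmeas_tens; exact: mxmeas_cmx.
  rewrite ge0_integralZl//; last 3 first.
  + apply/measurable_EFinP; apply: measurable_funD.
      apply: measurable_nsq; apply: mxmeas_mul; last exact: mxmeas_adj.
      by apply: mxmeas_mul => //; exact: mxmeas_cst.
    apply: measurable_funM => //; apply: measurable_funM.
      apply: measurable_funM => //; apply: measurable_nsq.
      by apply: mxmeas_mul => //; exact: mxmeas_cst.
    by apply: measurable_nsq; exact: mxmeas_adj.
  + by move=> x _; rewrite lee_fin addr_ge0 ?divr_ge0 ?mulr_ge0 ?nsq_ge0.
  + by rewrite lee_fin.
  rewrite mulrCA EFinM lee_wpmul2l ?lee_fin//.
  exact: (moment_nsq3 c2_ge1 momG).
Qed.

Lemma cnt_le (S : {set 'I_m}) l u : (l <= u)%N -> (u <= m)%N -> (cnt S l u <= #|S|)%N.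
Proof.
move=> lu um; rewrite -cnt_card (cnt_cat S (leq0n l) (leq_trans lu um)).
by rewrite (cnt_cat S lu um) addnCA leq_addr.
Qed.

(** Writing [|c W|^2] as the inner product of [c W W^*] with [c] gives
    [|c W|^4 <= |c W W^*|^2 |c|^2], which [E_key] integrates. *)
Lemma E_nsq4 (S : {set 'I_m}) (c : M) u : (u <= m)%N ->
  (\int[P]_w (nsq (c *m Wf S 0 u w) ^+ 2)%:E <= (K ^+ cnt S 0 u * nsq c ^+ 2)%:E)%E.
Proof.
move=> um.
have := @E_key S u 0 pred0 p (fun=> nsq c) (fun=> c) (leq0n u) um
  (fun _ _ => isT) (measurable_cst _) (fun=> nsq_ge0 c) (mxmeas_cst _ _).
rewrite integral_cst_prob -EFinM -expr2 => h1.
apply: (le_trans _ h1); apply: le_integral_ge0 => w; rewrite lee_fin ?sqr_ge0//.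
rewrite mulrC mulmxA -[nsq (c *m _)]ipxx ip_mulr ipC.
exact: ip_CS.
Qed.

(** Beyond [i] both products share a tail [W], so the matrix is [A G_i H_i W W^* B^*] with a single
    occurrence of [H_i]; this gives the factor [1/p]. [E_key] removes [W W^*] under the weight
    [|A G_i|^2 / p], then [G_i] is integrated out, and [|A|^2 |B|^2] is split into fourth powers for
    [E_nsq4]. *)
Lemma E_offdiag (S S' : {set 'I_m}) (c c' : M) (i : 'I_m) :
  i \in S -> i \notin S' -> (forall j : 'I_m, (i < j)%N -> (j \in S) = (j \in S')) ->
  (\int[P]_w (nsq ((c *m Wf S 0 m w) *m (c' *m Wf S' 0 m w) ^t*))%:E <=
   (K ^+ m * K ^+ m * (nsq c ^+ 2 + nsq c' ^+ 2) / p%:R)%:E)%E.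
Proof.
move=> iS iS' eqS.
have p0 : (0 : R) < p%:R by rewrite ltr0n.
have im : (i < m)%N by [].
have powK (S0 : {set 'I_m}) l u : (l <= u)%N -> (u <= m)%N -> K ^+ cnt S0 l u <= K ^+ m.
  move=> lu um; rewrite ler_weXn2l//; apply: leq_trans (cnt_le _ lu um) _.
  by apply: leq_trans (max_card _) _; rewrite card_ord.
pose A w : M := c *m Wf S 0 i w.
pose B w : M := c' *m Wf S' 0 i w.
pose W w : M := Wf S i.+1 m w.
have WSE w : c *m Wf S 0 m w = A w *m amp (G i w) *m (H i w : M) *m W w.
  rewrite (Wf_cat S w (leq0n i) (ltnW im)) (Wf_recl _ _ im) Yf_ord iS /A /X /W.
  by rewrite !mulmxA.
have WS'E w : c' *m Wf S' 0 m w = B w *m W w.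
  rewrite (Wf_cat S' w (leq0n i) (ltnW im)) (Wf_recl _ _ im) Yf_ord (negbTE iS') mul1mx.
  rewrite mulmxA; congr (_ *m _); rewrite /W /Wf; apply: eq_big_nat => r /andP[ir rm].
  by rewrite -[r]/(Ordinal rm : nat) !Yf_ord eqS.
pose Di : pred I := dep_ltn i.
pose D2 : pred I := [pred j | Di j || (j == inl i)].
pose D3 : pred I := [pred j | j != inr i].
have Dil : ~~ Di (inl i) by rewrite /Di /= ltnn.
have D23 j : D2 j -> D3 j.
  move=> /orP[|/eqP->//]; case: j => // j; rewrite /Di /D3 /= => ji.
  by apply/eqP => -[] e; rewrite e ltnn in ji.
have D3i : ~~ D3 (inr i) by rewrite /D3 /= eqxx.
have mA : mxdep Di A by apply: mxmeas_mul; [exact: mxmeas_cst|exact: mxdep_W0].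
have mB : mxdep Di B by apply: mxmeas_mul; [exact: mxmeas_cst|exact: mxdep_W0].
have mA2 : mxdep D2 A by apply: mxdep_sub mA => j h; apply/orP; left.
have mB2 : mxdep D2 B by apply: mxdep_sub mB => j h; apply/orP; left.
have mG2 : mxdep D2 (fun w => amp (G i w) : M) by apply: mxdep_amp; apply/orP; right.
have mAG : mxdep D2 (fun w => A w *m amp (G i w)) by exact: mxmeas_mul.
have mW : mxdep D3 W.
  apply: mxdep_Wf => j /andP[ij jm] _; rewrite /D3 /=; apply/eqP => -[] e.
  by move: ij; rewrite e ltnn.
have mWW : mxdep D3 (fun w => W w *m (W w) ^t*).
  by apply: mxmeas_mul => //; exact: mxmeas_adj.
apply: (@le_trans _ _ (\int[P]_w ((nsq (A w *m amp (G i w)) / p%:R) *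
    nsq (B w *m (W w *m (W w) ^t*)))%:E)%E).
  apply: (@le_trans _ _ (\int[P]_w (nsq ((A w *m amp (G i w)) *m (H i w : M) *m
      ((W w *m (W w) ^t*) *m (B w) ^t*)))%:E)%E).
    apply: le_integral_ge0 => w; first by rewrite lee_fin nsq_ge0.
    by rewrite WSE WS'E adjM !mulmxA.
  apply: (@decouple_H i (fun x w => nsq ((A w *m amp (G i w)) *m (x : M) *m
      ((W w *m (W w) ^t*) *m (B w) ^t*)))).
  - have jA : mxjdep (inr i) (fun (_ : cmx R p) w => A w *m amp (G i w)).
      exact: mxjdep_snd D3i (mxdep_sub D23 mAG).
    have jB : mxjdep (inr i) (fun (_ : cmx R p) w => B w).
      exact: mxjdep_snd D3i (mxdep_sub D23 mB2).
    have jW : mxjdep (inr i) (fun (_ : cmx R p) w => W w *m (W w) ^t*).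
      exact: mxjdep_snd D3i mWW.
    have jx : mxjdep (inr i) (fun (x : cmx R p) (_ : Omega) => (x : M)).
      exact: mxjdep_fst.
    apply: measurable_nsq; apply: mxmeas_mul.
      exact: mxmeas_mul jA jx.
    by apply: mxmeas_mul; [exact: jW|exact: mxmeas_adj jB].
  - by move=> x w; exact: nsq_ge0.
  - move=> w; apply: le_trans (haar_nsq_mul (haarH i) _ _) _.
    have -> : nsq (B w *m (W w *m (W w) ^t*)) = nsq (W w *m (W w) ^t* *m (B w) ^t*).
      by rewrite -nsq_adj !adjM trmxCK.
    by rewrite mulrAC.
have h2m : rdep D2 (fun w => nsq (A w *m amp (G i w)) / p%:R).
  by apply: measurable_funM => //; exact: measurable_nsq.
have disj (j : 'I_m) : (i.+1 <= j < m)%N -> ~~ D2 (inl j) && ~~ D2 (inr j).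
  move=> /andP[ij _]; have ji : ~~ (j < i)%N by rewrite -leqNgt ltnW.
  apply/andP; split; apply/negP => /orP[|/eqP] //; rewrite /Di /= ?(negbTE ji)//.
  by move=> -[] e; rewrite e ltnn in ij.
have h1 := @E_key S m i.+1 D2 p _ B im (leqnn m) disj h2m
  (fun w => divr_ge0 (nsq_ge0 _) (ler0n _ _)) mB2.
apply: (le_trans h1) => {h1}.
have mdi F : mxdep Di F -> measurable_fun setT (fun w => nsq (F w : M)).
  by move=> mF; apply: (@rdep_measurable Di); exact: measurable_nsq.
have half0 : 0 <= (2 * p%:R)^-1 :> R by rewrite invr_ge0 mulr_ge0.
have h2 : (\int[P]_w (nsq (A w *m amp (G i w)) / p%:R * nsq (B w))%:E <=
    (K ^+ m * (nsq c ^+ 2 + nsq c' ^+ 2) / p%:R)%:E)%E.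
  apply: (@le_trans _ _ (\int[P]_w (nsq (A w) / p%:R * nsq (B w))%:E)%E).
    apply: (@decouple_G i (fun x w => nsq (A w *m amp (x : 'M[C]_n)) / p%:R * nsq (B w))).
    - have jA : mxjdep (inl i) (fun (_ : cmx R n) w => A w) by exact: mxjdep_snd Dil mA.
      have jB : mxjdep (inl i) (fun (_ : cmx R n) w => B w) by exact: mxjdep_snd Dil mB.
      have jG : mxjdep (inl i) (fun (x : cmx R n) (_ : Omega) => amp (x : 'M[C]_n) : M).
        by apply: mxmeas_tens; exact: mxjdep_fst.
      apply: measurable_funM; last exact: measurable_nsq jB.
      apply: measurable_funM => //; apply: measurable_nsq.
      exact: mxmeas_mul jA jG.
    - by move=> x w; rewrite mulr_ge0 ?divr_ge0 ?nsq_ge0.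
    - move=> w.
      have bE x : nsq (A w *m amp (x : 'M[C]_n)) / p%:R * nsq (B w) =
        (nsq (B w) / p%:R) * nsq (A w *m amp (x : 'M[C]_n)) by ring.
      under eq_integral do rewrite bE EFinM.
      have b0 : 0 <= nsq (B w) / p%:R by rewrite divr_ge0 ?nsq_ge0.
      rewrite ge0_integralZl//; last 2 first.
      + apply/measurable_EFinP; apply: measurable_nsq; apply: mxmeas_mul.
          exact: mxmeas_cst.
        by apply: mxmeas_tens; exact: mxmeas_cmx.
      + by move=> x _; rewrite lee_fin nsq_ge0.
      rewrite [X in (_ <= X%:E)%E](_ : _ = nsq (B w) / p%:R * nsq (A w)); last by ring.
      rewrite [leRHS]EFinM lee_wpmul2l ?lee_fin//.
      exact: (moment_nsq momG).
  apply: (@le_trans _ _ (\int[P]_w ((2 * p%:R)^-1 * nsq (A w) ^+ 2 +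
      (2 * p%:R)^-1 * nsq (B w) ^+ 2)%:E)%E).
    apply: le_integral_ge0 => w; rewrite lee_fin.
      by rewrite mulr_ge0 ?divr_ge0 ?nsq_ge0.
    rewrite -mulrDr invfM -subr_ge0.
    rewrite [X in 0 <= X](_ : _ = 2^-1 / p%:R * (nsq (A w) - nsq (B w)) ^+ 2).
      by rewrite mulr_ge0 ?divr_ge0 ?sqr_ge0// invr_ge0.
    by move: (p%:R : R) (gt_eqF p0) => pp pp0; field; rewrite pp0.
  under eq_integral do rewrite EFinD.
  have mA' : measurable_fun setT (fun w => nsq (A w) ^+ 2).
    by apply: measurable_funX; exact: mdi.
  have mB' : measurable_fun setT (fun w => nsq (B w) ^+ 2).
    by apply: measurable_funX; exact: mdi.
  rewrite ge0_integralD//; last 4 first.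
  - by move=> w _; rewrite lee_fin mulr_ge0 ?sqr_ge0.
  - by apply/measurable_EFinP; exact: measurable_funM.
  - by move=> w _; rewrite lee_fin mulr_ge0 ?sqr_ge0.
  - by apply/measurable_EFinP; exact: measurable_funM.
  rewrite !integralZ//; try by move=> w; exact: sqr_ge0.
  apply: (@le_trans _ _ (((2 * p%:R)^-1)%:E * (K ^+ m * nsq c ^+ 2)%:E +
      ((2 * p%:R)^-1)%:E * (K ^+ m * nsq c' ^+ 2)%:E)%E).
    apply: leeD; apply: lee_wpmul2l; rewrite ?lee_fin//.
      apply: le_trans (E_nsq4 _ _ (ltnW im)) _; rewrite lee_fin.
      by rewrite ler_wpM2r ?sqr_ge0// powK// ltnW.
    apply: le_trans (E_nsq4 _ _ (ltnW im)) _; rewrite lee_fin.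
    by rewrite ler_wpM2r ?sqr_ge0// powK// ltnW.
  rewrite -!EFinM -EFinD lee_fin.
  set x := K ^+ m; have x0 : 0 <= x by rewrite exprn_ge0.
  rewrite -subr_ge0.
  rewrite [X in 0 <= X](_ : _ = 2^-1 / p%:R * (x * (nsq c ^+ 2 + nsq c' ^+ 2))).
    by rewrite mulr_ge0 ?divr_ge0 ?mulr_ge0 ?addr_ge0 ?sqr_ge0// invr_ge0.
  by move: (p%:R : R) (gt_eqF p0) => pp pp0; field; rewrite pp0.
apply: (@le_trans _ _ ((K ^+ m)%:E * (K ^+ m * (nsq c ^+ 2 + nsq c' ^+ 2) / p%:R)%:E)%E).
  apply: lee_pmul => //.
  - by rewrite lee_fin exprn_ge0.
  - by apply: integral_ge0 => w _; rewrite lee_fin mulr_ge0 ?divr_ge0 ?nsq_ge0.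
  - by rewrite lee_fin powK.
by rewrite -EFinM !mulrA.
Qed.

(** The diagonal part of [Q Q^*] minus its mean, with only the first [u] variables revealed: the
    martingale whose increments are bounded below. *)
Definition Zf (kap : {set 'I_m} -> R) (c : {set 'I_m} -> M) u w : M :=
  \sum_S (kap S)%:C *: ((c S *m Wf S 0 u w) *m (c S *m Wf S 0 u w) ^t*) -
  \sum_S (kap S)%:C *: (c S *m (c S) ^t*).

Lemma Zf_recr kap c (i : 'I_m) w : Zf kap c i.+1 w = Zf kap c i w +
  \sum_(S : {set 'I_m} | i \in S) (kap S)%:C *: ((c S *m Wf S 0 i w) *m
    ((amp (G i w) *m (H i w : M) *m ((H i w : M) ^t*) *m (amp (G i w)) ^t*) - 1%:M) *m
    (c S *m Wf S 0 i w) ^t*).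
Proof.
rewrite /Zf addrAC; congr (_ - _).
rewrite [X in _ = _ + X]big_mkcond -big_split; apply: eq_bigr => S _ /=.
rewrite Wf_recr// Yf_ord; case: ifP => _; last by rewrite mulmx1 addr0.
rewrite -scalerDr mulmxBr mulmx1 mulmxBl addrCA subrr addr0.
by rewrite /X !adjM !mulmxA.
Qed.

(** [H_i] cancels against its adjoint, and [moment_variance] with weights [al S = kap S * nsq (c S)]
    bounds the increment. By [E_nsq4] each [S] leaves at most [c2 K^cnt al S], with [cnt] the number
    of its elements before [i]. As [c2 <= K] and [i] itself lies in [S], this is at most
    [K^dd al S]. *)
Lemma E_diag_step kap c dd (i : 'I_m) : (forall S, 0 <= kap S) ->
  (forall S : {set 'I_m}, (dd < #|S|)%N -> kap S = 0) ->
  (\int[P]_w (nsq (Zf kap c i.+1 w))%:E <=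
   \int[P]_w (nsq (Zf kap c i w))%:E +
   (K ^+ dd * (\sum_(S : {set 'I_m} | i \in S) kap S * nsq (c S)) ^+ 2)%:E)%E.
Proof.
move=> kap0 kapd; have im : (i < m)%N by [].
pose a S w : M := c S *m Wf S 0 i w.
pose Z w := Zf kap c i w.
pose al (S : {set 'I_m}) := kap S * nsq (c S).
set s := \sum_(S : {set 'I_m} | i \in S) kap S * nsq (c S).
have al0 S : 0 <= al S by rewrite mulr_ge0 ?nsq_ge0.
have ala w S : al S = 0 -> (kap S)%:C *: a S w = 0.
  move=> /eqP; rewrite mulf_eq0 => /orP[/eqP ->|/eqP/nsq_eq0 c0].
    by rewrite scale0r.
  by rewrite /a c0 mul0mx scaler0.
have s0 : 0 <= s by apply: sumr_ge0 => S _; exact: al0.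
pose Di : pred I := dep_ltn i.
pose D2 : pred I := [pred j | Di j || (j == inl i)].
have Dil : ~~ Di (inl i) by rewrite /Di /= ltnn.
have D2i : ~~ D2 (inr i) by rewrite /D2 /Di /= ltnn.
have ma S : mxdep Di (a S) by apply: mxmeas_mul; [exact: mxmeas_cst|exact: mxdep_W0].
have mZ : mxdep Di Z.
  apply: mxmeas_add; last exact: mxmeas_cst.
  apply: mxmeas_sum => S _; apply: mxmeas_scale.
  by apply: mxmeas_mul; [exact: ma|apply: mxmeas_adj; exact: ma].
have Di2 j : Di j -> D2 j by move=> h; apply/orP; left.
pose f (y : M) w := nsq (Z w + \sum_(S : {set 'I_m} | i \in S)
  (kap S)%:C *: (a S w *m (y - 1%:M) *m (a S w) ^t*)).
apply: (@le_trans _ _ (\int[P]_w (f (amp (G i w) *m (amp (G i w)) ^t*) w)%:E)%E).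
  under eq_integral do rewrite Zf_recr.
  have mG2 : mxdep D2 (fun w => amp (G i w) : M) by apply: mxdep_amp; apply/orP; right.
  apply: (@decouple_H i (fun x w =>
    f (amp (G i w) *m (x : M) *m (x : M) ^t* *m (amp (G i w)) ^t*) w)).
  - have jZ : mxjdep (inr i) (fun (_ : cmx R p) w => Z w).
      exact: mxjdep_snd D2i (mxdep_sub Di2 mZ).
    have ja S : mxjdep (inr i) (fun (_ : cmx R p) w => a S w).
      exact: mxjdep_snd D2i (mxdep_sub Di2 (ma S)).
    have jG : mxjdep (inr i) (fun (_ : cmx R p) w => amp (G i w) : M).
      exact: mxjdep_snd D2i mG2.
    have jx : mxjdep (inr i) (fun (x : cmx R p) (_ : Omega) => (x : M)).
      exact: mxjdep_fst.
    apply: measurable_nsq; apply: mxmeas_add; first exact: jZ.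
    apply: mxmeas_sum => S _; apply: mxmeas_scale.
    apply: mxmeas_mul; last exact: mxmeas_adj (ja S).
    apply: mxmeas_mul; first exact: ja.
    apply: mxmeas_add; last exact: mxmeas_cst.
    apply: mxmeas_mul; last exact: mxmeas_adj jG.
    apply: mxmeas_mul; last exact: mxmeas_adj jx.
    exact: mxmeas_mul jG jx.
  - by move=> x w; exact: nsq_ge0.
  - move=> w; pose g := f (amp (G i w) *m (amp (G i w)) ^t*) w.
    rewrite -[leRHS](integral_cst_prob (distribution P (H i))).
    apply: (le_integral_haar (haarH i) (psi := fun=> g)
      (phi := fun x => f (amp (G i w) *m (x : M) *m (x : M) ^t* *m (amp (G i w)) ^t*) w)).
    + apply: measurable_nsq; apply: mxmeas_add; first exact: mxmeas_cst.
      apply: mxmeas_sum => S _; apply: mxmeas_scale.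
      apply: mxmeas_mul; last exact: mxmeas_cst.
      apply: mxmeas_mul; first exact: mxmeas_cst.
      apply: mxmeas_add; last exact: mxmeas_cst.
      apply: mxmeas_mul; last exact: mxmeas_cst.
      apply: mxmeas_mul; last by apply: mxmeas_adj; exact: mxmeas_cmx.
      by apply: mxmeas_mul; [exact: mxmeas_cst|exact: mxmeas_cmx].
    + exact: measurable_cst.
    + by move=> x; exact: nsq_ge0.
    + by move=> x; exact: nsq_ge0.
    + move=> x ux.
      have xE : amp (G i w) *m x *m x ^t* *m (amp (G i w)) ^t* =
          (amp (G i w) : M) *m (amp (G i w)) ^t*.
        move: (amp (G i w)) => y.
        by rewrite -(mulmxA y) unitary_adjl// mulmx1.
      by rewrite xE; exact: lexx.
pose q w : R := \sum_(S : {set 'I_m} | i \in S)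
  (al S)^-1 * (kap S ^+ 2 * (c2 * nsq (a S w) ^+ 2)).
apply: (@le_trans _ _ (\int[P]_w (nsq (Z w) + s * q w)%:E)%E).
  apply: (@decouple_G i (fun x w => f (amp (x : 'M[C]_n) *m (amp (x : 'M[C]_n)) ^t*) w)).
  - have jZ : mxjdep (inl i) (fun (_ : cmx R n) w => Z w) by exact: mxjdep_snd Dil mZ.
    have ja S : mxjdep (inl i) (fun (_ : cmx R n) w => a S w).
      exact: mxjdep_snd Dil (ma S).
    have jG : mxjdep (inl i) (fun (x : cmx R n) (_ : Omega) => amp (x : 'M[C]_n) : M).
      by apply: mxmeas_tens; exact: mxjdep_fst.
    apply: measurable_nsq; apply: mxmeas_add; first exact: jZ.
    apply: mxmeas_sum => S _; apply: mxmeas_scale.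
    apply: mxmeas_mul; last exact: mxmeas_adj (ja S).
    apply: mxmeas_mul; first exact: ja.
    apply: mxmeas_add; last exact: mxmeas_cst.
    by apply: mxmeas_mul; [exact: jG|exact: mxmeas_adj jG].
  - by move=> x w; exact: nsq_ge0.
  - move=> w; apply: le_trans
      (moment_variance c2_ge1 momG [pred S : {set 'I_m} | i \in S] (Z w) al0 (ala w)) _.
    by [].
have mnsq F : mxdep Di F -> measurable_fun setT (fun w => nsq (F w : M)).
  by move=> mF; apply: (@rdep_measurable Di); exact: measurable_nsq.
have ms S : measurable_fun setT (fun w => nsq (a S w) ^+ 2).
  by apply: measurable_funX; exact: mnsq.
have c20 : 0 <= c2 by exact: le_trans c2_ge1.
pose b (S : {set 'I_m}) := if i \in S then (al S)^-1 * (kap S ^+ 2 * c2) else 0.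
have b0 S : 0 <= b S.
  rewrite /b; case: ifP => // _.
  by rewrite mulr_ge0 ?invr_ge0// mulr_ge0 ?sqr_ge0.
have qE w : q w = \sum_S b S * nsq (a S w) ^+ 2.
  rewrite /q big_mkcond; apply: eq_bigr => S _; rewrite /b.
  by case: ifP => _; rewrite ?mul0r// !mulrA.
have mq : measurable_fun setT q.
  by rewrite (funext qE); apply: measurable_sum => S; exact: measurable_funM.
have q0 w : 0 <= q w.
  by rewrite qE; apply: sumr_ge0 => S _; rewrite mulr_ge0 ?sqr_ge0.
under eq_integral do rewrite EFinD.
rewrite ge0_integralD//; last 4 first.
- by move=> w _; rewrite lee_fin nsq_ge0.
- by apply/measurable_EFinP; exact: mnsq.
- by move=> w _; rewrite lee_fin mulr_ge0.
- by apply/measurable_EFinP; exact: measurable_funM.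
apply: leeD => //; rewrite integralZ// expr2 mulrCA EFinM lee_wpmul2l ?lee_fin//.
under eq_integral do rewrite qE -sumEFin.
rewrite ge0_integral_sum//; last 2 first.
- by move=> S; apply/measurable_EFinP; exact: measurable_funM.
- by move=> S w _; rewrite lee_fin mulr_ge0 ?sqr_ge0.
rewrite /s mulr_sumr [X in (_ <= X%:E)%E]big_mkcond -sumEFin; apply: lee_sum => S _.
rewrite integralZ//; last by move=> w; exact: sqr_ge0.
apply: (@le_trans _ _ ((b S)%:E * (K ^+ cnt S 0 i * nsq (c S) ^+ 2)%:E)%E).
  by apply: lee_wpmul2l; rewrite ?lee_fin//; exact: E_nsq4 (ltnW im).
rewrite -EFinM lee_fin /b; case: ifP => iS; last by rewrite mul0r.
rewrite -/(al S).
(* A zero weight has inverse 0, so both sides vanish. *)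
have [al00|al00] := eqVneq (al S) 0.
  by rewrite al00 invr0 !mul0r mulr0.
have -> : (al S)^-1 * (kap S ^+ 2 * c2) * (K ^+ cnt S 0 i * nsq (c S) ^+ 2) =
   (c2 * K ^+ cnt S 0 i) * al S.
  have vE v : v * (kap S ^+ 2 * c2) * (K ^+ cnt S 0 i * nsq (c S) ^+ 2) =
      v * al S * (c2 * K ^+ cnt S 0 i * al S) by rewrite /al; ring.
  by rewrite vE mulVf// mul1r.
rewrite ler_wpM2r//.
apply: (@le_trans _ _ (K ^+ (cnt S 0 i).+1)).
  by rewrite exprS ler_wpM2r ?exprn_ge0// /K; have := c20; lra.
rewrite ler_weXn2l//.
have Sd : (#|S| <= dd)%N.
  rewrite leqNgt; apply/negP => /kapd k0.
  by move: al00; rewrite /al k0 mul0r eqxx.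
apply: leq_trans Sd; rewrite -cnt_card (cnt_cat S (leq0n i) (ltnW im)).
by rewrite (cnt_recl S im) iS -addn1 leq_add2l leq_addr.
Qed.

Lemma E_diag kap c dd : (forall S, 0 <= kap S) ->
  (forall S : {set 'I_m}, (dd < #|S|)%N -> kap S = 0) ->
  (\int[P]_w (nsq (Zf kap c m w))%:E <=
   (K ^+ dd * \sum_(i < m) (\sum_(S : {set 'I_m} | i \in S) kap S * nsq (c S)) ^+ 2)%:E)%E.
Proof.
move=> kap0 kapd.
suff h u : (u <= m)%N -> (\int[P]_w (nsq (Zf kap c u w))%:E <=
   (K ^+ dd * \sum_(i < m | (i < u)%N)
     (\sum_(S : {set 'I_m} | i \in S) kap S * nsq (c S)) ^+ 2)%:E)%E.
  apply: le_trans (h m (leqnn m)) _; rewrite lee_fin le_eqVlt; apply/orP; left.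
  by apply/eqP; congr (_ * _); apply: eq_bigl => i; rewrite ltn_ord.
elim: u => [|u IH] um.
  have Z0 w : Zf kap c 0 w = 0.
    rewrite /Zf -sumrB big1// => S _.
    by rewrite Wf_geq// mulmx1 subrr.
  under eq_integral do rewrite Z0 nsq0.
  by rewrite integral_cst_prob big_pred0 ?mulr0.
have := @E_diag_step kap c dd (Ordinal um) kap0 kapd => /=.
move=> h1; apply: (le_trans h1) => {h1}.
apply: (le_trans (leeD2r _ (IH (ltnW um)))).
rewrite -EFinD lee_fin -mulrDr ler_wpM2l ?exprn_ge0//.
rewrite [leRHS](bigD1 (Ordinal um))//= [leLHS]addrC lerD2l.
rewrite le_eqVlt; apply/orP; left; apply/eqP; apply: eq_bigl => i.
by rewrite [LHS]ltn_neqAle ltnS -val_eqE andbC.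
Qed.

End Model.

(** * Parseval's identity for matrix-valued functions *)

Section FourierBounds.
Context {R : realType} {m n : nat}.
Notation C := R[i].
Implicit Types (f : {ffun 'I_m -> bool} -> 'M[C]_n) (S : {set 'I_m}).

(** The Walsh character with real values, so that it can be pulled out of [ip]; [chiC] identifies it
    with the sign in [fhat]. *)
Definition chi S (b : {ffun 'I_m -> bool}) : R := \prod_(i in S) (-1) ^+ b i.

Lemma chiC S b : (chi S b)%:C = \prod_(i in S) (-1) ^+ b i.
Proof.
rewrite /chi rmorph_prod; apply: eq_bigr => i _.
by rewrite rmorphXn rmorphN rmorph1.
Qed.

(** The sum over [S] factors into the product over [i] of 1 plus the product of the two signs at
    [i]; a coordinate where the points differ gives the factor 0. *)
Lemma sum_chi (b b' : {ffun 'I_m -> bool}) :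
  \sum_S chi S b * chi S b' = if b == b' then 2 ^+ m else 0.
Proof.
pose x i : R := (-1) ^+ b i * (-1) ^+ b' i.
have -> : \sum_S chi S b * chi S b' = \prod_i (x i + 1).
  rewrite bigA_distr; apply: eq_big => [S|S _]; first by rewrite inE.
  by rewrite /chi -big_split [LHS]big_mkcond.
case: eqVneq => [bb|bb'].
  rewrite (eq_bigr (fun=> 2)) ?prodr_const ?card_ord// => i _.
  by rewrite /x bb -expr2 sqrr_sign.
have [i bi] : exists i, b i != b' i.
  apply/existsP; rewrite -negb_forall; apply: contra bb' => /forallP h.
  by apply/eqP/ffunP => i; apply/eqP.
rewrite (bigD1 i)//= [X in X * _](_ : _ = 0) ?mul0r// /x.
by case: (b i) (b' i) bi => -[] // _; rewrite ?expr0 ?expr1 ?mulr1 ?mul1r addNr.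
Qed.

Lemma parseval {a c} (F : {ffun 'I_m -> bool} -> 'M[C]_(a, c)) :
  \sum_S nsq (\sum_b (chi S b)%:C *: F b) = 2 ^+ m * \sum_b nsq (F b).
Proof.
have E S : nsq (\sum_b (chi S b)%:C *: F b) =
    \sum_b \sum_b' (chi S b * chi S b') * ip (F b) (F b').
  rewrite -ipxx ip_suml; apply: eq_bigr => b _; rewrite ip_sumr.
  by apply: eq_bigr => b' _; rewrite ipZl ipZr mulrA.
rewrite (eq_bigr _ (fun S _ => E S)) exchange_big mulr_sumr /=.
apply: eq_bigr => b _; rewrite exchange_big /=.
rewrite (bigD1 b)//= [X in _ + X]big1 ?addr0 => [|b' bb'].
  by rewrite -mulr_suml sum_chi eqxx ipxx.
by rewrite -mulr_suml sum_chi eq_sym (negbTE bb') mul0r.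
Qed.

Lemma fhatE f S : fhat f S = (2 ^+ m)^-1%:C *: \sum_b (chi S b)%:C *: f b.
Proof.
rewrite /fhat; congr (_ *: _).
  by rewrite fmorphV rmorphXn rmorph_nat.
by apply: eq_bigr => b _; rewrite chiC.
Qed.

(** [opnorm] concerns columns, while here [A] acts on rows. By duality [|u A|^2] is the inner
    product of [u A A^*] with [u], and the adjoint of [u A A^*] is [A] applied to the column
    [(u A)^*], of length at most [|u A|]. *)
Lemma nsq_contraction {a} (A : 'M[C]_n) (U : 'M[C]_(a, n)) :
  opnorm A <= 1 -> nsq (U *m A) <= nsq U.
Proof.
move=> A1; rewrite [leLHS]nsq_row [leRHS]nsq_row; apply: ler_sum => i _.
rewrite row_mul; move: (row i U) => u.
have [t0|t0] := eqVneq (nsq (u *m A)) 0; first by rewrite t0 nsq_ge0.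
have tp : 0 < nsq (u *m A) by rewrite lt_def t0 nsq_ge0.
rewrite -(ler_pM2r tp) -expr2 -{1}ipxx ip_mulr.
apply: le_trans (ip_CS _ _) _; rewrite ler_wpM2l ?nsq_ge0//.
rewrite -nsq_adj adjM trmxCK; apply: le_trans (nsq_mul_opnorm _ A1) _.
by rewrite expr1n mul1r nsq_adj.
Qed.

(** Parseval applied to [U f]. The free factor [U] turns a statement about traces into one about
    quadratic forms: the matrices [f^(S) f^(S)^*] add up to at most [I]. *)
Lemma sum_nsq_fhat f {a} (U : 'M[C]_(a, n)) : (forall b, opnorm (f b) <= 1) ->
  \sum_S nsq (U *m fhat f S) <= nsq U.
Proof.
move=> f1.
have E S : nsq (U *m fhat f S) =
    (2 ^+ m)^-1 ^+ 2 * nsq (\sum_b (chi S b)%:C *: (U *m f b)).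
  rewrite fhatE -scalemxAr nsqZr mulmx_sumr; congr (_ * nsq _).
  by apply: eq_bigr => b _; rewrite -scalemxAr.
rewrite (eq_bigr _ (fun S _ => E S)) -mulr_sumr parseval.
have x0 : (0 : R) < 2 ^+ m by rewrite exprn_gt0.
apply: (@le_trans _ _ ((2 ^+ m)^-1 * \sum_(b : {ffun 'I_m -> bool}) nsq U)).
  rewrite expr2 -mulrA mulKf ?gt_eqF// ler_wpM2l ?invr_ge0 ?(ltW x0)//.
  by apply: ler_sum => b _; exact: nsq_contraction.
rewrite sumr_const card_ffun card_bool card_ord -[nsq U *+ _]mulr_natl natrX.
by rewrite mulKf ?gt_eqF.
Qed.

Lemma nsq_fhat_tr f S : complex.Re (\tr (fhat f S *m (fhat f S) ^t*)) = nsq (fhat f S).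
Proof. by rewrite nsq_tr. Qed.

Lemma influence_le_maxInf f i : influence f i <= maxInf f.
Proof. by rewrite /maxInf; exact: le_bigmax. Qed.

End FourierBounds.

(** * Embedding into the upper left corner *)

Section Embedding.
Context {R : realType} {n p : nat}.
Hypothesis np : (n <= p)%N.
Notation C := R[i].

Definition incl : 'M[C]_(n, p) := pid_mx n.

Lemma incl_adj : incl ^t* = (pid_mx n : 'M[C]_(p, n)).
Proof.
rewrite /incl tr_pid_mx; apply/matrixP => i j; rewrite !mxE.
by rewrite rmorph_nat.
Qed.

Lemma incl_mul_adj : incl *m incl ^t* = 1%:M.
Proof. by rewrite incl_adj mul_pid_mx minnn (minn_idPr np) pid_mx_1. Qed.

Lemma iotamxE (A : 'M[C]_n) : iotamx p A = incl ^t* *m A *m incl.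
Proof. by rewrite incl_adj. Qed.

Lemma nsq_mul_incl {a} (X : 'M[C]_(a, n)) : nsq (X *m incl) = nsq X.
Proof. by rewrite -!ipxx ip_mulr -mulmxA incl_mul_adj mulmx1. Qed.

Lemma nsq_adj_incl_mul {a} (X : 'M[C]_(n, a)) : nsq (incl ^t* *m X) = nsq X.
Proof. by rewrite -nsq_adj adjM trmxCK nsq_mul_incl nsq_adj. Qed.

(** Pythagoras: multiplying on the right by [incl^* incl] is an orthogonal projection. *)
Lemma nsq_mul_adj_incl {a} (X : 'M[C]_(a, p)) : nsq (X *m incl ^t*) <= nsq X.
Proof.
rewrite -(nsq_mul_incl (X *m incl ^t*)).
have := nsq_ge0 (X - X *m incl ^t* *m incl).
rewrite nsqD nsqN ipNr.
have -> : ip X (X *m incl ^t* *m incl) = nsq (X *m incl ^t* *m incl).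
  by rewrite ipC ip_mulr -ipxx [RHS]ip_mulr -!mulmxA incl_mul_adj mulmx1.
lra.
Qed.

Lemma nsq_iotamx (A : 'M[C]_n) : nsq (iotamx p A) = nsq A.
Proof. by rewrite iotamxE nsq_mul_incl nsq_adj_incl_mul. Qed.

Lemma nsq_proj : nsq (incl ^t* *m incl) = n%:R.
Proof. by rewrite nsq_adj_incl_mul -[incl]mul1mx nsq_mul_incl nsq1. Qed.

Lemma proj_iotamx (A : 'M[C]_n) : incl ^t* *m incl *m iotamx p A = iotamx p A.
Proof. by rewrite iotamxE !mulmxA -(mulmxA _ incl) incl_mul_adj mulmx1. Qed.

(** Supplies the hypothesis of [chop_excess_le] on [B], taken to be the mean of [Q Q^*]. The
    embedding compresses [v] to its first [n] coordinates, where [sum_nsq_fhat] applies. *)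
Lemma ip_sum_iotamx {m} (f : {ffun 'I_m -> bool} -> 'M[C]_n) (kap : {set 'I_m} -> R)
    (v : 'rV[C]_p) :
  (forall b, opnorm (f b) <= 1) -> (forall S, 0 <= kap S <= 1) ->
  ip (v *m \sum_S (kap S)%:C *: (iotamx p (fhat f S) *m (iotamx p (fhat f S)) ^t*)) v
  <= nsq v.
Proof.
move=> f1 kap1.
have E : ip (v *m \sum_S (kap S)%:C *: (iotamx p (fhat f S) *m (iotamx p (fhat f S)) ^t*)) v
   = \sum_S kap S * nsq ((v *m incl ^t*) *m fhat f S).
  rewrite mulmx_sumr ip_suml; apply: eq_bigr => S _.
  rewrite -scalemxAr ipZl mulmxA ip_mulr trmxCK ipxx; congr (_ * _).
  by rewrite iotamxE !mulmxA nsq_mul_incl.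
rewrite E; apply: le_trans (nsq_mul_adj_incl v).
apply: le_trans (sum_nsq_fhat _ f1); apply: ler_sum => S _.
by have /andP[_ k1] := kap1 S; rewrite ler_piMl ?nsq_ge0.
Qed.

End Embedding.

(** * From the moment bounds to the estimate for [chopmx] *)

Section Assembly.
Context {R : realType} {m n k : nat} (c2 c3 : R) (calG : probability (cmx R n) R).
Context d (Omega : measurableType d) (P : probability Omega R).
Variables (G : 'I_m -> {RV P >-> cmx R n}) (H : 'I_m -> {RV P >-> cmx R (n * k)%N}).
Hypothesis c2_ge1 : 1 <= c2.
Hypothesis momG : moment_conditions c2 c3 calG.
Hypothesis modelGH : GH_model calG G H.
Hypothesis n_gt0 : (0 < n)%N.
Hypothesis k_gt0 : (0 < k)%N.
Variables (f : {ffun 'I_m -> bool} -> 'M[R[i]]_n) (rho : R).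
Hypothesis f1 : forall b, opnorm (f b) <= 1.
Hypothesis rho_ge0 : 0 <= rho.
Hypothesis rho_le1 : rho <= 1.
Notation C := R[i].
Notation p := (n * k)%N.
Notation M := 'M[C]_p.
Notation K := (3 * c2).

Let p_gt0 : (0 < p)%N. Proof. by rewrite muln_gt0 n_gt0. Qed.
Let np : (n <= p)%N. Proof. by rewrite leq_pmulr. Qed.

Let c (S : {set 'I_m}) : M := iotamx p (fhat f S).
Let cW S w : M := c S *m Wf G H S 0 m w.

Let K_ge0 : 0 <= K. Proof. by have := c2_ge1; lra. Qed.

Let mcW S : mxmeas (cW S).
Proof.
apply: mxmeas_mul; first exact: mxmeas_cst.
move=> i j; have h := @mxdep_Wf _ _ _ _ _ _ _ G H predT S 0 m (fun _ _ _ => isT).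
have [h1 h2] := h i j.
by split; [exact: (rdep_measurable h1)|exact: (rdep_measurable h2)].
Qed.

Lemma sum_nsq_c : \sum_S nsq (c S) <= n%:R.
Proof.
rewrite -(@nsq1 R n); apply: le_trans (sum_nsq_fhat 1%:M f1).
by apply: ler_sum => S _; rewrite /c nsq_iotamx// mul1mx.
Qed.

Lemma nsq_c_le S : nsq (c S) <= n%:R.
Proof.
apply: le_trans sum_nsq_c; rewrite (bigD1 S)//= lerDl.
by apply: sumr_ge0 => S' _; exact: nsq_ge0.
Qed.

(** Two distinct sets have a last index at which they differ. It lies in one of them, and passing to
    the adjoint exchanges their roles. *)
Lemma E_offdiag_neq (S S' : {set 'I_m}) : S != S' ->
  (\int[P]_w (nsq (cW S w *m (cW S' w) ^t*))%:E <=
   (K ^+ m * K ^+ m * (2 * n%:R ^+ 2) / p%:R)%:E)%E.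
Proof.
move=> SS'.
have bnd A B : ((K ^+ m * K ^+ m * (nsq (c A) ^+ 2 + nsq (c B) ^+ 2) / p%:R)%:E <=
    (K ^+ m * K ^+ m * (2 * n%:R ^+ 2) / p%:R)%:E)%E.
  rewrite lee_fin ler_wpM2r ?invr_ge0// ler_wpM2l ?mulr_ge0 ?exprn_ge0//.
  have h A' : nsq (c A') ^+ 2 <= n%:R ^+ 2.
    by rewrite ler_pXn2r ?nnegrE ?nsq_ge0// nsq_c_le.
  by rewrite [leRHS]mulr_natl mulr2n lerD// h.
have [i0 hi0] : exists i, (i \in S) != (i \in S').
  apply/existsP; rewrite -negb_forall; apply: contra SS' => /forallP h.
  by apply/eqP/finset.setP => i; apply/eqP.
have [i hi imax] := @arg_maxnP _ i0
  (fun i => (i \in S) != (i \in S')) (fun i : 'I_m => i : nat) hi0.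
have eqS (j : 'I_m) : (i < j)%N -> (j \in S) = (j \in S').
  by move=> ij; apply/eqP; apply: contraLR ij => /imax; rewrite -leqNgt.
have [iS|iS] := boolP (i \in S).
  have iS' : i \notin S' by move: hi; rewrite iS; case: (i \in S').
  apply: le_trans (bnd S S').
  exact: (E_offdiag c2_ge1 momG modelGH p_gt0 (c S) (c S') iS iS' eqS).
have iS' : i \in S' by move: hi; rewrite (negbTE iS); case: (i \in S').
apply: le_trans (bnd S' S).
have eqS' (j : 'I_m) : (i < j)%N -> (j \in S') = (j \in S) by move=> /eqS.
apply: le_trans (E_offdiag c2_ge1 momG modelGH p_gt0 (c S') (c S) iS' iS eqS').
apply: le_integral_ge0 => w; first by rewrite lee_fin nsq_ge0.
have swap (A B : M) : nsq (A *m B ^t*) = nsq (B *m A ^t*).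
  by rewrite -nsq_adj adjM trmxCK.
by rewrite (swap (cW S w)); exact: lexx.
Qed.

Let sumW (lam : {set 'I_m} -> R) w : M := \sum_S (lam S)%:C *: cW S w.

Let msumW lam : mxmeas (sumW lam).
Proof. by apply: mxmeas_sum => S _; exact: mxmeas_scale. Qed.

Lemma E_nsq_sumW lam :
  (\int[P]_w (nsq (sumW lam w))%:E <= (\sum_S lam S ^+ 2 * nsq (c S))%:E)%E.
Proof.
have bT : @below m m =1 xpredT by move=> S; apply/belowP => i _.
have h := E_nsq_sum momG modelGH (fun S => (lam S)%:C *: c S) (leqnn m).
rewrite (eq_bigl _ _ bT) in h.
apply: le_trans (le_trans h _).
  apply: le_integral_ge0 => w; first by rewrite lee_fin nsq_ge0.
  rewrite lee_fin le_eqVlt; apply/orP; left; apply/eqP; congr nsq.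
  rewrite [RHS](eq_bigl _ _ bT); apply: eq_bigr => S _.
  by rewrite -scalemxAl.
by rewrite lee_fin; apply: ler_sum => S _; rewrite nsqZr.
Qed.

Let offsum (lam : {set 'I_m} -> R) w : M :=
  \sum_(z : {set 'I_m} * {set 'I_m} | z.2 != z.1)
    (lam z.1 * lam z.2)%:C *: (cW z.1 w *m (cW z.2 w) ^t*).

Let moffsum lam : mxmeas (offsum lam).
Proof.
apply: mxmeas_sum => z _; apply: mxmeas_scale.
by apply: mxmeas_mul => //; exact: mxmeas_adj.
Qed.

Lemma sumW_sqr lam w : sumW lam w *m (sumW lam w) ^t* -
    \sum_S (lam S ^+ 2)%:C *: (c S *m (c S) ^t*) =
  Zf G H (fun S => lam S ^+ 2) c m w + offsum lam w.
Proof.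
rewrite /Zf addrAC; congr (_ - _).
rewrite /sumW adj_sum mulmx_suml.
transitivity (\sum_S \sum_S' (lam S * lam S')%:C *: (cW S w *m (cW S' w) ^t*)).
  apply: eq_bigr => S _; rewrite mulmx_sumr; apply: eq_bigr => S' _.
  rewrite adjZ -scalemxAl -scalemxAr scalerA; congr (_ *: _).
  by rewrite rmorphM; congr (_ * _); exact: conjc_real.
rewrite /offsum -(pair_big_dep xpredT (fun S S' : {set 'I_m} => S' != S)
  (fun S S' => (lam S * lam S')%:C *: (cW S w *m (cW S' w) ^t*))) -big_split /=.
by apply: eq_bigr => S _; rewrite (bigD1 S)//= expr2.
Qed.

(** There are at most [4^m] ordered pairs. Cauchy-Schwarz over them costs one factor [4^m], and
    summing their bounds costs another. *)
Lemma E_offsum lam : (forall S, 0 <= lam S <= 1) ->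
  (\int[P]_w (nsq (offsum lam w))%:E <=
   (4 ^+ m * (4 ^+ m * (K ^+ m * K ^+ m * (2 * n%:R ^+ 2) / p%:R)))%:E)%E.
Proof.
move=> lam1; set b := (K ^+ m * K ^+ m * _ / _).
have b0 : 0 <= b by rewrite divr_ge0 ?mulr_ge0 ?exprn_ge0 ?sqr_ge0.
have card4 : \sum_(z : {set 'I_m} * {set 'I_m} | z.2 != z.1) (1 : R) <= 4 ^+ m.
  apply: (@le_trans _ _ (\sum_(z : {set 'I_m} * {set 'I_m}) (1 : R))).
    by rewrite [leRHS](bigID (fun z : {set 'I_m} * {set 'I_m} => z.2 != z.1)) /= lerDl sumr_ge0.
  have c2m : #|{: {set 'I_m}}| = (2 ^ m)%N.
    by rewrite -cardsT -powersetT card_powerset cardsT card_ord.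
  by rewrite sumr_const card_prod c2m -expnMn natrX.
pose F (z : {set 'I_m} * {set 'I_m}) w : R :=
  if z.2 != z.1 then nsq (cW z.1 w *m (cW z.2 w) ^t*) else 0.
have F0 z w : 0 <= F z w by rewrite /F; case: ifP => // _; exact: nsq_ge0.
have mF z : measurable_fun setT (F z).
  case zz : (z.2 != z.1); last first.
    by rewrite (_ : F z = cst 0)//; apply/funext => w; rewrite /F zz.
  rewrite (_ : F z = fun w => nsq (cW z.1 w *m (cW z.2 w) ^t*)); last first.
    by apply/funext => w; rewrite /F zz.
  by apply: measurable_nsq; apply: mxmeas_mul => //; exact: mxmeas_adj.
apply: (@le_trans _ _ (\int[P]_w (4 ^+ m * \sum_z F z w)%:E)%E).
  apply: le_integral_ge0 => w; first by rewrite lee_fin nsq_ge0.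
  rewrite lee_fin; apply: le_trans (nsq_sum_CS (al := fun=> 1) _ _ _) _ => //.
    by move=> z /eqP; rewrite oner_eq0.
  apply: ler_pM => //; [exact: sumr_ge0| |].
    by apply: sumr_ge0 => z _; rewrite mulr_ge0 ?nsq_ge0 ?invr_ge0.
  rewrite big_mkcond; apply: ler_sum => z _; rewrite /F; case: ifP => // _.
  rewrite invr1 mul1r nsqZr ler_piMl ?nsq_ge0//.
  have /andP[a0 a1] := lam1 z.1; have /andP[b0' b1] := lam1 z.2.
  by rewrite expr_le1 ?mulr_ge0// mulr_ile1.
under eq_integral do rewrite EFinM.
rewrite ge0_integralZl//; last 2 first.
- by apply/measurable_EFinP; exact: measurable_sum.
- by move=> w _; rewrite lee_fin sumr_ge0.
rewrite [leRHS]EFinM lee_wpmul2l ?lee_fin ?exprn_ge0//.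
under eq_integral do rewrite -sumEFin.
rewrite ge0_integral_sum//; last 2 first.
- by move=> z; exact/measurable_EFinP.
- by move=> z w _; rewrite lee_fin.
apply: (@le_trans _ _ (\sum_(z : {set 'I_m} * {set 'I_m} | z.2 != z.1) b%:E)%E).
  rewrite [leRHS]big_mkcond; apply: lee_sum => z _; rewrite /F.
  case: ifP => [zz|_]; last by rewrite integral_cst_prob.
  by apply: E_offdiag_neq; rewrite eq_sym.
rewrite sumEFin lee_fin.
have -> : \sum_(z : {set 'I_m} * {set 'I_m} | z.2 != z.1) b =
    (\sum_(z : {set 'I_m} * {set 'I_m} | z.2 != z.1) 1) * b.
  by rewrite mulr_suml; apply: eq_bigr => z _; rewrite mul1r.
by rewrite ler_wpM2r.
Qed.

Lemma TQiota_sumW (r : R) (Q : pred {set 'I_m}) w :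
  TQiota r f (fun i => GH G H i w) =
  sumW (fun S => if Q S then r ^+ #|S| else 0) w +
  sumW (fun S => if Q S then 0 else r ^+ #|S|) w.
Proof.
rewrite /TQiota /sumW -big_split; apply: eq_bigr => S _ /=.
rewrite -scalerDl -rmorphD /= prod_GH.
by case: ifP => _; rewrite ?addr0 ?add0r.
Qed.

Lemma E_nsq_Qiota :
  (\int[P]_w (nsq (Qiota f (fun i => GH G H i w) : M))%:E <= n%:R%:E)%E.
Proof.
have QE w : Qiota f (fun i => GH G H i w) = sumW (fun=> 1) w.
  by apply: eq_bigr => S _; rewrite prod_GH scale1r.
under eq_integral do rewrite QE.
apply: le_trans (E_nsq_sumW _) _; rewrite lee_fin.
apply: le_trans sum_nsq_c; apply: ler_sum => S _.
by rewrite expr1n mul1r.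
Qed.

Let J : 'M[C]_(n, p) := incl.

Let proj_sumW lam w : J ^t* *m J *m sumW lam w = sumW lam w.
Proof.
rewrite /sumW mulmx_sumr; apply: eq_bigr => S _.
by rewrite -scalemxAr /cW mulmxA proj_iotamx.
Qed.

Section Truncation.
Variables (dd : nat) (t : R).
Hypothesis t_gt0 : 0 < t.

Let lamL (S : {set 'I_m}) : R := if (#|S| <= dd)%N then rho ^+ #|S| else 0.
Let lamT (S : {set 'I_m}) : R := if (#|S| <= dd)%N then 0 else rho ^+ #|S|.

Let rhoX01 q : 0 <= rho ^+ q <= 1.
Proof. by rewrite exprn_ge0//= exprn_ile1. Qed.

Let lamL01 S : 0 <= lamL S <= 1.
Proof. by rewrite /lamL; case: ifP => _; rewrite ?rhoX01// lexx ler01. Qed.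

Let lamL2_01 S : 0 <= lamL S ^+ 2 <= 1.
Proof. by have /andP[h0 h1] := lamL01 S; rewrite sqr_ge0 expr_le1. Qed.

(** The sum of the squares [s_i^2] is at most the sum of the [s_i] times their maximum, which is at
    most the maximal influence. The sum of the [s_i] counts each [S] with multiplicity
    [|S| <= dd]. *)
Lemma E_diag_maxInf :
  (\int[P]_w (nsq (Zf G H (fun S => lamL S ^+ 2) c m w))%:E <=
   (K ^+ dd * (maxInf f * (dd%:R * n%:R)))%:E)%E.
Proof.
apply: le_trans (E_diag c2_ge1 momG modelGH p_gt0 c (dd := dd) _ _) _ => [S|S Sd|].
- by rewrite sqr_ge0.
- by rewrite /lamL leqNgt Sd expr0n.
rewrite lee_fin ler_wpM2l ?exprn_ge0//.
pose s (i : 'I_m) := \sum_(S : {set 'I_m} | i \in S) lamL S ^+ 2 * nsq (c S).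
have s0 i : 0 <= s i.
  by apply: sumr_ge0 => S _; rewrite mulr_ge0 ?sqr_ge0 ?nsq_ge0.
have sle i : s i <= maxInf f.
  apply: le_trans (influence_le_maxInf f i); apply: ler_sum => S _.
  rewrite nsq_fhat_tr /c nsq_iotamx//.
  by have /andP[_ h1] := lamL2_01 S; rewrite ler_piMl ?nsq_ge0.
have tau0 : 0 <= maxInf f.
  exact: bigmax_ge_id.
apply: (@le_trans _ _ (maxInf f * \sum_i s i)).
  rewrite mulr_sumr; apply: ler_sum => i _; rewrite expr2.
  by rewrite -/(s i) ler_wpM2r.
rewrite ler_wpM2l//.
have -> : \sum_i s i = \sum_(S : {set 'I_m}) #|S|%:R * (lamL S ^+ 2 * nsq (c S)).
  rewrite /s (exchange_big_dep xpredT)//=; apply: eq_bigr => S _.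
  by rewrite sumr_const mulr_natl.
apply: (@le_trans _ _ (\sum_S dd%:R * nsq (c S))); last first.
  by rewrite -mulr_sumr ler_wpM2l// sum_nsq_c.
apply: ler_sum => S _; have /andP[h0 h1] := lamL2_01 S.
have [Sd|Sd] := leqP #|S| dd; last first.
  by rewrite /lamL leqNgt Sd expr0n mul0r mulr0 mulr_ge0 ?nsq_ge0.
apply: ler_pM => //; first by rewrite mulr_ge0 ?nsq_ge0.
- by rewrite ler_nat.
- by rewrite ler_piMl ?nsq_ge0.
Qed.

Lemma E_tail : (\int[P]_w (nsq (sumW lamT w))%:E <= ((rho ^+ dd.+1) ^+ 2 * n%:R)%:E)%E.
Proof.
apply: le_trans (E_nsq_sumW _) _; rewrite lee_fin.
apply: (@le_trans _ _ (\sum_S (rho ^+ dd.+1) ^+ 2 * nsq (c S))); last first.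
  by rewrite -mulr_sumr ler_wpM2l ?sqr_ge0// sum_nsq_c.
apply: ler_sum => S _; rewrite ler_wpM2r ?nsq_ge0// /lamT.
case: leqP => Sd; first by rewrite expr0n sqr_ge0.
by rewrite ler_pXn2r ?nnegrE ?exprn_ge0// ler_wiXn2l.
Qed.

(** At each outcome [chop_excess_le] applies, with the degrees up to [dd] as [L], the higher ones as
    [T], and the corner projection, of square norm [n], as [Pi]. Measurability is only needed of the
    resulting bound, whose terms are integrated one by one. The 2 in [2 / t] comes from separating
    the diagonal and off-diagonal errors. *)
Lemma E_chop :
  (\int[P]_w (nsq (TQiota rho f (fun i => GH G H i w) -
      chopmx (TQiota rho f (fun i => GH G H i w)) : M))%:E <=
   (2 / t * (K ^+ dd * (maxInf f * (dd%:R * n%:R))) +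
    (2 / t * (4 ^+ m * (4 ^+ m * (K ^+ m * K ^+ m * (2 * n%:R ^+ 2) / p%:R))) +
     (n%:R * t + 2 * ((rho ^+ dd.+1) ^+ 2 * n%:R))))%:E)%E.
Proof.
pose Z w := Zf G H (fun S => lamL S ^+ 2) c m w.
have mZ : mxmeas Z.
  apply: mxmeas_add; last exact: mxmeas_cst.
  apply: mxmeas_sum => S _; apply: mxmeas_scale.
  by apply: mxmeas_mul; [exact: mcW|apply: mxmeas_adj; exact: mcW].
have t2 : 0 <= 2 / t by rewrite divr_ge0// ltW.
apply: (@le_trans _ _ (\int[P]_w (2 / t * nsq (Z w) + (2 / t * nsq (offsum lamL w) +
    (n%:R * t + 2 * nsq (sumW lamT w))))%:E)%E).
  apply: le_integral_ge0 => w; first by rewrite lee_fin nsq_ge0.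
  rewrite lee_fin (TQiota_sumW rho (fun S => #|S| <= dd)%N) -/lamL -/lamT.
  have PiA : J ^t* *m J *m (sumW lamL w + sumW lamT w) = sumW lamL w + sumW lamT w.
    by rewrite mulmxDr !proj_sumW.
  have B1 := fun v => ip_sum_iotamx np v f1 lamL2_01.
  apply: le_trans (chop_excess_le t_gt0 PiA erefl B1) _.
  rewrite nsq_proj// -/c sumW_sqr -/(Z w).
  have := nsqD_le2 (Z w) (offsum lamL w); set u := nsq (Z w + _).
  move=> /(ler_wpM2r (x := t^-1)); rewrite invr_ge0 ltW// => /(_ isT) h.
  rewrite !addrA lerD2r lerD2r -mulrDr; apply: (le_trans h).
  by rewrite le_eqVlt; apply/orP; left; apply/eqP; rewrite mulrAC.
have mo : measurable_fun setT (fun w => nsq (offsum lamL w)) by exact: measurable_nsq.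
have mT : measurable_fun setT (fun w => nsq (sumW lamT w)) by exact: measurable_nsq.
have mZ' : measurable_fun setT (fun w => nsq (Z w)) by exact: measurable_nsq.
have iD (g h : Omega -> R) (x y : R) : (forall w, 0 <= g w) -> (forall w, 0 <= h w) ->
    measurable_fun setT g -> measurable_fun setT h ->
    (\int[P]_w (g w)%:E <= x%:E -> \int[P]_w (h w)%:E <= y%:E ->
     \int[P]_w (g w + h w)%:E <= (x + y)%:E)%E.
  move=> g0 h0 mg mh gx hy; under eq_integral do rewrite EFinD.
  rewrite ge0_integralD//; last 4 first.
  - by move=> w _; rewrite lee_fin.
  - exact/measurable_EFinP.
  - by move=> w _; rewrite lee_fin.
  - exact/measurable_EFinP.
  by rewrite EFinD; exact: leeD.
have iZ (z : R) (g : Omega -> R) (x : R) : 0 <= z -> (forall w, 0 <= g w) ->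
    measurable_fun setT g -> (\int[P]_w (g w)%:E <= x%:E ->
     \int[P]_w (z * g w)%:E <= (z * x)%:E)%E.
  move=> z0 g0 mg gx; under eq_integral do rewrite EFinM.
  rewrite ge0_integralZl//; last 2 first.
  - exact/measurable_EFinP.
  - by move=> w _; rewrite lee_fin.
  by rewrite EFinM lee_wpmul2l// lee_fin.
have nt0 : 0 <= n%:R * t by rewrite mulr_ge0// ltW.
have z0 (F : Omega -> M) w : 0 <= 2 / t * nsq (F w) by rewrite mulr_ge0 ?nsq_ge0.
have mz (F : Omega -> M) : mxmeas F -> measurable_fun setT (fun w => 2 / t * nsq (F w)).
  by move=> mF; apply: measurable_funM => //; exact: measurable_nsq.
have mT2 : measurable_fun setT (fun w => n%:R * t + 2 * nsq (sumW lamT w)).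
  by apply: measurable_funD => //; exact: measurable_funM.
have T0 w : 0 <= n%:R * t + 2 * nsq (sumW lamT w).
  by apply: addr_ge0 => //; rewrite mulr_ge0 ?nsq_ge0.
apply: (iD).
- exact: z0.
- by move=> w; rewrite addr_ge0// z0.
- exact: mz.
- by apply: measurable_funD => //; exact: mz.
- by apply: iZ => //; [move=> w; exact: nsq_ge0|exact: E_diag_maxInf].

apply: (iD).
- exact: z0.
- exact: T0.
- exact: mz.
- exact: mT2.
- by apply: iZ => //; [move=> w; exact: nsq_ge0|exact: E_offsum].
apply: (iD).
- by [].
- by move=> w; rewrite mulr_ge0 ?nsq_ge0.
- exact: measurable_cst.
- exact: measurable_funM.
- by rewrite integral_cst_prob.
- by apply: iZ => //; [move=> w; exact: nsq_ge0|exact: E_tail].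
Qed.

(** [chop_excess_le] with [L = 0], [B = 0] and [t = 1] leaves [n] plus twice the square norm of the
    whole polynomial. *)
Lemma E_chop_trivial :
  (\int[P]_w (nsq (TQiota rho f (fun i => GH G H i w) -
      chopmx (TQiota rho f (fun i => GH G H i w)) : M))%:E <= (3 * n%:R)%:E)%E.
Proof.
apply: (@le_trans _ _ (\int[P]_w (n%:R + 2 * nsq (sumW (fun S => rho ^+ #|S|) w))%:E)%E).
  apply: le_integral_ge0 => w; first by rewrite lee_fin nsq_ge0.
  rewrite lee_fin (TQiota_sumW rho xpredT) /=.
  have -> : sumW (fun=> 0) w = 0 by rewrite /sumW big1// => S _; rewrite scale0r.
  rewrite addr0; set A := sumW _ w.
  have PiA : J ^t* *m J *m A = A by exact: proj_sumW.
  have AE : A = 0 + A by rewrite add0r.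
  have B1 (v : 'rV[C]_p) : ip (v *m 0) v <= nsq v by rewrite mulmx0 ip0l nsq_ge0.
  apply: le_trans (chop_excess_le ltr01 PiA AE B1) _.
  by rewrite mul0mx subr0 nsq0 mul0r add0r nsq_proj// mulr1.
have mT : measurable_fun setT (fun w => nsq (sumW (fun S => rho ^+ #|S|) w)).
  exact: measurable_nsq.
under eq_integral do rewrite EFinD.
rewrite ge0_integralD//; last 2 first.
- by move=> w _; rewrite lee_fin mulr_ge0 ?nsq_ge0.
- by apply/measurable_EFinP; exact: measurable_funM.
rewrite integral_cst_prob.
have -> : 3 * n%:R = n%:R + 2 * n%:R :> R by ring.
rewrite [leRHS]EFinD leeD2l//; under eq_integral do rewrite EFinM.
rewrite ge0_integralZl//; last 2 first.
- exact/measurable_EFinP.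
- by move=> w _; rewrite lee_fin nsq_ge0.
rewrite [leRHS]EFinM lee_wpmul2l// ?lee_fin//.
apply: le_trans (E_nsq_sumW _) _; rewrite lee_fin.
apply: le_trans sum_nsq_c; apply: ler_sum => S _.
have /andP[h0 h1] := rhoX01 #|S|.
by rewrite ler_piMl ?nsq_ge0// expr_le1.
Qed.

End Truncation.

End Assembly.

(** * Choice of the degree and absorption of [c2] *)

Section Numerics.
Context {R : realType}.

Lemma powR_expR (tau a : R) : 0 < tau -> tau `^ a = expR (- (a * - ln tau)).
Proof. by move=> t0; rewrite /powR gt_eqF// mulrN opprK. Qed.

Lemma expR_ge_id (x : R) : x <= expR x.
Proof. by apply: le_trans (expR_ge1Dx x); rewrite lerDr. Qed.

(** Let [l = ln (1 / tau)] and [x = l / (60 c2 c3)], so that [th l = 2 (1 - rho) x], and let [dd] be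
    the integer part of [x]. Then [dd + 1 > x] gives the damping. The growth is bounded by [(3
    c2)^dd <= exp (3 c2 x) <= exp (l / 20)], from the crude [3 c2 <= exp (3 c2)]; this is what puts
    [c2] into the exponent of [tau]. *)
Lemma degree_choice (tau rho c2 c3 : R) (th := (1 - rho) / (30 * c2 * c3)) :
  0 < tau -> tau < 1 -> 0 < rho -> rho < 1 -> 1 <= c2 -> 1 <= c3 ->
  exists dd : nat, (rho ^+ dd.+1) ^+ 2 <= tau `^ th /\
    (3 * c2) ^+ dd * (tau * dd%:R) <= (tau `^ th) ^+ 2.
Proof.
move=> tau0 tau1 rho0 rho1 c21 c31.
set l := - ln tau.
have l0 : 0 < l by rewrite oppr_gt0 ln_lt0// tau0.
have c20 : 0 < c2 by exact: lt_le_trans c21.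
have c30 : 0 < c3 by exact: lt_le_trans c31.
have cc1 : 1 <= c2 * c3 by rewrite mulr_ege1.
have cc0 : 0 < c2 * c3 by rewrite mulr_gt0.
pose x := l / (60 * (c2 * c3)).
have x0 : 0 < x by rewrite divr_gt0// mulr_gt0.
have xl : x <= l / 60.
  by rewrite ler_pM2l// lef_pV2 ?posrE ?mulr_gt0// ler_peMr.
have /andP[dx xd] := truncn_itv (ltW x0).
move: (Num.trunc x) dx xd => dd dx xd.
have thE : th * l = (1 - rho) * (2 * x).
  by rewrite /th /x; field; rewrite !gt_eqF.
have r1 : 0 < 1 - rho by rewrite subr_gt0.
exists dd; rewrite (powR_expR _ tau0) -/l; split.
  apply: (@le_trans _ _ (expR (- (1 - rho)) ^+ (dd.+1 * 2))).
    rewrite exprM ler_pXn2r ?nnegrE ?exprn_ge0 ?expR_ge0 ?(ltW rho0)//.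
    rewrite ler_pXn2r ?nnegrE ?expR_ge0 ?(ltW rho0)//.
    by apply: le_trans (expR_ge1Dx _); lra.
  rewrite -expRM_natl ler_expR thE natrM.
  have h : (1 - rho) * x <= (1 - rho) * dd.+1%:R by rewrite ler_wpM2l ?(ltW r1) ?(ltW xd).
  move: h; move: (dd.+1%:R : R) => z; lra.
rewrite -expRM_natl.
have tauE : tau = expR (- l) by rewrite /l opprK lnK// posrE.
have K0 : 0 <= 3 * c2 by rewrite mulr_ge0// ltW.
have h1 : (3 * c2) ^+ dd <= expR (l / 20).
  apply: (@le_trans _ _ (expR (3 * c2) ^+ dd)).
    by rewrite lerXn2r ?nnegrE ?expR_ge0// expR_ge_id.
  rewrite -expRM_natl ler_expR; apply: (@le_trans _ _ (x * (3 * c2))).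
    by rewrite ler_wpM2r.
  have -> : x * (3 * c2) = l / 20 / c3 by rewrite /x; field; rewrite !gt_eqF.
  by rewrite ler_pdivrMr// ler_peMr// divr_ge0// ltW.
have h2 : dd%:R <= expR (l / 60).
  by apply: le_trans dx _; apply: le_trans xl _; exact: expR_ge_id.
apply: (@le_trans _ _ (expR (l / 20) * (expR (- l) * expR (l / 60)))).
  apply: ler_pM.
  - exact: exprn_ge0.
  - by rewrite mulr_ge0// ltW.
  - exact: h1.
  - by rewrite -tauE ler_wpM2l// ltW.
rewrite -!expRD ler_expR thE.
(* The claim needs [2 th l <= 4 x <= l / 15] to be at most [l - l / 20 - l / 60 = 14 l / 15]. *)
have : (1 - rho) * x <= x by rewrite ler_piMl// ?(ltW x0)//; lra.
by move: xl l0; lra.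
Qed.

(** The last hypothesis forces [15 c2 c3 < l = ln (1 / tau)], hence [3 c2 <= l]. The [m]-th power of
    [l / (3 m) <= exp (l / (3 m))] then has [exp (l / 3) = tau^(-1/3)] on its right. *)
Lemma pow_logarithm_le (m : nat) (tau rho c2 c3 : R)
    (th := (1 - rho) / (30 * c2 * c3)) : (0 < m)%N ->
  0 < tau -> 0 < rho -> rho < 1 -> 1 <= c2 -> 1 <= c3 ->
  2^-1 < th * - ln tau ->
  (3 * c2) ^+ m <= (3 * m%:R) ^+ m * tau `^ (- 3^-1).
Proof.
move=> m0 tau0 rho0 rho1 c21 c31; set l := - ln tau => thl.
have c20 : 0 < c2 by exact: lt_le_trans c21.
have c30 : 0 < c3 by exact: lt_le_trans c31.
have cc0 : 0 < 30 * c2 * c3 by rewrite !mulr_gt0.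
have l0 : 0 < l.
  rewrite ltNge; apply/negP => l0.
  have th0 : 0 <= th by apply: divr_ge0; [rewrite subr_ge0 ltW|exact: ltW].
  have : th * l <= 0 by rewrite mulr_ge0_le0.
  by move: thl; lra.
have c2l : 3 * c2 <= l.
  have h : 2^-1 * (30 * c2 * c3) < (1 - rho) * l.
    by rewrite -ltr_pdivlMr// mulrAC.
  have h2 : (1 - rho) * l <= l by rewrite ler_piMl ?(ltW l0)//; lra.
  have h3 : c2 <= c2 * c3 by rewrite ler_peMr// ltW.
  have h4 : 2^-1 * (30 * c2 * c3) = 15 * (c2 * c3) by field.
  by rewrite h4 in h; lra.
have mm : (0 : R) < 3 * m%:R by rewrite mulr_gt0// ltr0n.
have tE : tau `^ (- 3^-1) = expR (l / (3 * m%:R)) ^+ m.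
  rewrite (powR_expR _ tau0) -/l -expRM_natl; congr expR.
  by field; rewrite pnatr_eq0 -lt0n.
rewrite tE -exprMn lerXn2r ?nnegrE ?mulr_ge0 ?expR_ge0 ?(ltW mm) ?(ltW c20)//.
apply: (le_trans c2l); rewrite -ler_pdivrMl// mulrC; exact: expR_ge_id.
Qed.

End Numerics.

(** * Combination of the estimates *)

Lemma L2norm_sqr (R : realType) d (T : measurableType d) (P : probability T R)
    (m p : nat) (X : 'I_m -> T -> 'M[R[i]]_p)
    (F : ('I_m -> 'M[R[i]]_p) -> 'M[R[i]]_p) :
  (L2norm P X F ^+ 2 = \int[P]_w (nsq (F (X ^~ w)))%:E)%E.
Proof.
have -> : (\int[P]_w (nsq (F (X ^~ w)))%:E = 'E_P[fun w => trabs2 (F (X ^~ w))])%E.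
  by rewrite unlock; apply: eq_integral => w _; rewrite trabs2E.
rewrite /L2norm poweR12_sqrt ?sqr_sqrte//; apply: expectation_ge0 => w;
  by rewrite trabs2E nsq_ge0.
Qed.

(** [q / t <= X] because [q <= X^2] and [t >= X]; [y^2 / t <= y] because [t >= y]. The sum is at
    most [2 X + 4 y + (X + y) + 2 X]. *)
Lemma trade_off (R : realType) (q nn Kd4 X y S t : R) :
  0 < nn -> 0 < X -> 0 < y -> t = X + y -> q <= X ^+ 2 -> S <= X ->
  nn * (nn * Kd4) = nn * y ^+ 2 ->
  nn^-1 * (2 / t * (q * nn) + (2 / t * (2 * (nn * (nn * Kd4))) + (nn * t + 2 * (S * nn))))
    <= 5 * X + 5 * y.
Proof.
move=> n0 X0 y0 tE qX SX ->.
have t0 : 0 < t by rewrite tE addr_gt0.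
have -> : nn^-1 * (2 / t * (q * nn) + (2 / t * (2 * (nn * y ^+ 2)) + (nn * t + 2 * (S * nn)))) =
    2 * (q / t) + 4 * (y ^+ 2 / t) + t + 2 * S.
  by field; rewrite !gt_eqF.
have h1 : q / t <= X.
  rewrite ler_pdivrMr//; apply: (le_trans qX); rewrite expr2 ler_pM2l// tE.
  by rewrite lerDl ltW.
have h2 : y ^+ 2 / t <= y.
  by rewrite ler_pdivrMr// expr2 ler_pM2l// tE lerDr ltW.
by rewrite tE in h1 h2 *; lra.
Qed.

Theorem corollary3p8 (R : realType) (m n : nat) (m_gt0 : (0 < m)%N)
    (n_gt0 : (0 < n)%N) :
  exists C : R, 0 < C /\
  forall (k : nat) (f : {ffun 'I_m -> bool} -> 'M[R[i]]_n) (rho c2 c3 : R)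
    (calG : probability (cmx R n) R)
    (d : measure_display) (Omega : measurableType d) (P : probability Omega R)
    (G : 'I_m -> {RV P >-> cmx R n})
    (H : 'I_m -> {RV P >-> cmx R (n * k)%N}),
  let p := (n * k)%N in
  let tau := maxInf f in
  (0 < k)%N ->
  (forall b, opnorm (f b) <= 1) ->
  0 < rho -> rho < 1 ->
  0 < tau ->
  1 <= c2 -> 1 <= c3 ->
  moment_conditions c2 c3 calG ->
  GH_model calG G H ->
  ((n%:R^-1)%:E * L2norm P (GH G H) (Qiota (p := p) f) ^+ 2 <= 1)%E /\
  ((n%:R^-1)%:E *
     L2norm P (GH G H)
       (fun X => (TQiota (p := p) rho f X - chopmx (TQiota (p := p) rho f X))%R)
     ^+ 2
   <= (10 * n%:R `^ 2^-1 * tau `^ ((1 - rho) / (30 * c2 * c3))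
       + C * (tau `^ (- 3^-1) * p%:R `^ (- 2^-1)))%R%:E)%E.
Proof.
(* Chosen so that [C tau^(-1/3) p^(-1/2)] is [5 y], for the [y] below, with [(3 c2)^m] replaced by
   its bound from [pow_logarithm_le]. *)
pose C : R := 5 * 4 ^+ m * Num.sqrt n%:R * (3 * m%:R) ^+ m.
have nR0 : (0 : R) < n%:R by rewrite ltr0n.
have C0 : 0 < C.
  by rewrite !mulr_gt0 ?exprn_gt0 ?sqrtr_gt0 ?mulr_gt0 ?ltr0n.
exists C; split => // k f rho c2 c3 calG d Omega P G H p tau k_gt0 f1 rho0 rho1 tau0
  c21 c31 momG modelGH.
have p0 : (0 < p)%N by rewrite muln_gt0 n_gt0.
have pR0 : (0 : R) < p%:R by rewrite ltr0n.
have nV0 : (0 : R) <= n%:R^-1 by rewrite invr_ge0 ltW.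
split; rewrite (L2norm_sqr P (GH G H)).
  apply: (@le_trans _ _ ((n%:R^-1)%:E * n%:R%:E)%E); last first.
    by rewrite -EFinM mulVf// gt_eqF.
  rewrite lee_wpmul2l ?lee_fin//.
  exact: (E_nsq_Qiota momG modelGH k_gt0 f1).
set th := (1 - rho) / (30 * c2 * c3); set X := tau `^ th.
have X0 : 0 < X by rewrite powR_gt0.
have sn1 : 1 <= Num.sqrt n%:R :> R.
  by rewrite -[leLHS]sqrtr1 ler_sqrt ?ler1n.
have sp0 : 0 < Num.sqrt p%:R :> R by rewrite sqrtr_gt0.
have snE : n%:R `^ 2^-1 = Num.sqrt n%:R :> R by rewrite powR12_sqrt.
have spE : p%:R `^ (- 2^-1) = (Num.sqrt p%:R)^-1 :> R by rewrite powRN powR12_sqrt.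
rewrite snE spE.
have err0 : 0 <= C * (tau `^ (- 3^-1) * (Num.sqrt p%:R)^-1).
  by rewrite mulr_ge0 ?(ltW C0)// mulr_ge0 ?powR_ge0// invr_ge0 ltW.
(* In the first case [X >= exp (- 1/2) >= 1/2], so the right-hand side is at least 5, while the
   trivial bound is 3. *)
have [thl|thl] := leP (th * - ln tau) 2^-1.
  apply: (@le_trans _ _ ((n%:R^-1)%:E * (3 * n%:R)%:E)%E).
    rewrite lee_wpmul2l ?lee_fin//.
    exact: (E_chop_trivial momG modelGH k_gt0 f1 (ltW rho0) (ltW rho1)).
  rewrite -EFinM lee_fin mulrCA mulVf ?gt_eqF// mulr1.
  have X12 : 2^-1 <= X.
    rewrite /X (powR_expR _ tau0); apply: le_trans (expR_ge1Dx _).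
    by move: thl; lra.
  have : 10 * 1 * 2^-1 <= 10 * Num.sqrt n%:R * X by rewrite ler_pM// ler_pM2l.
  by move: err0; lra.
have tau1 : tau < 1.
  rewrite ltNge; apply/negP => tau1; have := ln_ge0 tau1 => l0.
  have th0 : 0 <= th.
    apply: divr_ge0; first by rewrite subr_ge0 ltW.
    by rewrite !mulr_ge0// ?(le_trans ler01 c21) ?(le_trans ler01 c31).
  have : th * - ln tau <= 0 by rewrite mulr_ge0_le0// oppr_le0.
  by move: thl; lra.
have [dd [tail low]] := degree_choice tau0 tau1 rho0 rho1 c21 c31.
rewrite -/th -/X in tail low.
have Kle := pow_logarithm_le m_gt0 tau0 rho0 rho1 c21 c31 thl.
have K0 : 0 < 3 * c2 by rewrite mulr_gt0// (lt_le_trans ltr01).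
(* Chosen so that the off-diagonal bound of [E_offsum] equals [2 n y^2]. *)
pose y := 4 ^+ m * (3 * c2) ^+ m * Num.sqrt n%:R * (Num.sqrt p%:R)^-1.
have y0 : 0 < y by rewrite !mulr_gt0 ?exprn_gt0 ?invr_gt0// (lt_le_trans ltr01).
pose t := X + y.
have t0 : 0 < t by rewrite addr_gt0.
have main := E_chop c21 momG modelGH n_gt0 k_gt0 f1 (ltW rho0) (ltW rho1) dd t0.
apply: (le_trans (lee_wpmul2l _ main)); first by rewrite lee_fin.
rewrite -EFinM lee_fin.
apply: (@le_trans _ _ (5 * X + 5 * y)).
  pose Kd4 : R := 4 ^+ m * 4 ^+ m * ((3 * c2) ^+ m * (3 * c2) ^+ m) / p%:R.
  have yE : n%:R * (n%:R * Kd4) = n%:R * y ^+ 2 :> R.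
    have n2 := sqr_sqrtr (ltW nR0); have p2 := sqr_sqrtr (ltW pR0).
    have sqE (a b s r : R) : (a * b * s * r^-1) ^+ 2 =
      a ^+ 2 * b ^+ 2 * s ^+ 2 * (r ^+ 2)^-1 by rewrite !exprMn exprVn.
    rewrite /y sqE n2 p2 /Kd4.
    by move: (4 ^+ m) ((3 * c2) ^+ m) (p%:R^-1) (n%:R : R) => a b r s; ring.
  apply: le_trans (trade_off nR0 X0 y0 (erefl t) low tail yE).
  rewrite le_eqVlt; apply/orP; left; apply/eqP; rewrite /Kd4 /tau -/p.
  move: (4 ^+ m) ((3 * c2) ^+ m) ((3 * c2) ^+ dd) (p%:R : R) (n%:R : R) (dd%:R : R)
    ((rho ^+ dd.+1) ^+ 2) (maxInf f) => a b b' q s e r v; ring.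
apply: lerD.
  rewrite ler_pM2r//; move: sn1; lra.
have -> : C * (tau `^ (- 3^-1) * (Num.sqrt p%:R)^-1) =
    5 * (4 ^+ m * ((3 * m%:R) ^+ m * tau `^ (- 3^-1)) * Num.sqrt n%:R * (Num.sqrt p%:R)^-1).
  by rewrite /C; ring.
rewrite ler_pM2l// /y ler_pM2r ?invr_gt0// ler_pM2r ?(lt_le_trans ltr01 sn1)//.
by rewrite ler_pM2l ?exprn_gt0.
Qed.
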